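(* Let $f\in\mathcal{S}$ be given by $f(z)=z+\sum_{n=2}^{\infty}a_nz^n$ for $|z|<1$, and suppose that $a_3=0$. Then (i) $|a_2|\le 1$; (ii) $|a_4|\le \dfrac14\sqrt{\dfrac{21}{5}}+\dfrac{5}{8}=1.1373\ldots$; (iii) $|a_5|\le c_3$, where $c_3=1.674896577\ldots$ is the constant defined in the context; (iv) $|H_2(2)|\le c_4$, where $c_4=1.1373\ldots$ is the constant defined in the context; (v) $|H_3(1)|\le c_5$, where $c_5=0.6647958756\ldots$ is the constant defined in the context.
   Context: $\mathbb{D}=\{z\in\mathbb{C}:|z|<1\}$ is the open unit disk. $\mathcal{S}$ is the class of functions $f$ that are analytic and univalent (injective) in $\mathbb{D}$ and have the form $f(z)=z+a_2z^2+a_3z^3+\cdots$ (i.e. $f(0)=0$, $f'(0)=1$). The second and third Hankel determinants of such an $f$ are $$H_2(2)=a_2a_4-a_3^2,$$ $$H_3(1)=a_3(a_2a_4-a_3^2)-a_4(a_4-a_2a_3)+a_5(a_3-a_2^2).$$ The constants are as follows (dots after a decimal indicate a truncated decimal expansion). With $R(x)=\sqrt{1-x^{2}-\frac{27}{4}x^{4}}$ for $0\le x\le \frac12$, $$c_3=\max_{0\le x\le 1/2}\left(\left(\frac{2}{\sqrt{7}}+\frac{6}{\sqrt{5}}x\right)R(x)+\frac{25}{4}x^{4}\right)=1.674896577\ldots,$$ $$c_4=\max_{0\le x\le 1/2}\left(\frac{4}{\sqrt{5}}\,x\,R(x)+10x^{4}\right)=1.1373\ldots,$$ $$c_5=\max_{0\le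 x\le 1/2}\left(\frac{1}{5}R(x)^2+\left(\frac{4}{\sqrt{5}}x^{3}+\frac{8}{\sqrt{7}}x^{2}\right)R(x)\right)=0.6647958756\ldots.$$ *)

(* Defs.v *)
From Stdlib Require Import Reals Lra.
From Coquelicot Require Import Coquelicot.
Open Scope R_scope.

Definition in_disk (z : C) : Prop := Cmod z < 1.

(* Analyticity is complex differentiability: [ex_derive] and [is_derive] are
   taken over the valued field C, not over R. *)
Definition class_S (f : C -> C) : Prop :=
  (forall z : C, in_disk z -> ex_derive (K := C_AbsRing) f z) /\
  (forall z w : C, in_disk z -> in_disk w -> f z = f w -> z = w) /\
  f (RtoC 0) = RtoC 0 /\
  is_derive (K := C_AbsRing) f (RtoC 0) (RtoC 1).

(* f(z) = z + sum_{n >= 2} a_n z^n on the disk; the entries a 0 and a 1 are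
   not used. *)
Definition has_expansion (f : C -> C) (a : nat -> C) : Prop :=
  forall z : C, in_disk z ->
    is_series (V := C_NormedModule)
      (fun k : nat => (a (k + 2)%nat * z ^ (k + 2))%C) (f z - z)%C.

Definition H2_2 (a : nat -> C) : C :=
  (a 2%nat * a 4%nat - a 3%nat ^ 2)%C.

Definition H3_1 (a : nat -> C) : C :=
  (a 3%nat * (a 2%nat * a 4%nat - a 3%nat ^ 2)
   - a 4%nat * (a 4%nat - a 2%nat * a 3%nat)
   + a 5%nat * (a 3%nat - a 2%nat ^ 2))%C.

Definition is_max_on (F : R -> R) (lo hi M : R) : Prop :=
  (exists x : R, lo <= x <= hi /\ F x = M) /\
  (forall x : R, lo <= x <= hi -> F x <= M).

(* The supremum of F over [lo, hi]; by [max_on_correct] it is the maximum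
   whenever F is continuous on [lo, hi]. *)
Definition max_on (F : R -> R) (lo hi : R) : R :=
  real (Lub_Rbar (fun y : R => exists x : R, lo <= x <= hi /\ y = F x)).

Lemma max_on_correct (F : R -> R) (lo hi : R) :
  lo <= hi ->
  (forall x : R, lo <= x <= hi -> continuity_pt F x) ->
  is_max_on F lo hi (max_on F lo hi).
Proof.
  intros Hle Hc.
  destruct (continuity_ab_maj F lo hi Hle Hc) as [m [Hm Hin]].
  assert (E : max_on F lo hi = F m).
  { unfold max_on.
    rewrite (is_lub_Rbar_unique _ (Finite (F m))); [reflexivity|].
    split.
    - intros y [x [Hx ->]]. exact (Hm x Hx).
    - intros b Hb. apply Hb. exists m. split; [exact Hin | reflexivity]. }
  rewrite E. split.
  - exists m. split; [exact Hin | reflexivity].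
  - exact Hm.
Qed.

Definition Rad (x : R) : R := sqrt (1 - x ^ 2 - 27 / 4 * x ^ 4).

Definition F3 (x : R) : R :=
  (2 / sqrt 7 + 6 / sqrt 5 * x) * Rad x + 25 / 4 * x ^ 4.

Definition F4 (x : R) : R :=
  4 / sqrt 5 * x * Rad x + 10 * x ^ 4.

Definition F5 (x : R) : R :=
  1 / 5 * Rad x ^ 2 + (4 / sqrt 5 * x ^ 3 + 8 / sqrt 7 * x ^ 2) * Rad x.

Definition c3 : R := max_on F3 0 (1 / 2).
Definition c4 : R := max_on F4 0 (1 / 2).
Definition c5 : R := max_on F5 0 (1 / 2).

Lemma Rad_continuous (x : R) : 0 <= x <= 1 / 2 -> continuity_pt Rad x.
Proof.
  intros Hx. unfold Rad.
  apply (continuity_pt_comp (fun x => 1 - x ^ 2 - 27 / 4 * x ^ 4) sqrt).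
  - reg.
  - apply continuity_pt_sqrt.
    assert (H2 : x ^ 2 <= 1 / 4) by nra.
    replace (x ^ 4) with (x ^ 2 * x ^ 2) by ring.
    assert (0 <= x ^ 2) by nra. nra.
Qed.

Lemma c3_is_max : is_max_on F3 0 (1 / 2) c3.
Proof.
  apply max_on_correct; [lra|]. intros x Hx.
  pose proof (Rad_continuous x Hx). unfold F3. reg.
Qed.

Lemma c4_is_max : is_max_on F4 0 (1 / 2) c4.
Proof.
  apply max_on_correct; [lra|]. intros x Hx.
  pose proof (Rad_continuous x Hx). unfold F4. reg.
Qed.

Lemma c5_is_max : is_max_on F5 0 (1 / 2) c5.
Proof.
  apply max_on_correct; [lra|]. intros x Hx.
  pose proof (Rad_continuous x Hx). unfold F5. reg.
Qed.

(* Main.v *)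
(* The bounds come from the area theorem, applied to 1/f(z) and to 1/sqrt(f(z^2)).
   Writing 1/f(z) = 1/z - a_2 + b_1 z + b_2 z^2 + ..., it gives
   |b_1|^2 + 2|b_2|^2 + 3|b_3|^2 <= 1; for a_3 = 0 one has b_1 = a_2^2 and
   H_3(1) = b_1 b_3 - b_2^2, hence |a_2| <= 1 and even |H_3(1)| <= 1/2.
   Writing 1/sqrt(f(z^2)) = (1 + k_1 z^2 + k_2 z^4 + ...)/z, it gives
   |k_1|^2 + 3|k_2|^2 + 5|k_3|^2 + 7|k_4|^2 <= 1, where a_3 = 0 forces
   k_2 = 3/2 k_1^2; since a_4, a_5 and H_2(2) are polynomials in k_1, k_3, k_4,
   their bounds are the maxima over x = |k_1| = |a_2|/2 in [0, 1/2].

   For the area theorem itself, an injective holomorphic G satisfies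
   int phi(G)|G'|^2 <= int phi for phi >= 0.  With G(z) = 1/z + O(z) on an annulus
   of inner radius 1/M and phi(w) = max(0, 1 - |w|^2/M^2) the terms of order M^2
   cancel as M grows, and Bessel's inequality for the rest is the area theorem;
   neither the boundary curve of the image nor Green's formula is needed. *)
Require Import Defs.
From Stdlib Require Import Reals Lra Lia ClassicalEpsilon.
From Coquelicot Require Import Coquelicot.
Open Scope R_scope.

(* Coquelicot states many equalities in a module type, which [ring] does not recognize. *)
Ltac real_eq := match goal with |- ?a = ?b => change (@eq R a b) end.

(** The inequality int phi(G)|G'|^2 <= int phi carries most of the work. In the coordinate u = log z
    the annulus becomes a rectangle, and planar integrals are lattice sums over rectangles, so that
    Fubini is an exchange of finite sums. Two obstacles shape the argument. Compactness wants a
    closed rectangle, on which [cexp] is injective only if the height is below 2 PI; hence a thin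
    strip is cut off at the top. And |G'| may be small at some points; hence |G'|^2 is replaced by
    its excess over eta^2, which loses at most eta^2 times the area. The test function phi is
    Lipschitz and everywhere at least 1 - |w|^2/M^2, so the left side is estimated from below
    without locating the set |G| < M.

    Holomorphy is carried as a pair (F, F') with a uniform quadratic error. Cauchy's formula turns
    such pairs into power series, which provide products, reciprocals and the square root.

    The weight 27/4 in [Rad] is 3 (3/2)^2. The second area inequality alone allows x > 1/2, since
    x^2 + 27/4 x^4 is only 43/64 at x = 1/2; the range [0, 1/2] comes from |a_2| <= 1. *)

Lemma Cmod_minus_sym (z w : C) : Cmod (z - w) = Cmod (w - z).
Proof. rewrite <- Cmod_opp. f_equal. ring. Qed.

Lemma Cmod_triangle_minus (z w : C) : Cmod (z - w) <= Cmod z + Cmod w.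
Proof. unfold Cminus. rewrite <- (Cmod_opp w). apply Cmod_triangle. Qed.

Lemma Cmod_triangle_rev (z w : C) : Cmod z - Cmod w <= Cmod (z - w).
Proof.
  assert (H := Cmod_triangle (z - w) w).
  replace (z - w + w)%C with z in H by ring. lra.
Qed.

Lemma Cmod_le_sum (z : C) : Cmod z <= Rabs (Re z) + Rabs (Im z).
Proof.
  assert (H := Rabs_pos (Re z)). assert (H0 := Rabs_pos (Im z)).
  apply Rsqr_incr_0_var; [|lra]. unfold Rsqr.
  replace (Cmod z * Cmod z) with (Cmod z ^ 2) by ring. rewrite Cmod2_alt.
  rewrite (pow2_abs (Re z)) || rewrite <- (pow2_abs (Re z)).
  rewrite <- (pow2_abs (Im z)). nra.
Qed.

Lemma im_le_Cmod (z : C) : Rabs (Im z) <= Cmod z.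
Proof. eapply Rle_trans; [apply Rmax_r|apply (Rmax_Cmod z)]. Qed.

(** * Uniform complex differentiability *)

(* [F'] is the derivative of [F] with a quadratic error that is uniform on [S];
   this plays the role of holomorphy and needs no limits. *)
Definition udiff (S : C -> Prop) (F F' : C -> C) : Prop :=
  exists B : R, 0 <= B /\ forall z w : C, S z -> S w ->
    Cmod (F w - F z - F' z * (w - z)) <= B * Cmod (w - z) ^ 2.

Definition bounded_on (S : C -> Prop) (F : C -> C) : Prop :=
  exists K : R, 0 <= K /\ forall z : C, S z -> Cmod (F z) <= K.

Definition lip_on (S : C -> Prop) (F : C -> C) : Prop :=
  exists L : R, 0 <= L /\ forall z w : C, S z -> S w ->
    Cmod (F w - F z) <= L * Cmod (w - z).

Definition cdisk (r : R) (z : C) : Prop := Cmod z <= r.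

(** Uniformity is asked only on closed disks of radius below 1, since the quadratic constant may
    blow up at the boundary. The derivative is explicit, so every closure property also computes
    it. *)
Definition holo (F F' : C -> C) : Prop :=
  forall r : R, 0 <= r < 1 -> udiff (cdisk r) F F'.

Lemma lip_bounded (S : C -> Prop) (F : C -> C) :
  bounded_on S (fun z => z) -> lip_on S F -> bounded_on S F.
Proof.
  intros [D [HD HS]] [L [HL HF]].
  destruct (classic (exists z0, S z0)) as [[z0 Hz0]|Hn].
  - exists (Cmod (F z0) + L * (2 * D)). split.
    + assert (H := Cmod_ge_0 (F z0)). nra.
    + intros z Hz. assert (H := HF z0 z Hz0 Hz).
      assert (H1 := Cmod_triangle_minus z z0).
      assert (H2 := HS z Hz). assert (H3 := HS z0 Hz0).
      assert (H4 := Cmod_triangle_rev (F z) (F z0)).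
      assert (L * Cmod (z - z0) <= L * (2 * D)) by (apply Rmult_le_compat_l; lra).
      lra.
  - exists 0. split; [lra|]. intros z Hz. exfalso. apply Hn. now exists z.
Qed.

(** Adding the expansion at z, evaluated at w, to the expansion at w, evaluated at z, cancels the
    values of [F] and leaves (F' w - F' z)(w - z), bounded by 2 B |w - z|^2. *)
Lemma udiff_lip_deriv (S : C -> Prop) (F F' : C -> C) :
  udiff S F F' -> lip_on S F'.
Proof.
  intros [B [HB HF]]. exists (2 * B). split; [lra|].
  intros z w Hz Hw.
  destruct (Ceq_dec z w) as [->|Hne].
  - replace (F' w - F' w)%C with (RtoC 0) by ring.
    replace (w - w)%C with (RtoC 0) by ring. rewrite Cmod_0. lra.
  - assert (H1 := HF z w Hz Hw). assert (H2 := HF w z Hw Hz).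
    assert (Hp : 0 < Cmod (w - z)).
    { apply Cmod_gt_0. intros H. apply Hne.
      replace w with (w - z + z)%C by ring. rewrite H. ring. }
    apply Rmult_le_reg_r with (Cmod (w - z)); [exact Hp|].
    rewrite <- Cmod_mult.
    replace ((F' w - F' z) * (w - z))%C with
      ((F w - F z - F' z * (w - z)) + (F z - F w - F' w * (z - w)))%C by ring.
    eapply Rle_trans; [apply Cmod_triangle|].
    rewrite (Cmod_minus_sym z w) in H2. nra.
Qed.

Lemma udiff_bounded_deriv (S : C -> Prop) (F F' : C -> C) :
  bounded_on S (fun z => z) -> udiff S F F' -> bounded_on S F'.
Proof.
  intros HS HF. apply lip_bounded; [exact HS|]. eapply udiff_lip_deriv; exact HF.
Qed.

Lemma udiff_lip (S : C -> Prop) (F F' : C -> C) :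
  bounded_on S (fun z => z) -> udiff S F F' -> lip_on S F.
Proof.
  intros HS HF. destruct (udiff_bounded_deriv S F F' HS HF) as [K [HK HF']].
  destruct HS as [D [HD HS]]. destruct HF as [B [HB HF]].
  exists (B * (2 * D) + K). split; [nra|].
  intros z w Hz Hw.
  replace (F w - F z)%C with
    ((F w - F z - F' z * (w - z)) + F' z * (w - z))%C by ring.
  eapply Rle_trans; [apply Cmod_triangle|]. rewrite Cmod_mult.
  assert (H1 := HF z w Hz Hw). assert (H2 := HF' z Hz).
  assert (H3 := Cmod_triangle_minus w z).
  assert (H4 := HS z Hz). assert (H5 := HS w Hw).
  assert (H6 := Cmod_ge_0 (w - z)).
  assert (B * Cmod (w - z) ^ 2 <= B * (2 * D) * Cmod (w - z)).
  { replace (B * Cmod (w - z) ^ 2) with (B * Cmod (w - z) * Cmod (w - z)) by ring.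
    apply Rmult_le_compat_r; [exact H6|]. apply Rmult_le_compat_l; lra. }
  nra.
Qed.

Lemma udiff_bounded (S : C -> Prop) (F F' : C -> C) :
  bounded_on S (fun z => z) -> udiff S F F' -> bounded_on S F.
Proof.
  intros HS HF. apply lip_bounded; [exact HS|]. eapply udiff_lip; eassumption.
Qed.

Lemma udiff_ext (S : C -> Prop) (F F' G G' : C -> C) :
  (forall z, S z -> F z = G z) -> (forall z, S z -> F' z = G' z) ->
  udiff S F F' -> udiff S G G'.
Proof.
  intros H H' [B [HB HF]]. exists B. split; [exact HB|].
  intros z w Hz Hw. rewrite <- (H z Hz), <- (H w Hw), <- (H' z Hz). now apply HF.
Qed.

Lemma udiff_id (S : C -> Prop) : udiff S (fun z => z) (fun _ => RtoC 1).
Proof.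
  exists 0. split; [lra|]. intros z w _ _.
  replace (w - z - RtoC 1 * (w - z))%C with (RtoC 0) by ring. rewrite Cmod_0. lra.
Qed.

Lemma udiff_mult (S : C -> Prop) (F F' G G' : C -> C) :
  bounded_on S (fun z => z) ->
  udiff S F F' -> udiff S G G' ->
  udiff S (fun z => F z * G z)%C (fun z => F' z * G z + F z * G' z)%C.
Proof.
  intros HS HF HG.
  destruct (udiff_bounded _ _ _ HS HF) as [KF [HKF HbF]].
  destruct (udiff_bounded _ _ _ HS HG) as [KG [HKG HbG]].
  destruct (udiff_lip _ _ _ HS HF) as [LF [HLF HlF]].
  destruct (udiff_lip _ _ _ HS HG) as [LG [HLG HlG]].
  destruct HF as [B [HB HF]]. destruct HG as [A [HA HG]].
  exists (B * KG + KF * A + LF * LG). split.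
  { assert (0 <= B * KG) by nra. assert (0 <= KF * A) by nra. nra. }
  intros z w Hz Hw.
  replace (F w * G w - F z * G z - (F' z * G z + F z * G' z) * (w - z))%C with
    ((F w - F z - F' z * (w - z)) * G z + F z * (G w - G z - G' z * (w - z))
     + (F w - F z) * (G w - G z))%C by ring.
  eapply Rle_trans; [apply Cmod_triangle|].
  eapply Rle_trans; [apply Rplus_le_compat_r, Cmod_triangle|].
  rewrite !Cmod_mult.
  assert (H1 : Cmod (F w - F z - F' z * (w - z)) * Cmod (G z)
     <= B * Cmod (w - z) ^ 2 * KG).
  { apply Rmult_le_compat; try apply Cmod_ge_0; auto. }
  assert (H2 : Cmod (F z) * Cmod (G w - G z - G' z * (w - z))
     <= KF * (A * Cmod (w - z) ^ 2)).
  { apply Rmult_le_compat; try apply Cmod_ge_0; auto. }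
  assert (H3 : Cmod (F w - F z) * Cmod (G w - G z)
     <= (LF * Cmod (w - z)) * (LG * Cmod (w - z))).
  { apply Rmult_le_compat; try apply Cmod_ge_0; auto. }
  nra.
Qed.

Lemma udiff_scal (S : C -> Prop) (c : C) (F F' : C -> C) :
  udiff S F F' -> udiff S (fun z => c * F z)%C (fun z => c * F' z)%C.
Proof.
  intros [B [HB HF]]. exists (Cmod c * B).
  split; [apply Rmult_le_pos; [apply Cmod_ge_0|exact HB]|].
  intros z w Hz Hw.
  replace (c * F w - c * F z - c * F' z * (w - z))%C with
    (c * (F w - F z - F' z * (w - z)))%C by ring.
  rewrite Cmod_mult. assert (H := HF z w Hz Hw). assert (H1 := Cmod_ge_0 c). nra.
Qed.

Lemma udiff_comp (S T : C -> Prop) (F F' G G' : C -> C) :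
  bounded_on S (fun z => z) -> bounded_on T (fun z => z) ->
  (forall z, S z -> T (G z)) ->
  udiff T F F' -> udiff S G G' ->
  udiff S (fun z => F (G z)) (fun z => F' (G z) * G' z)%C.
Proof.
  intros HS HT HST HF HG.
  destruct (udiff_bounded_deriv _ _ _ HT HF) as [K [HK HbF]].
  destruct (udiff_lip _ _ _ HS HG) as [LG [HLG HlG]].
  destruct HF as [B [HB HF]]. destruct HG as [A [HA HG]].
  exists (B * LG ^ 2 + K * A). split; [nra|].
  intros z w Hz Hw.
  replace (F (G w) - F (G z) - F' (G z) * G' z * (w - z))%C with
    ((F (G w) - F (G z) - F' (G z) * (G w - G z)) +
     F' (G z) * (G w - G z - G' z * (w - z)))%C by ring.
  eapply Rle_trans; [apply Cmod_triangle|]. rewrite Cmod_mult.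
  assert (H1 := HF _ _ (HST z Hz) (HST w Hw)).
  assert (H2 := HlG z w Hz Hw).
  assert (H5 := Cmod_ge_0 (G w - G z)).
  assert (Cmod (G w - G z) ^ 2 <= LG ^ 2 * Cmod (w - z) ^ 2).
  { rewrite <- Rpow_mult_distr. apply pow_incr. lra. }
  assert (Cmod (F' (G z)) * Cmod (G w - G z - G' z * (w - z))
    <= K * (A * Cmod (w - z) ^ 2)).
  { apply Rmult_le_compat; try apply Cmod_ge_0; auto. }
  nra.
Qed.

Lemma udiff_inv (S : C -> Prop) (F F' : C -> C) (e : R) :
  bounded_on S (fun z => z) -> 0 < e -> (forall z, S z -> e <= Cmod (F z)) ->
  udiff S F F' ->
  udiff S (fun z => / F z)%C (fun z => - F' z / (F z * F z))%C.
Proof.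
  intros HS He Hlow HF.
  destruct (udiff_lip _ _ _ HS HF) as [L [HL HlF]].
  destruct HF as [B [HB HF]].
  exists (/ e ^ 3 * L ^ 2 + / e ^ 2 * B). split.
  { assert (0 < / e ^ 3) by (apply Rinv_0_lt_compat, pow_lt, He).
    assert (0 < / e ^ 2) by (apply Rinv_0_lt_compat, pow_lt, He). nra. }
  intros z w Hz Hw.
  assert (Nz : F z <> RtoC 0).
  { intros H. assert (H1 := Hlow z Hz). rewrite H, Cmod_0 in H1. lra. }
  assert (Nw : F w <> RtoC 0).
  { intros H. assert (H1 := Hlow w Hw). rewrite H, Cmod_0 in H1. lra. }
  replace (/ F w - / F z - - F' z / (F z * F z) * (w - z))%C with
    ((F w - F z) * (F w - F z) / (F z * F z * F w)
     - (F w - F z - F' z * (w - z)) / (F z * F z))%C by (field; split; assumption).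
  eapply Rle_trans; [apply Cmod_triangle_minus|].
  unfold Cdiv. rewrite !Cmod_mult, !Cmod_inv, !Cmod_mult;
    repeat apply Cmult_neq_0; try assumption.
  assert (H1 := HlF z w Hz Hw). assert (H2 := HF z w Hz Hw).
  assert (H3 := Hlow z Hz). assert (H4 := Hlow w Hw).
  assert (H5 := Cmod_ge_0 (F w - F z)).
  assert (H7 : Cmod (F w - F z) * Cmod (F w - F z) *
    / (Cmod (F z) * Cmod (F z) * Cmod (F w)) <= (L ^ 2 * Cmod (w - z) ^ 2) * / e ^ 3).
  { apply Rmult_le_compat.
    - nra.
    - left. apply Rinv_0_lt_compat. repeat apply Rmult_lt_0_compat; lra.
    - nra.
    - apply Rinv_le_contravar; [apply pow_lt, He|].
      replace (e ^ 3) with (e * e * e) by ring.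
      repeat apply Rmult_le_compat; try lra; nra. }
  assert (H8 : Cmod (F w - F z - F' z * (w - z)) * / (Cmod (F z) * Cmod (F z))
    <= (B * Cmod (w - z) ^ 2) * / e ^ 2).
  { apply Rmult_le_compat.
    - apply Cmod_ge_0.
    - left. apply Rinv_0_lt_compat. repeat apply Rmult_lt_0_compat; lra.
    - exact H2.
    - apply Rinv_le_contravar; [apply pow_lt, He|]. nra. }
  nra.
Qed.

Lemma cdisk_bounded (r : R) : 0 <= r -> bounded_on (cdisk r) (fun z => z).
Proof. intros Hr. exists r. split; [exact Hr|]. intros z Hz. exact Hz. Qed.

Lemma holo_id : holo (fun z => z) (fun _ => RtoC 1).
Proof. intros r _. apply udiff_id. Qed.

Lemma holo_mult (F F' G G' : C -> C) :
  holo F F' -> holo G G' ->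
  holo (fun z => F z * G z)%C (fun z => F' z * G z + F z * G' z)%C.
Proof. intros HF HG r Hr. apply udiff_mult; auto. apply cdisk_bounded; lra. Qed.

Lemma holo_scal (c : C) (F F' : C -> C) :
  holo F F' -> holo (fun z => c * F z)%C (fun z => c * F' z)%C.
Proof. intros HF r Hr. apply udiff_scal; auto. Qed.

(** * From quadratic increments to real derivatives *)

Lemma quadratic_is_derive (g d : R -> R) (B : R) :
  (forall s t, Rabs (g t - g s - d s * (t - s)) <= B * (t - s) ^ 2) ->
  forall x, is_derive g x (d x).
Proof.
  intros H x. apply is_derive_Reals. intros eps He.
  assert (P := Rabs_pos B).
  assert (Hd : 0 < eps / (Rabs B + 1)) by (apply Rdiv_lt_0_compat; lra).
  exists (mkposreal _ Hd). intros h Hh0 Hh. simpl in Hh.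
  assert (H1 := H x (x + h)). replace (x + h - x) with h in H1 by ring.
  assert (Ph : 0 < Rabs h) by now apply Rabs_pos_lt.
  replace ((g (x + h) - g x) / h - d x) with ((g (x + h) - g x - d x * h) / h)
    by (field; assumption).
  rewrite Rabs_div by assumption.
  apply (Rmult_lt_reg_r (Rabs h)); [exact Ph|].
  replace (Rabs (g (x + h) - g x - d x * h) / Rabs h * Rabs h)
    with (Rabs (g (x + h) - g x - d x * h)) by (field; lra).
  eapply Rle_lt_trans; [exact H1|]. rewrite <- pow2_abs.
  apply (Rmult_lt_compat_r (Rabs B + 1)) in Hh; [|lra].
  replace (eps / (Rabs B + 1) * (Rabs B + 1)) with eps in Hh by (field; lra).
  assert (H2 := Rle_abs B). simpl. rewrite Rmult_1_r.
  apply Rle_lt_trans with (Rabs B * (Rabs h * Rabs h)); [|nra].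
  apply Rmult_le_compat_r; nra.
Qed.

(** The projection of the line onto [a, b]. Composing with it extends a function from an interval to
    the whole line without enlarging its Lipschitz constant, which serves the lemmas that quantify
    over all reals. *)
Definition clamp (a b t : R) : R := Rmax a (Rmin b t).

Lemma clamp_range (a b t : R) : a <= b -> a <= clamp a b t <= b.
Proof. intros H. unfold clamp, Rmax, Rmin. repeat destruct Rle_dec; lra. Qed.

Lemma clamp_id (a b t : R) : a <= t <= b -> clamp a b t = t.
Proof. intros H. unfold clamp. rewrite Rmin_right, Rmax_right; lra. Qed.

Lemma clamp_lip (a b s t : R) : a <= b -> Rabs (clamp a b t - clamp a b s) <= Rabs (t - s).
Proof.
  intros H. unfold clamp, Rmax, Rmin. repeat destruct Rle_dec;
    unfold Rabs; repeat destruct Rcase_abs; lra.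
Qed.

(** The bound forces derivative 0, and the mean value theorem applies to the real and the imaginary
    part. Both the constancy of functions with zero derivative and the homotopy behind Cauchy's
    formula rest on this. *)
Lemma quadratic_increment_const (phi : R -> C) (B : R) :
  (forall x y, Cmod (phi y - phi x) <= B * (y - x) ^ 2) -> phi 1 = phi 0.
Proof.
  intros H.
  assert (Hr : forall g : R -> R, (forall x y, Rabs (g y - g x) <= B * (y - x) ^ 2) -> g 1 = g 0).
  { intros g Hg.
    assert (Hd : forall x, is_derive g x 0).
    { apply (quadratic_is_derive g (fun _ => 0) B). intros x y.
      replace (g y - g x - 0 * (y - x)) with (g y - g x) by ring. apply Hg. }
    destruct (MVT_gen g 0 1 (fun _ => 0)) as [c [_ E]].
    - intros x _. apply Hd.
    - intros x _. apply continuity_pt_filterlim, (ex_derive_continuous g). now exists 0.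
    - lra. }
  apply injective_projections.
  - apply (Hr (fun x => fst (phi x))). intros x y.
    eapply Rle_trans; [apply (re_le_Cmod (phi y - phi x))|apply H].
  - apply (Hr (fun x => snd (phi x))). intros x y.
    eapply Rle_trans; [apply (im_le_Cmod (phi y - phi x))|apply H].
Qed.

Lemma cdisk_convex (r x : R) (z w : C) :
  0 <= x <= 1 -> cdisk r z -> cdisk r w -> cdisk r (z + x * (w - z))%C.
Proof.
  unfold cdisk. intros Hx Hz Hw.
  replace (z + x * (w - z))%C with (RtoC (1 - x) * z + x * w)%C
    by (rewrite RtoC_minus; ring).
  eapply Rle_trans; [apply Cmod_triangle|].
  rewrite !Cmod_mult, !Cmod_R, !Rabs_pos_eq by lra. nra.
Qed.

(** Along the segment from 0 to z, parametrized through [clamp 0 1], the linear term of each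
    increment vanishes and only the quadratic error remains. *)
Lemma holo_deriv_zero_const (F F' : C -> C) :
  holo F F' -> (forall z, Cmod z < 1 -> F' z = RtoC 0) ->
  forall z, Cmod z < 1 -> F z = F (RtoC 0).
Proof.
  intros HF H0 z Hz. assert (Hz0 := Cmod_ge_0 z).
  destruct (HF (Cmod z) (conj Hz0 Hz)) as [B [HB HB']].
  assert (Hd : forall x, cdisk (Cmod z) (RtoC (clamp 0 1 x) * z)).
  { intros x. assert (H := clamp_range 0 1 x Rle_0_1).
    unfold cdisk. rewrite Cmod_mult, Cmod_R, Rabs_pos_eq by lra. nra. }
  assert (E := quadratic_increment_const (fun x => F (RtoC (clamp 0 1 x) * z)%C) (B * Cmod z ^ 2)).
  cbv beta in E. rewrite !clamp_id, Cmult_1_l, Cmult_0_l in E by lra. apply E.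
  intros x y. assert (H := HB' _ _ (Hd x) (Hd y)). assert (Hc := clamp_lip 0 1 x y Rle_0_1).
  set (u := clamp 0 1 x) in *. set (v := clamp 0 1 y) in *.
  rewrite H0 in H by (assert (H1 := Hd x); unfold cdisk in H1; fold u in H1; lra).
  replace (F (v * z) - F (u * z) - RtoC 0 * (v * z - u * z))%C with
    (F (v * z) - F (u * z))%C in H by ring.
  eapply Rle_trans; [exact H|].
  replace (v * z - u * z)%C with (RtoC (v - u) * z)%C by (rewrite RtoC_minus; ring).
  rewrite Cmod_mult, Cmod_R, Rpow_mult_distr, Rmult_assoc, (Rmult_comm (Cmod z ^ 2)), <- (pow2_abs (y - x)).
  apply Rmult_le_compat_l; [exact HB|]. apply Rmult_le_compat_r; [apply pow2_ge_0|].
  apply pow_incr. split; [apply Rabs_pos|exact Hc].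
Qed.

(** * The complex exponential *)

Definition cexp (z : C) : C := (exp (Re z) * cos (Im z), exp (Re z) * sin (Im z)).

Lemma cexp_plus (z w : C) : cexp (z + w) = (cexp z * cexp w)%C.
Proof.
  destruct z as [a b], w as [c d]. unfold cexp, Cplus, Cmult, Re, Im; simpl.
  rewrite exp_plus, cos_plus, sin_plus. f_equal; ring.
Qed.

Lemma cexp_0 : cexp (RtoC 0) = RtoC 1.
Proof.
  unfold cexp, RtoC, Re, Im; simpl. rewrite exp_0, cos_0, sin_0. f_equal; ring.
Qed.

Lemma Cmod_cexp (z : C) : Cmod (cexp z) = exp (Re z).
Proof.
  destruct z as [a b]. unfold cexp, Cmod, Re, Im; simpl.
  replace (exp a * cos b * (exp a * cos b * 1) + exp a * sin b * (exp a * sin b * 1))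
    with (Rsqr (exp a) * (Rsqr (sin b) + Rsqr (cos b))) by (unfold Rsqr; ring).
  rewrite sin2_cos2, Rmult_1_r. apply sqrt_Rsqr. left. apply exp_pos.
Qed.

Lemma cexp_neq_0 (z : C) : cexp z <> RtoC 0.
Proof. apply Cmod_gt_0. rewrite Cmod_cexp. apply exp_pos. Qed.

(** The mean value theorem is applied to [f] and then to [f'], which gives f''(d) c x with |d| <=
    |c| <= |x|; compared with Taylor's formula this loses the factor 1/2. *)
Lemma taylor_second_order (f f' f'' : R -> R) (M x : R) :
  (forall t, derivable_pt_lim f t (f' t)) ->
  (forall t, derivable_pt_lim f' t (f'' t)) ->
  (forall t, Rabs t <= Rabs x -> Rabs (f'' t) <= M) ->
  Rabs (f x - f 0 - f' 0 * x) <= M * x ^ 2.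
Proof.
  intros H1 H2 HM.
  assert (MV : forall (g g' : R -> R), (forall t, derivable_pt_lim g t (g' t)) ->
    forall y, exists c, g y - g 0 = g' c * y /\ Rabs c <= Rabs y).
  { intros g g' Hg y.
    destruct (MVT_gen g 0 y g') as [c [Hc E]].
    - intros t _. apply is_derive_Reals, Hg.
    - intros t _. apply derivable_continuous_pt. exists (g' t). apply Hg.
    - exists c. split; [rewrite E; ring|].
      unfold Rmin, Rmax in Hc. destruct (Rle_dec 0 y);
        unfold Rabs; destruct (Rcase_abs c), (Rcase_abs y); lra. }
  destruct (MV f f' H1 x) as [c [E Hc]].
  destruct (MV f' f'' H2 c) as [d [E' Hd]].
  replace (f x - f 0 - f' 0 * x) with ((f' c - f' 0) * x) by (rewrite E; ring).
  rewrite E', !Rabs_mult.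
  assert (H := HM d ltac:(lra)).
  assert (P1 := Rabs_pos (f'' d)). assert (P2 := Rabs_pos c).
  rewrite <- (pow2_abs x). simpl. rewrite Rmult_1_r, <- Rmult_assoc.
  apply Rmult_le_compat_r; [apply Rabs_pos|].
  apply Rmult_le_compat; lra.
Qed.

Lemma exp_second_order (D x : R) :
  Rabs x <= D -> Rabs (exp x - 1 - x) <= exp D * x ^ 2.
Proof.
  intros Hx. assert (H := taylor_second_order exp exp exp (exp D) x
    derivable_pt_lim_exp derivable_pt_lim_exp).
  rewrite exp_0, Rmult_1_l in H. apply H.
  intros t Ht. rewrite Rabs_pos_eq by (left; apply exp_pos).
  assert (Hle : t <= D).
  { assert (H1 := Rle_abs t). lra. }
  destruct Hle as [Hlt| ->]; [left; now apply exp_increasing|lra].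
Qed.

Lemma sin_second_order (x : R) : Rabs (sin x - x) <= x ^ 2.
Proof.
  assert (H := taylor_second_order sin cos (fun t => - sin t) 1 x
    derivable_pt_lim_sin derivable_pt_lim_cos).
  rewrite sin_0, cos_0, !Rmult_1_l, Rminus_0_r in H. apply H.
  intros t _. apply Rabs_le. assert (H1 := SIN_bound t). lra.
Qed.

Lemma cos_second_order (x : R) : Rabs (cos x - 1) <= x ^ 2.
Proof.
  assert (H := taylor_second_order cos (fun t => - sin t) (fun t => - cos t) 1 x
    derivable_pt_lim_cos).
  cbv beta in H. rewrite sin_0, cos_0, Ropp_0, !Rmult_0_l, !Rminus_0_r, !Rmult_1_l in H. apply H.
  - intros t. apply derivable_pt_lim_opp, derivable_pt_lim_sin.
  - intros t _. apply Rabs_le. assert (H1 := COS_bound t). lra.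
Qed.

Lemma exp_lip (D x : R) : Rabs x <= D -> Rabs (exp x - 1) <= (1 + exp D * D) * Rabs x.
Proof.
  intros Hx. assert (H := exp_second_order D x Hx).
  replace (exp x - 1) with ((exp x - 1 - x) + x) by ring.
  eapply Rle_trans; [apply Rabs_triang|].
  rewrite <- (pow2_abs x) in H. assert (P := Rabs_pos x). assert (P1 := exp_pos D).
  assert (exp D * Rabs x ^ 2 <= exp D * D * Rabs x).
  { simpl. rewrite Rmult_1_r, <- Rmult_assoc. apply Rmult_le_compat_r; [lra|].
    apply Rmult_le_compat_l; lra. }
  lra.
Qed.

Lemma cexp_second_order (D : R) : 0 <= D ->
  exists K, 0 <= K /\ forall h, Cmod h <= D ->
    Cmod (cexp h - RtoC 1 - h) <= K * Cmod h ^ 2.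
Proof.
  intros HD. assert (PD := exp_pos D).
  assert (PD2 : 0 <= exp D * D) by nra.
  (* The real and imaginary parts split into four terms. Three are at most [exp D] times the square
     of the modulus; the fourth, (exp x - 1) y, takes the Lipschitz constant of exp on [-D, D]. *)
  exists (3 * exp D + (1 + exp D * D)). split; [lra|].
  intros h Hh. assert (P := Cmod_ge_0 h).
  assert (Hx := Rle_trans _ _ _ (re_le_Cmod h) Hh).
  assert (H1 := re_le_Cmod h). assert (H2 := im_le_Cmod h).
  set (x := Re h) in *. set (y := Im h) in *.
  eapply Rle_trans; [apply Cmod_le_sum|].
  replace (Re (cexp h - RtoC 1 - h)) with (exp x * (cos y - 1) + (exp x - 1 - x))
    by (unfold cexp, Cminus, Cplus, Copp, RtoC, Re, Im, x, y, Re, Im; simpl; ring).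
  replace (Im (cexp h - RtoC 1 - h)) with (exp x * (sin y - y) + (exp x - 1) * y)
    by (unfold cexp, Cminus, Cplus, Copp, RtoC, Re, Im, x, y, Re, Im; simpl; ring).
  assert (A := Rabs_triang (exp x * (cos y - 1)) (exp x - 1 - x)).
  assert (A' := Rabs_triang (exp x * (sin y - y)) ((exp x - 1) * y)).
  rewrite !Rabs_mult in A. rewrite (Rabs_mult (exp x)), (Rabs_mult (exp x - 1)) in A'.
  rewrite (Rabs_pos_eq (exp x)) in A, A'
    by (left; apply exp_pos).
  assert (E : exp x <= exp D).
  { assert (H3 := Rle_abs x). assert (Hle : x <= D) by lra.
    destruct Hle as [Hlt| ->]; [left; now apply exp_increasing|lra]. }
  assert (Ex := exp_pos x).
  assert (B1 := cos_second_order y). assert (B2 := sin_second_order y).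
  assert (B3 := exp_second_order D x Hx). assert (B4 := exp_lip D x Hx).
  rewrite <- (pow2_abs y) in B1, B2. rewrite <- (pow2_abs x) in B3.
  assert (Px := Rabs_pos x). assert (Py := Rabs_pos y).
  assert (Sx : Rabs x ^ 2 <= Cmod h ^ 2) by (apply pow_incr; lra).
  assert (Sy : Rabs y ^ 2 <= Cmod h ^ 2) by (apply pow_incr; lra).
  assert (Sxy : Rabs x * Rabs y <= Cmod h ^ 2) by nra.
  assert (C1 : exp x * Rabs (cos y - 1) <= exp D * Cmod h ^ 2).
  { apply Rmult_le_compat; try lra; apply Rabs_pos. }
  assert (C2 : exp x * Rabs (sin y - y) <= exp D * Cmod h ^ 2).
  { apply Rmult_le_compat; try lra; apply Rabs_pos. }
  assert (C3 : Rabs (exp x - 1 - x) <= exp D * Cmod h ^ 2).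
  { eapply Rle_trans; [exact B3|]. apply Rmult_le_compat_l; lra. }
  assert (C4 : Rabs (exp x - 1) * Rabs y <= (1 + exp D * D) * Cmod h ^ 2).
  { apply Rle_trans with ((1 + exp D * D) * (Rabs x * Rabs y)).
    - rewrite <- Rmult_assoc. apply Rmult_le_compat_r; lra.
    - apply Rmult_le_compat_l; lra. }
  lra.
Qed.

(** The functional equation moves the expansion from z to 0, where it is applied to w - z, of
    modulus at most 2 D. *)
Lemma udiff_cexp (S : C -> Prop) : bounded_on S (fun z => z) -> udiff S cexp cexp.
Proof.
  intros [D [HD HS]].
  destruct (cexp_second_order (2 * D) ltac:(lra)) as [K [HK H]].
  exists (exp D * K). split; [assert (H0 := exp_pos D); nra|].
  intros z w Hz Hw.
  replace (cexp w - cexp z - cexp z * (w - z))%C with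
    (cexp z * (cexp (w - z) - RtoC 1 - (w - z)))%C.
  2:{ replace (cexp w) with (cexp z * cexp (w - z))%C; [ring|].
      rewrite <- cexp_plus. f_equal. ring. }
  rewrite Cmod_mult, Cmod_cexp, Rmult_assoc.
  assert (H1 := HS z Hz). assert (H2 := HS w Hw). assert (H3 := re_le_Cmod z).
  assert (H4 := Rle_abs (Re z)).
  apply Rmult_le_compat.
  - left. apply exp_pos.
  - apply Cmod_ge_0.
  - assert (Hle : Re z <= D) by lra.
    destruct Hle as [Hlt| ->]; [left; now apply exp_increasing|lra].
  - apply H. assert (H5 := Cmod_triangle_minus w z). lra.
Qed.

Lemma holo_cexp (F F' : C -> C) :
  holo F F' -> holo (fun z => cexp (F z)) (fun z => cexp (F z) * F' z)%C.
Proof.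
  intros HF r Hr. assert (Hb : bounded_on (cdisk r) (fun z => z)) by (apply cdisk_bounded; lra).
  destruct (udiff_bounded _ _ _ Hb (HF r Hr)) as [K [HK HKF]].
  apply (udiff_comp _ (cdisk K)); auto.
  - apply cdisk_bounded, HK.
  - apply udiff_cexp, cdisk_bounded, HK.
Qed.

(** * Power series on the unit disk *)

Definition cseries (a : nat -> C) (s : C) : Prop := is_series (V := C_NormedModule) a s.

Definition pser (c : nat -> C) (F : C -> C) : Prop :=
  forall z : C, Cmod z < 1 -> cseries (fun n => c n * z ^ n)%C (F z).

(** Convergence in the unit disk is expressed through the moduli of the coefficients, so that the
    theory of real power series supplies derivatives, primitives and absolute convergence. *)
Definition disk_conv (c : nat -> C) : Prop := Rbar_le 1 (CV_radius (fun n => Cmod (c n))).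

Lemma cseries_unique (a : nat -> C) (s t : C) : cseries a s -> cseries a t -> s = t.
Proof. intros H1 H2. exact (filterlim_locally_unique _ _ _ H1 H2). Qed.

Lemma cseries_ext (a b : nat -> C) (s : C) :
  (forall n, a n = b n) -> cseries a s -> cseries b s.
Proof. intros H H1. exact (is_series_ext a b s H H1). Qed.

Lemma cseries_scal (c : C) (a : nat -> C) (s : C) :
  cseries a s -> cseries (fun n => c * a n)%C (c * s)%C.
Proof. intros H. exact (is_series_scal c a s H). Qed.

Lemma cseries_plus (a b : nat -> C) (s t : C) :
  cseries a s -> cseries b t -> cseries (fun n => a n + b n)%C (s + t)%C.
Proof. intros H1 H2. exact (is_series_plus a b s t H1 H2). Qed.

Lemma cseries_cons (a : nat -> C) (s : C) :
  cseries (fun n => a (S n)) s -> cseries a (a 0%nat + s)%C.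
Proof.
  intros H. apply (is_series_decr_1 (V := C_NormedModule)).
  match goal with |- is_series _ ?l => replace l with s; [exact H|] end.
  change (s = ((a 0%nat + s) + - a 0%nat)%C). ring.
Qed.

Lemma cseries_sum_lim (a : nat -> C) (s : C) :
  cseries a s <->
  is_lim_seq (fun N => Cmod (sum_n (G := C_AbelianMonoid) a N - s)) 0.
Proof.
  split; intros H.
  - apply is_lim_seq_spec. intros eps.
    assert (H1 := proj1 (filterlim_locally_ball_norm _ _) H eps).
    destruct H1 as [N HN]. exists N. intros n Hn.
    rewrite Rminus_0_r, Rabs_pos_eq by apply Cmod_ge_0.
    apply (HN n Hn).
  - apply is_lim_seq_spec in H. apply (filterlim_locally_ball_norm (K := C_AbsRing)).
    intros eps. destruct (H eps) as [N HN]. exists N. intros n Hn.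
    assert (H1 := HN n Hn). rewrite Rminus_0_r, Rabs_pos_eq in H1 by apply Cmod_ge_0.
    exact H1.
Qed.

Lemma cseries_bound (a : nat -> C) (s : C) (b : nat -> R) :
  cseries a s -> (forall n, Cmod (a n) <= b n) -> ex_series b -> Cmod s <= Series b.
Proof.
  intros Ha Hab Hb.
  assert (Hn : forall N, Cmod (sum_n (G := C_AbelianMonoid) a N) <= sum_n b N).
  { induction N as [|N IH].
    - rewrite !sum_O. apply Hab.
    - rewrite !sum_Sn. eapply Rle_trans; [apply Cmod_triangle|].
      apply Rplus_le_compat; [exact IH|apply Hab]. }
  assert (L : is_lim_seq (fun N => sum_n b N +
      Cmod (sum_n (G := C_AbelianMonoid) a N - s)) (Series b + 0)).
  { apply (is_lim_seq_plus' _ _ (Series b) 0).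
    - exact (Series_correct _ Hb).
    - now apply cseries_sum_lim. }
  rewrite Rplus_0_r in L.
  refine (is_lim_seq_le _ _ (Cmod s) (Series b) _ (is_lim_seq_const _) L).
  intros N. assert (H := Hn N).
  assert (H1 := Cmod_triangle_rev s (sum_n (G := C_AbelianMonoid) a N)).
  rewrite Cmod_minus_sym in H1. lra.
Qed.

(** If the radius x were below 1, convergence at a real r strictly between x and 1 would bound the
    partial sums, hence the terms |c_n| r^n, and the radius would be at least r. *)
Lemma pser_disk_conv (c : nat -> C) (F : C -> C) : pser c F -> disk_conv c.
Proof.
  intros HF. unfold disk_conv.
  destruct (CV_radius_bounded (fun n => Cmod (c n))) as [Hub _].
  destruct (Rbar_le_lt_dec 1 (CV_radius (fun n => Cmod (c n)))) as [Hle|Hlt]; [exact Hle|].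
  exfalso. assert (Hge := CV_radius_ge_0 (fun n => Cmod (c n))).
  destruct (CV_radius (fun n => Cmod (c n))) as [x| |]; simpl in *; try easy.
  set (r := (x + 1) / 2). assert (Hr : x < r < 1) by (unfold r; lra).
  assert (Hx := Hub r). simpl in Hx.
  assert (r <= x); [|lra]. apply Hx.
  assert (Hc : Cmod r < 1) by (rewrite Cmod_R, Rabs_pos_eq; lra).
  destruct (filterlim_bounded (K := C_AbsRing) (V := C_NormedModule)
    (sum_n (fun n => c n * r ^ n)%C)) as [M HM].
  { exists (F r). exact (HF r Hc). }
  assert (HM' : forall n, Cmod (sum_n (G := C_AbelianMonoid) (fun n => c n * r ^ n)%C n) <= M)
    by exact HM.
  exists (2 * M). intros n.
  rewrite Rabs_pos_eq by (apply Rmult_le_pos; [apply Cmod_ge_0|apply pow_le; lra]).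
  replace (Cmod (c n) * r ^ n) with (Cmod (c n * r ^ n))
    by (rewrite Cmod_mult, Cmod_pow, Cmod_R, Rabs_pos_eq by lra; reflexivity).
  assert (H0 := HM' n). destruct n as [|n].
  - rewrite sum_O in H0. assert (H1 := Cmod_ge_0 (c 0%nat * r ^ 0)). lra.
  - assert (H1 := HM' n). rewrite sum_Sn in H0. change (@plus C_AbelianMonoid) with Cplus in H0.
    set (s := sum_n (fun n => c n * r ^ n)%C n) in *.
    replace (c (S n) * r ^ S n)%C with (s + c (S n) * r ^ S n - s)%C by ring.
    eapply Rle_trans; [apply Cmod_triangle_minus|]. lra.
Qed.

Lemma disk_conv_inside (c : nat -> C) (r : R) : disk_conv c -> 0 <= r < 1 ->
  Rbar_lt (Rabs r) (CV_radius (fun n => Cmod (c n))).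
Proof.
  intros H Hr. eapply Rbar_lt_le_trans; [|exact H]. simpl. rewrite Rabs_pos_eq; lra.
Qed.

(** The twice differentiated series of moduli; its sum is the quadratic constant in
    [pser_holo_derive]. For n < 2 the factor n (n - 1) vanishes, so the truncated exponent does no
    harm. *)
Lemma disk_conv_series2 (c : nat -> C) (r : R) :
  disk_conv c -> 0 <= r < 1 ->
  ex_series (fun n => Cmod (c n) * (INR n * (INR n - 1)) * r ^ (n - 2)).
Proof.
  intros H Hr. apply (ex_series_incr_n _ 2).
  apply (ex_series_ext
    (fun n => Rabs (PS_derive (PS_derive (fun n => Cmod (c n))) n * r ^ n))).
  - intros n. unfold PS_derive. replace (2 + n - 2)%nat with n by lia.
    replace (2 + n)%nat with (S (S n)) by lia.
    rewrite Rabs_pos_eq.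
    + rewrite !S_INR. real_eq. ring.
    + apply Rmult_le_pos; [|apply pow_le; lra].
      repeat apply Rmult_le_pos; try apply pos_INR. apply Cmod_ge_0.
  - apply CV_disk_inside. rewrite !CV_radius_derive. now apply disk_conv_inside.
Qed.

Lemma disk_conv_derive (c : nat -> C) :
  disk_conv c -> disk_conv (fun n => INR (S n) * c (S n))%C.
Proof.
  unfold disk_conv. intros H. rewrite <- CV_radius_derive in H.
  erewrite CV_radius_ext; [exact H|]. intros n. unfold PS_derive.
  now rewrite Cmod_mult, Cmod_R, (Rabs_pos_eq (INR (S n))) by apply pos_INR.
Qed.

Lemma disk_conv_tail (c : nat -> C) : disk_conv c -> disk_conv (fun n => c (S n)).
Proof. unfold disk_conv. intros H. rewrite <- CV_radius_decr_1 in H. exact H. Qed.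

Lemma pser_exists (c : nat -> C) : disk_conv c -> exists F, pser c F.
Proof.
  intros H.
  (* Hilbert's epsilon selects the sum at each point; outside the disk the value is arbitrary. *)
  exists (fun z => epsilon (inhabits (RtoC 0)) (cseries (fun n => c n * z ^ n)%C)).
  intros z Hz. apply epsilon_spec.
  apply (ex_series_le (V := C_CompleteNormedModule) _ (fun n => Rabs (Cmod (c n) * Cmod z ^ n))).
  - intros n. rewrite <- Cmod_pow, <- Cmod_mult. apply Rle_abs.
  - apply (CV_disk_inside (fun n => Cmod (c n))), disk_conv_inside; [exact H|].
    assert (H0 := Cmod_ge_0 z). lra.
Qed.

(** By induction: passing from n to n + 1 multiplies the error by w and adds exactly n z^(n-1) (w -
    z)^2. For n < 2 both sides are 0. *)
Lemma pow_second_order (z w : C) (r : R) (n : nat) :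
  Cmod z <= r -> Cmod w <= r ->
  Cmod (w ^ n - z ^ n - INR n * z ^ (n - 1) * (w - z))
    <= INR n * (INR n - 1) * r ^ (n - 2) * Cmod (w - z) ^ 2.
Proof.
  intros Hz Hw. assert (Hr : 0 <= r) by (assert (H := Cmod_ge_0 z); lra).
  destruct n as [|[|n]].
  - replace (w ^ 0 - z ^ 0 - INR 0 * z ^ (0 - 1) * (w - z))%C with (RtoC 0)
      by (simpl; ring).
    rewrite Cmod_0. simpl. lra.
  - replace (w ^ 1 - z ^ 1 - INR 1 * z ^ (1 - 1) * (w - z))%C with (RtoC 0)
      by (simpl; ring).
    rewrite Cmod_0. simpl. lra.
  - replace (S (S n) - 1)%nat with (S n) by lia. replace (S (S n) - 2)%nat with n by lia.
    induction n as [|n IH].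
    + replace (w ^ 2 - z ^ 2 - INR 2 * z ^ 1 * (w - z))%C with ((w - z) * (w - z))%C.
      * rewrite Cmod_mult. simpl. nra.
      * simpl INR. rewrite RtoC_plus. simpl. ring.
    + replace (w ^ S (S (S n)) - z ^ S (S (S n)) - INR (S (S (S n))) * z ^ S (S n) * (w - z))%C
        with (w * (w ^ S (S n) - z ^ S (S n) - INR (S (S n)) * z ^ S n * (w - z))
          + INR (S (S n)) * z ^ S n * ((w - z) * (w - z)))%C.
      * eapply Rle_trans; [apply Cmod_triangle|].
        rewrite !Cmod_mult, Cmod_pow, Cmod_R, Rabs_pos_eq by apply pos_INR.
        assert (Hp : 0 <= r ^ n) by (apply pow_le, Hr).
        assert (H1 : Cmod w * Cmod (w ^ S (S n) - z ^ S (S n)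
            - INR (S (S n)) * z ^ S n * (w - z))
          <= r * (INR (S (S n)) * (INR (S (S n)) - 1) * r ^ n * Cmod (w - z) ^ 2)).
        { apply Rmult_le_compat; try apply Cmod_ge_0; assumption. }
        assert (H2 : Cmod z ^ S n <= r ^ S n).
        { apply pow_incr. split; [apply Cmod_ge_0|exact Hz]. }
        assert (H3 : INR (S (S n)) * Cmod z ^ S n * (Cmod (w - z) * Cmod (w - z))
          <= INR (S (S n)) * r ^ S n * (Cmod (w - z) * Cmod (w - z))).
        { apply Rmult_le_compat_r; [nra|]. apply Rmult_le_compat_l; [apply pos_INR|exact H2]. }
        eapply Rle_trans; [apply Rplus_le_compat; [exact H1|exact H3]|].
        rewrite !S_INR. assert (Hn : 0 <= INR n) by apply pos_INR.
        simpl. assert (Hq : 0 <= r * r ^ n * (Cmod (w - z) * Cmod (w - z)))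
          by (apply Rmult_le_pos; nra).
        nra.
      * rewrite (S_INR (S (S n))), RtoC_plus. simpl. ring.
Qed.

Lemma pser_holo_derive (c : nat -> C) (F F' : C -> C) :
  pser c F -> pser (fun n => INR (S n) * c (S n))%C F' -> holo F F'.
Proof.
  intros HF HF' r Hr. assert (Hg := pser_disk_conv c F HF).
  assert (Hs := disk_conv_series2 c r Hg Hr).
  set (b := fun n => Cmod (c n) * (INR n * (INR n - 1)) * r ^ (n - 2)) in Hs.
  assert (Hb0 : forall n, 0 <= b n).
  { intros n. apply Rmult_le_pos; [|apply pow_le; lra].
    apply Rmult_le_pos; [apply Cmod_ge_0|]. destruct n as [|n]; [simpl; lra|].
    rewrite S_INR. assert (H := pos_INR n). nra. }
  exists (Series b). split.
  { rewrite <- (Rmult_0_l (Series b)), <- Series_scal_l.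
    apply Series_le; [intros n; assert (H := Hb0 n); lra|exact Hs]. }
  intros z w Hz Hw. unfold cdisk in *.
  rewrite <- Series_scal_r.
  apply (cseries_bound (fun n => c n * (w ^ n - z ^ n - INR n * z ^ (n - 1) * (w - z)))%C).
  - assert (S1 := HF w ltac:(lra)). assert (S2 := HF z ltac:(lra)).
    assert (S3 := HF' z ltac:(lra)).
    assert (S4 : cseries (fun n => c n * (INR n * z ^ (n - 1)))%C (F' z)).
    { replace (F' z) with (c 0%nat * (INR 0 * z ^ (0 - 1)) + F' z)%C by (simpl; ring).
      apply (cseries_cons (fun n => c n * (INR n * z ^ (n - 1)))%C).
      eapply cseries_ext; [|exact S3]. intros n. cbv beta.
      replace (S n - 1)%nat with n by lia. ring. }
    assert (S5 := cseries_plus _ _ _ _ (cseries_plus _ _ _ _ S1 (cseries_scal (-(1))%C _ _ S2))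
      (cseries_scal (- (w - z))%C _ _ S4)).
    replace (F w - F z - F' z * (w - z))%C with
      (F w + - (1) * F z + - (w - z) * F' z)%C by ring.
    eapply cseries_ext; [|exact S5]. intros n. cbv beta. ring.
  - intros n. rewrite Cmod_mult. unfold b.
    assert (H := pow_second_order z w r n Hz Hw). assert (H1 := Cmod_ge_0 (c n)).
    replace (Cmod (c n) * (INR n * (INR n - 1)) * r ^ (n - 2) * Cmod (w - z) ^ 2) with
      (Cmod (c n) * (INR n * (INR n - 1) * r ^ (n - 2) * Cmod (w - z) ^ 2)) by ring.
    apply Rmult_le_compat_l; assumption.
  - apply ex_series_scal_r. exact Hs.
Qed.

Lemma pser_deriv (c : nat -> C) (F : C -> C) :
  pser c F -> exists F', pser (fun n => INR (S n) * c (S n))%C F' /\ holo F F'.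
Proof.
  intros HF.
  destruct (pser_exists (fun n => INR (S n) * c (S n))%C) as [F' HF'].
  { apply disk_conv_derive. eapply pser_disk_conv, HF. }
  exists F'. split; [exact HF'|]. now apply (pser_holo_derive c).
Qed.

(** Splitting off one coefficient at a time is the induction step for the uniqueness of
    coefficients, for Bessel's inequality and for the coefficients of a product. *)
Lemma pser_tail (c : nat -> C) (F : C -> C) :
  pser c F -> exists H, pser (fun n => c (S n)) H /\
    forall z, Cmod z < 1 -> F z = (c 0%nat + z * H z)%C.
Proof.
  intros HF. destruct (pser_exists (fun n => c (S n))) as [H HH].
  { apply disk_conv_tail. eapply pser_disk_conv, HF. }
  exists H. split; [exact HH|]. intros z Hz.
  apply (cseries_unique (fun n => c n * z ^ n)%C); [now apply HF|].
  replace (c 0%nat + z * H z)%C with (c 0%nat * z ^ 0 + z * H z)%C by (simpl; ring).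
  apply (cseries_cons (fun n => c n * z ^ n)%C).
  eapply cseries_ext; [|apply cseries_scal, (HH z Hz)].
  intros n. cbv beta. simpl. ring.
Qed.

Lemma pser_0 (c : nat -> C) (F : C -> C) : pser c F -> F (RtoC 0) = c 0%nat.
Proof.
  intros HF. destruct (pser_tail c F HF) as [H [_ E]].
  rewrite E by (rewrite Cmod_0; lra). ring.
Qed.

Lemma holo_punctured_eq (F F' G G' : C -> C) :
  holo F F' -> holo G G' ->
  (forall z, 0 < Cmod z < 1 -> F z = G z) -> F (RtoC 0) = G (RtoC 0).
Proof.
  intros HF HG H.
  assert (Hb : bounded_on (cdisk (1 / 2)) (fun z => z)) by (apply cdisk_bounded; lra).
  destruct (udiff_lip _ _ _ Hb (HF (1 / 2) ltac:(lra))) as [L [HL H1]].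
  destruct (udiff_lip _ _ _ Hb (HG (1 / 2) ltac:(lra))) as [K [HK H2]].
  destruct (Req_dec (Cmod (F (RtoC 0) - G (RtoC 0))) 0) as [E|E].
  { apply Cmod_eq_0 in E.
    replace (F (RtoC 0)) with (F (RtoC 0) - G (RtoC 0) + G (RtoC 0))%C by ring.
    rewrite E. ring. }
  exfalso. assert (P := Cmod_ge_0 (F (RtoC 0) - G (RtoC 0))).
  set (m := Cmod (F (RtoC 0) - G (RtoC 0))) in *.
  (* At distance x from 0 the functions [F] and [G] together vary by at most (L + K) x < m, although
     they agree at x and differ by m at 0. *)
  set (x := Rmin (1 / 2) (m / (2 * (L + K + 1)))).
  assert (Hx : 0 < x).
  { apply Rmin_glb_lt; [lra|]. apply Rdiv_lt_0_compat; lra. }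
  assert (Hx1 : x <= 1 / 2) by apply Rmin_l.
  assert (Hx2 : x * (2 * (L + K + 1)) <= m).
  { assert (H3 : x <= m / (2 * (L + K + 1))) by apply Rmin_r.
    apply (Rmult_le_compat_r (2 * (L + K + 1))) in H3; [|lra].
    replace (m / (2 * (L + K + 1)) * (2 * (L + K + 1))) with m in H3 by (field; lra).
    exact H3. }
  assert (Cx : Cmod x = x) by (rewrite Cmod_R, Rabs_pos_eq; lra).
  assert (C0 : cdisk (1 / 2) (RtoC 0)) by (unfold cdisk; rewrite Cmod_0; lra).
  assert (C1 : cdisk (1 / 2) x) by (unfold cdisk; lra).
  assert (A1 := H1 x (RtoC 0) C1 C0). assert (A2 := H2 (RtoC 0) x C0 C1).
  replace (0 - x)%C with (- x)%C in A1 by ring.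
  replace (x - 0)%C with (RtoC x) in A2 by ring.
  rewrite Cmod_opp in A1. rewrite Cx in A1, A2.
  assert (A3 : m <= Cmod (F (RtoC 0) - F x) + Cmod (G x - G (RtoC 0))).
  { unfold m. replace (F (RtoC 0) - G (RtoC 0))%C with
      ((F (RtoC 0) - F x) + (G x - G (RtoC 0)))%C.
    - apply Cmod_triangle.
    - rewrite (H x) by lra. ring. }
  nra.
Qed.

(** Evaluation at 0 gives the first coefficient. After dividing by z the tails are known to agree
    only off 0, and continuity closes the gap. *)
Lemma pser_unique (c d : nat -> C) (F : C -> C) :
  pser c F -> pser d F -> forall n, c n = d n.
Proof.
  intros Hc Hd n. revert c d F Hc Hd. induction n as [|n IH]; intros c d F Hc Hd.
  - now rewrite <- (pser_0 c F Hc), <- (pser_0 d F Hd).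
  - destruct (pser_tail c F Hc) as [H [HH E]]. destruct (pser_tail d F Hd) as [K [HK E']].
    assert (E0 : c 0%nat = d 0%nat) by now rewrite <- (pser_0 c F Hc), <- (pser_0 d F Hd).
    assert (EHK : forall z, 0 < Cmod z < 1 -> H z = K z).
    { intros z Hz. assert (E1 := E z ltac:(lra)). rewrite (E' z), <- E0 in E1 by lra.
      assert (Nz : z <> RtoC 0) by (apply Cmod_gt_0; lra).
      replace (H z) with ((c 0%nat + z * H z - c 0%nat) / z)%C by (field; exact Nz).
      rewrite <- E1. field. exact Nz. }
    apply (IH (fun n => c (S n)) (fun n => d (S n)) H); [exact HH|].
    intros z Hz. replace (H z) with (K z); [now apply HK|].
    destruct (Req_dec (Cmod z) 0) as [Z|Z].
    + apply Cmod_eq_0 in Z. subst z. symmetry.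
      destruct (pser_deriv _ _ HH) as [H' [_ DH]]. destruct (pser_deriv _ _ HK) as [K' [_ DK]].
      now apply (holo_punctured_eq H H' K K').
    + symmetry. apply EHK. assert (P := Cmod_ge_0 z). lra.
Qed.

Lemma pser_primitive (c : nat -> C) (F : C -> C) :
  pser c F -> exists P, holo P F /\ P (RtoC 0) = RtoC 0.
Proof.
  intros HF.
  set (d := fun n : nat => match n with O => RtoC 0 | S m => (c m / INR (S m))%C end).
  assert (Nn : forall n, RtoC (INR (S n)) <> RtoC 0).
  { intros n H. apply RtoC_inj in H. now apply not_0_INR in H. }
  destruct (pser_exists d) as [P HP].
  { assert (H := pser_disk_conv c F HF). unfold disk_conv in *. rewrite <- CV_radius_Int in H.
    erewrite CV_radius_ext; [exact H|]. intros [|n]; unfold d, PS_Int; [apply Cmod_0|].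
    now rewrite Cmod_div, Cmod_R, Rabs_pos_eq by (apply Nn || apply pos_INR). }
  exists P. split.
  - apply (pser_holo_derive d P F HP). intros z Hz.
    eapply cseries_ext; [|apply (HF z Hz)]. intros n. unfold d. cbv beta. field. apply Nn.
  - now rewrite (pser_0 d P HP).
Qed.

(** * Means over the circle *)

(** Boundedness is included because it makes the class closed under products; the Lipschitz
    condition gives continuity, hence integrability. *)
Definition bdd_lip (u : R -> C) : Prop :=
  exists K L, 0 <= K /\ 0 <= L /\ (forall t, Cmod (u t) <= K) /\
    (forall s t, Cmod (u t - u s) <= L * Rabs (t - s)).

Lemma bdd_lip_const (c : C) : bdd_lip (fun _ => c).
Proof.
  exists (Cmod c), 0. repeat split; try lra; try apply Cmod_ge_0.
  1: intros t; lra.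
  intros s t. replace (c - c)%C with (RtoC 0) by ring. rewrite Cmod_0. lra.
Qed.

Lemma bdd_lip_ext (u v : R -> C) : (forall t, u t = v t) -> bdd_lip u -> bdd_lip v.
Proof.
  intros E (K & L & HK & HL & H1 & H2). exists K, L.
  repeat split; auto; intros; rewrite <- !E; auto.
Qed.

Lemma bdd_lip_plus (u v : R -> C) : bdd_lip u -> bdd_lip v -> bdd_lip (fun t => u t + v t)%C.
Proof.
  intros (K & L & HK & HL & H1 & H2) (K' & L' & HK' & HL' & H3 & H4).
  exists (K + K'), (L + L'). repeat split; try lra.
  - intros t. eapply Rle_trans; [apply Cmod_triangle|]. now apply Rplus_le_compat.
  - intros s t. replace (u t + v t - (u s + v s))%C with ((u t - u s) + (v t - v s))%C by ring.
    eapply Rle_trans; [apply Cmod_triangle|]. assert (A := H2 s t). assert (B := H4 s t). lra.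
Qed.

Lemma bdd_lip_mult (u v : R -> C) : bdd_lip u -> bdd_lip v -> bdd_lip (fun t => u t * v t)%C.
Proof.
  intros (K & L & HK & HL & H1 & H2) (K' & L' & HK' & HL' & H3 & H4).
  exists (K * K'), (L * K' + K * L'). repeat split; try nra.
  - intros t. rewrite Cmod_mult. apply Rmult_le_compat; auto; apply Cmod_ge_0.
  - intros s t.
    replace (u t * v t - u s * v s)%C with ((u t - u s) * v t + u s * (v t - v s))%C by ring.
    eapply Rle_trans; [apply Cmod_triangle|]. rewrite !Cmod_mult.
    assert (A : Cmod (u t - u s) * Cmod (v t) <= (L * Rabs (t - s)) * K')
      by (apply Rmult_le_compat; auto; apply Cmod_ge_0).
    assert (B : Cmod (u s) * Cmod (v t - v s) <= K * (L' * Rabs (t - s)))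
      by (apply Rmult_le_compat; auto; apply Cmod_ge_0).
    lra.
Qed.

Lemma bdd_lip_conj (u : R -> C) : bdd_lip u -> bdd_lip (fun t => Cconj (u t)).
Proof.
  intros (K & L & HK & HL & H1 & H2). exists K, L. repeat split; try lra.
  - intros t. rewrite Cmod_conj. auto.
  - intros s t. rewrite <- Cminus_conj, Cmod_conj. auto.
Qed.

Lemma bdd_lip_pow (u : R -> C) (n : nat) : bdd_lip u -> bdd_lip (fun t => u t ^ n)%C.
Proof.
  intros H. induction n as [|n IH]; simpl; [apply bdd_lip_const|]. now apply bdd_lip_mult.
Qed.

Lemma bdd_lip_inv (u : R -> C) (e : R) :
  0 < e -> (forall t, e <= Cmod (u t)) -> bdd_lip u -> bdd_lip (fun t => / u t)%C.
Proof.
  intros He Hu (K & L & HK & HL & H1 & H2). exists (/ e), (L * / (e * e)).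
  assert (Pe : 0 < / e) by now apply Rinv_0_lt_compat.
  assert (Pe2 : 0 < / (e * e)) by (apply Rinv_0_lt_compat; nra).
  assert (N : forall t, u t <> RtoC 0) by (intros t; apply Cmod_gt_0; assert (H := Hu t); lra).
  repeat split; try nra.
  - intros t. rewrite Cmod_inv by apply N. apply Rinv_le_contravar; auto.
  - intros s t. replace (/ u t - / u s)%C with (- (u t - u s) / (u t * u s))%C
      by (field; split; apply N).
    rewrite Cmod_div, Cmod_opp, Cmod_mult by (apply Cmult_neq_0; apply N).
    unfold Rdiv. assert (A := H2 s t). assert (B := Hu s). assert (B' := Hu t).
    rewrite Rmult_assoc, (Rmult_comm (/ (e * e))), <- Rmult_assoc.
    apply Rmult_le_compat; [apply Cmod_ge_0| |exact A|].
    + left. apply Rinv_0_lt_compat. nra.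
    + apply Rinv_le_contravar; nra.
Qed.

Lemma bdd_lip_comp (S : C -> Prop) (F : C -> C) (u : R -> C) :
  bounded_on S F -> lip_on S F -> (forall t, S (u t)) -> bdd_lip u -> bdd_lip (fun t => F (u t)).
Proof.
  intros [B [HB HF]] [M [HM HF']] HS (K & L & HK & HL & H1 & H2).
  exists B, (M * L). repeat split; try nra.
  - intros t. auto.
  - intros s t. eapply Rle_trans; [apply HF'; apply HS|]. rewrite Rmult_assoc.
    apply Rmult_le_compat_l; auto.
Qed.

(** * The parametrized unit circle and integrals over a period *)

Definition cis (t : R) : C := cexp (0, t).

Lemma Cmod_cis (t : R) : Cmod (cis t) = 1.
Proof. unfold cis. rewrite Cmod_cexp. simpl. apply exp_0. Qed.

Lemma cis_plus (s t : R) : cis (s + t) = (cis s * cis t)%C.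
Proof.
  unfold cis. rewrite <- cexp_plus. f_equal. unfold Cplus; simpl. f_equal. ring.
Qed.

Lemma cis_0 : cis 0 = RtoC 1.
Proof. exact cexp_0. Qed.

Lemma cis_2PI : cis (2 * PI) = RtoC 1.
Proof.
  unfold cis, cexp. simpl. rewrite exp_0, cos_2PI, sin_2PI. unfold RtoC. f_equal; ring.
Qed.

Lemma cis_opp (t : R) : (cis (- t) * cis t)%C = RtoC 1.
Proof. rewrite <- cis_plus, Rplus_opp_l. apply cis_0. Qed.

Lemma cis_second_order : exists B, 0 <= B /\ forall s t,
  Cmod (cis t - cis s - Ci * cis s * RtoC (t - s)) <= B * (t - s) ^ 2.
Proof.
  exists 2. split; [lra|]. intros s t.
  replace (cis t - cis s - Ci * cis s * RtoC (t - s))%C with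
    (cis s * (cis (t - s) - 1 - Ci * RtoC (t - s)))%C.
  2:{ replace (cis t) with (cis s * cis (t - s))%C; [ring|].
      rewrite <- cis_plus. f_equal. ring. }
  rewrite Cmod_mult, Cmod_cis, Rmult_1_l.
  eapply Rle_trans; [apply Cmod_le_sum|].
  set (x := t - s).
  replace (Re (cis x - 1 - Ci * x)) with (cos x - 1)
    by (unfold cis, cexp, Re, Im, Cminus, Cplus, Copp, Cmult, Ci, RtoC; simpl; rewrite exp_0; ring).
  replace (Im (cis x - 1 - Ci * x)) with (sin x - x)
    by (unfold cis, cexp, Re, Im, Cminus, Cplus, Copp, Cmult, Ci, RtoC; simpl; rewrite exp_0; ring).
  assert (A := cos_second_order x). assert (B := sin_second_order x). lra.
Qed.

Lemma bdd_lip_cis : bdd_lip cis.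
Proof.
  destruct cis_second_order as [B [HB H]]. exists 1, (B + 2). repeat split; try lra.
  - intros t. rewrite Cmod_cis. lra.
  - intros s t. destruct (Rle_dec (Rabs (t - s)) 1) as [Hle|Hgt].
    + replace (cis t - cis s)%C with
        ((cis t - cis s - Ci * cis s * RtoC (t - s)) + Ci * cis s * RtoC (t - s))%C by ring.
      eapply Rle_trans; [apply Cmod_triangle|].
      rewrite !Cmod_mult, Cmod_Ci, Cmod_cis, Cmod_R.
      assert (H1 := H s t). rewrite <- pow2_abs in H1. assert (P := Rabs_pos (t - s)).
      assert (B * Rabs (t - s) ^ 2 <= B * Rabs (t - s)) by (apply Rmult_le_compat_l; nra).
      lra.
    + eapply Rle_trans; [apply Cmod_triangle_minus|]. rewrite !Cmod_cis. nra.
Qed.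

Lemma bdd_lip_cis_neg : bdd_lip (fun t => cis (- t)).
Proof.
  destruct bdd_lip_cis as (K & L & HK & HL & H1 & H2). exists K, L. repeat split; auto.
  intros s t. eapply Rle_trans; [apply H2|]. right. f_equal.
  replace (- t - - s) with (- (t - s)) by ring. apply Rabs_Ropp.
Qed.

Lemma lipschitz_continuous (g : R -> R) (L : R) :
  (forall s t, Rabs (g t - g s) <= L * Rabs (t - s)) -> forall x, continuous g x.
Proof.
  intros H x. apply continuity_pt_filterlim. intros eps He.
  exists (eps / (Rabs L + 1)). assert (P := Rabs_pos L). split.
  - apply Rdiv_lt_0_compat; lra.
  - intros y [_ Hy]. simpl in *. unfold Rdist in *.
    eapply Rle_lt_trans; [apply H|].
    apply Rle_lt_trans with (Rabs L * Rabs (y - x)).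
    + apply Rmult_le_compat_r; [apply Rabs_pos|apply Rle_abs].
    + apply (Rmult_lt_compat_r (Rabs L + 1)) in Hy; [|lra].
      replace (eps / (Rabs L + 1) * (Rabs L + 1)) with eps in Hy by (field; lra).
      assert (P1 := Rabs_pos (y - x)). nra.
Qed.

Lemma Re_minus (z w : C) : Re (z - w) = Re z - Re w.
Proof. reflexivity. Qed.
Lemma Im_minus (z w : C) : Im (z - w) = Im z - Im w.
Proof. reflexivity. Qed.

Lemma bdd_lip_continuous (u : R -> C) : bdd_lip u ->
  (forall x, continuous (fun t => Re (u t)) x) /\ (forall x, continuous (fun t => Im (u t)) x).
Proof.
  intros (K & L & HK & HL & H1 & H2).
  split; apply lipschitz_continuous with L; intros s t.
  - rewrite <- Re_minus. eapply Rle_trans; [apply re_le_Cmod|apply H2].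
  - rewrite <- Im_minus. eapply Rle_trans; [apply im_le_Cmod|apply H2].
Qed.

Lemma bdd_lip_ex_RInt (u : R -> C) (a b : R) : bdd_lip u ->
  ex_RInt (fun t => Re (u t)) a b /\ ex_RInt (fun t => Im (u t)) a b.
Proof.
  intros H. destruct (bdd_lip_continuous u H) as [H1 H2].
  split; apply (ex_RInt_continuous (V := R_CompleteNormedModule)); auto.
Qed.

Definition circle_int (u : R -> C) : C :=
  (RInt (fun t => Re (u t)) 0 (2 * PI), RInt (fun t => Im (u t)) 0 (2 * PI)).

Lemma circle_int_ext (u v : R -> C) : (forall t, u t = v t) -> circle_int u = circle_int v.
Proof. intros H. unfold circle_int. f_equal; apply RInt_ext; intros t _; now rewrite H. Qed.

Lemma circle_int_plus (u v : R -> C) : bdd_lip u -> bdd_lip v ->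
  circle_int (fun t => u t + v t)%C = (circle_int u + circle_int v)%C.
Proof.
  intros Hu Hv. destruct (bdd_lip_ex_RInt u 0 (2 * PI) Hu) as [U1 U2].
  destruct (bdd_lip_ex_RInt v 0 (2 * PI) Hv) as [V1 V2].
  unfold circle_int, Cplus. simpl. f_equal.
  - exact (RInt_plus (V := R_CompleteNormedModule) _ _ _ _ U1 V1).
  - exact (RInt_plus (V := R_CompleteNormedModule) _ _ _ _ U2 V2).
Qed.

Lemma RInt_lin (f g : R -> R) (x y a b : R) : ex_RInt f a b -> ex_RInt g a b ->
  RInt (fun t => x * f t + y * g t) a b = x * RInt f a b + y * RInt g a b.
Proof.
  intros Hf Hg.
  rewrite (RInt_plus (V := R_CompleteNormedModule) (fun t => x * f t) (fun t => y * g t)).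
  - rewrite (RInt_scal (V := R_CompleteNormedModule) f),
      (RInt_scal (V := R_CompleteNormedModule) g) by assumption. reflexivity.
  - exact (ex_RInt_scal (V := R_NormedModule) f a b x Hf).
  - exact (ex_RInt_scal (V := R_NormedModule) g a b y Hg).
Qed.

Lemma circle_int_scal (c : C) (u : R -> C) : bdd_lip u -> circle_int (fun t => c * u t)%C = (c * circle_int u)%C.
Proof.
  intros Hu. destruct (bdd_lip_ex_RInt u 0 (2 * PI) Hu) as [U1 U2].
  unfold circle_int, Cmult. simpl. f_equal.
  - rewrite (RInt_ext _ (fun t => fst c * Re (u t) + (- snd c) * Im (u t))).
    + rewrite RInt_lin by assumption. real_eq. unfold Re, Im; ring.
    + intros t _. real_eq. unfold Re, Im. ring.
  - rewrite (RInt_ext _ (fun t => fst c * Im (u t) + snd c * Re (u t))).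
    + rewrite RInt_lin by assumption. real_eq. unfold Re, Im; ring.
    + intros t _. real_eq. unfold Re, Im. ring.
Qed.

Lemma RInt_abs_le (f : R -> R) (K : R) :
  ex_RInt f 0 (2 * PI) -> (forall t, Rabs (f t) <= K) -> Rabs (RInt f 0 (2 * PI)) <= 2 * PI * K.
Proof.
  intros Hf HK. assert (P := PI_RGT_0).
  assert (H := abs_RInt_le_const f 0 (2 * PI) K ltac:(lra) Hf (fun t _ => HK t)). lra.
Qed.

(** The factor 4 PI in place of 2 PI comes from bounding the real and the imaginary part separately;
    only its finiteness matters later. *)
Lemma circle_int_bound (u : R -> C) (K : R) :
  bdd_lip u -> (forall t, Cmod (u t) <= K) -> Cmod (circle_int u) <= 4 * PI * K.
Proof.
  intros Hu HK. destruct (bdd_lip_ex_RInt u 0 (2 * PI) Hu) as [U1 U2].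
  eapply Rle_trans; [apply Cmod_le_sum|].
  assert (A := RInt_abs_le _ K U1 (fun t => Rle_trans _ _ _ (re_le_Cmod (u t)) (HK t))).
  assert (B := RInt_abs_le _ K U2 (fun t => Rle_trans _ _ _ (im_le_Cmod (u t)) (HK t))).
  unfold circle_int, Re at 1, Im at 1. simpl. lra.
Qed.

Lemma circle_int_const (c : C) : circle_int (fun _ => c) = (2 * PI * c)%C.
Proof.
  unfold circle_int. rewrite !RInt_const. rewrite <- RtoC_mult.
  unfold Cmult, RtoC, scal; simpl; unfold mult; simpl. f_equal; unfold Re, Im; ring.
Qed.

Lemma circle_int_ftc (U u : R -> C) (B : R) :
  bdd_lip u ->
  (forall s t, Cmod (U t - U s - u s * RtoC (t - s)) <= B * (t - s) ^ 2) ->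
  circle_int u = (U (2 * PI)%R - U 0%R)%C.
Proof.
  intros Hu H. destruct (bdd_lip_continuous u Hu) as [C1 C2].
  assert (D1 : forall x, is_derive (fun t => Re (U t)) x (Re (u x))).
  { apply (quadratic_is_derive _ (fun t => Re (u t)) B). intros s t.
    eapply Rle_trans; [|apply H]. eapply Rle_trans; [|apply re_le_Cmod].
    right. f_equal. unfold Re, Cminus, Cplus, Copp, Cmult, RtoC; simpl. ring. }
  assert (D2 : forall x, is_derive (fun t => Im (U t)) x (Im (u x))).
  { apply (quadratic_is_derive _ (fun t => Im (u t)) B). intros s t.
    eapply Rle_trans; [|apply H]. eapply Rle_trans; [|apply im_le_Cmod].
    right. f_equal. unfold Im, Cminus, Cplus, Copp, Cmult, RtoC; simpl. ring. }
  unfold circle_int, Cminus, Cplus, Copp. simpl. f_equal.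
  - apply is_RInt_unique.
    apply (is_RInt_derive (V := R_CompleteNormedModule) (fun t => Re (U t))); auto.
  - apply is_RInt_unique.
    apply (is_RInt_derive (V := R_CompleteNormedModule) (fun t => Im (U t))); auto.
Qed.

Lemma circle_int_cis_pow (n : nat) : (0 < n)%nat -> circle_int (fun t => cis (- t) ^ n)%C = RtoC 0.
Proof.
  intros Hn. assert (Hn' : INR n <> 0) by (apply not_0_INR; lia).
  assert (Epow : forall m t, (cis (- t) ^ m)%C = cis (- (INR m * t))).
  { induction m as [|m IH]; intros t.
    - simpl. rewrite Rmult_0_l, Ropp_0. symmetry. apply cis_0.
    - simpl Cpow. rewrite IH, <- cis_plus, S_INR. f_equal. ring. }
  assert (E : cis (- (INR n * (2 * PI))) = RtoC 1).
  { rewrite <- Epow. replace (cis (- (2 * PI))) with (RtoC 1).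
    - clear. induction n as [|n IH]; simpl; [reflexivity|]. rewrite IH. ring.
    - assert (E := cis_opp (2 * PI)). rewrite cis_2PI, Cmult_1_r in E. now rewrite E. }
  rewrite (circle_int_ext _ (fun t => cis (- (INR n * t)))) by (intros t; apply Epow).
  unfold cis, cexp in *. simpl in *. rewrite exp_0, !Rmult_1_l in E.
  injection E as Ec Es. rewrite cos_neg in Ec. rewrite sin_neg in Es.
  unfold circle_int, RtoC. simpl. rewrite exp_0. f_equal; apply is_RInt_unique.
  - replace 0 with (minus (sin (INR n * (2 * PI)) / INR n) (sin (INR n * 0) / INR n)) at 2.
    + apply (is_RInt_derive (V := R_CompleteNormedModule) (fun t => sin (INR n * t) / INR n)).
      * intros t _. auto_derive; [easy|]. rewrite cos_neg. field. exact Hn'.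
      * intros t _. apply (ex_derive_continuous (fun t => 1 * cos (- (INR n * t)))). auto_derive. easy.
    + rewrite Rmult_0_r, sin_0. unfold minus, plus, opp; simpl.
      replace (sin (INR n * (2 * PI))) with 0 by lra. field. exact Hn'.
  - replace 0 with (minus (cos (INR n * (2 * PI)) / INR n) (cos (INR n * 0) / INR n)) at 2.
    + apply (is_RInt_derive (V := R_CompleteNormedModule) (fun t => cos (INR n * t) / INR n)).
      * intros t _. auto_derive; [easy|]. rewrite sin_neg. field. exact Hn'.
      * intros t _. apply (ex_derive_continuous (fun t => 1 * sin (- (INR n * t)))). auto_derive. easy.
    + rewrite Rmult_0_r, cos_0, Ec. unfold minus, plus, opp; simpl. ring.
Qed.

(** * Cauchy's formula and Taylor series *)

(* [e^{it} / (e^{it} - z)] *)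
Definition cauchy_ker (z : C) (t : R) : C := (/ (1 - z * cis (- t)))%C.

Lemma cauchy_ker_lower (z : C) (t : R) : Cmod z < 1 -> 1 - Cmod z <= Cmod (1 - z * cis (- t)).
Proof.
  intros Hz. assert (H := Cmod_triangle_rev 1 (z * cis (- t))).
  rewrite Cmod_1, Cmod_mult, Cmod_cis in H. lra.
Qed.

Lemma cauchy_ker_neq (z : C) (t : R) : Cmod z < 1 -> (1 - z * cis (- t))%C <> RtoC 0.
Proof. intros Hz. apply Cmod_gt_0. assert (H := cauchy_ker_lower z t Hz). lra. Qed.

Lemma bdd_lip_cauchy_ker (z : C) : Cmod z < 1 -> bdd_lip (cauchy_ker z).
Proof.
  intros Hz. apply (bdd_lip_inv (fun t => 1 - z * cis (- t))%C (1 - Cmod z)).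
  - lra.
  - intros t. now apply cauchy_ker_lower.
  - unfold Cminus. apply (bdd_lip_plus (fun _ => RtoC 1) (fun t => - (z * cis (- t)))%C).
    + apply bdd_lip_const.
    + apply (bdd_lip_ext (fun t => - z * cis (- t))%C); [intros; ring|].
      apply (bdd_lip_mult _ _ (bdd_lip_const (- z)) bdd_lip_cis_neg).
Qed.

Lemma Cmod_cauchy_ker (z : C) (t : R) : Cmod z < 1 -> Cmod (cauchy_ker z t) <= / (1 - Cmod z).
Proof.
  intros Hz. unfold cauchy_ker. rewrite Cmod_inv by now apply cauchy_ker_neq.
  apply Rinv_le_contravar; [lra|]. now apply cauchy_ker_lower.
Qed.

(** The two claims are proved together: additivity of the integral requires the partial sums to be
    bounded and Lipschitz. *)
Lemma sum_n_circle_int (v : R -> C) (z : C) (N : nat) : bdd_lip v ->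
  sum_n (G := C_AbelianMonoid) (fun n => circle_int (fun t => v t * cis (- t) ^ n) * z ^ n)%C N
  = circle_int (fun t => v t * sum_n (G := C_AbelianMonoid) (fun n => (z * cis (- t)) ^ n)%C N)%C
  /\ bdd_lip (fun t => sum_n (G := C_AbelianMonoid) (fun n => (z * cis (- t)) ^ n)%C N).
Proof.
  intros Hv.
  assert (Hz : bdd_lip (fun t => z * cis (- t))%C).
  { apply bdd_lip_mult; [apply bdd_lip_const|apply bdd_lip_cis_neg]. }
  assert (Hterm : forall n, (circle_int (fun t => v t * cis (- t) ^ n) * z ^ n)%C
     = circle_int (fun t => v t * (z * cis (- t)) ^ n)%C).
  { intros n. rewrite Cmult_comm, <- circle_int_scal.
    - apply circle_int_ext. intros t. rewrite Cpow_mult_l. ring.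
    - apply bdd_lip_mult; [exact Hv|apply bdd_lip_pow, bdd_lip_cis_neg]. }
  induction N as [|N [IH IHb]].
  - split.
    + rewrite sum_O, Hterm. apply circle_int_ext. intros t. rewrite sum_O. reflexivity.
    + apply (bdd_lip_ext (fun _ => RtoC 1)); [|apply bdd_lip_const].
      intros t. now rewrite sum_O.
  - split.
    + rewrite sum_Sn, IH, Hterm.
      change (@plus C_AbelianMonoid) with Cplus. rewrite <- circle_int_plus.
      * apply circle_int_ext. intros t. rewrite sum_Sn. change (@plus C_AbelianMonoid) with Cplus. ring.
      * apply bdd_lip_mult; assumption.
      * apply bdd_lip_mult; [assumption|]. now apply bdd_lip_pow.
    + eapply bdd_lip_ext; [|apply (bdd_lip_plus _ _ IHb (bdd_lip_pow _ (S N) Hz))].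
      intros t. now rewrite sum_Sn.
Qed.

(** The kernel is the sum of a geometric series in z e^(-it). The remainder after N terms is the
    kernel times (z e^(-it))^(N+1), which is at most |z|^(N+1) / (1 - |z|) for every t. *)
Lemma cauchy_ker_series (v : R -> C) (z : C) : bdd_lip v -> Cmod z < 1 ->
  cseries (fun n => circle_int (fun t => v t * cis (- t) ^ n) * z ^ n)%C
    (circle_int (fun t => v t * cauchy_ker z t)%C).
Proof.
  intros Hv Hz. apply cseries_sum_lim.
  assert (Hv' := Hv). destruct Hv' as (K & _ & HK & _ & HKv & _).
  assert (Pz := Cmod_ge_0 z).
  set (M := 4 * PI * (K * / (1 - Cmod z))).
  apply (is_lim_seq_le_le (fun _ => 0) _ (fun N => M * Cmod z * Cmod z ^ N)).
  - intros N. split; [apply Cmod_ge_0|].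
    destruct (sum_n_circle_int v z N Hv) as [E Hb]. rewrite E.
    set (g := fun t => sum_n (G := C_AbelianMonoid) (fun n => (z * cis (- t)) ^ n)%C N) in *.
    assert (Eg : forall t, (g t - cauchy_ker z t = - (z * cis (- t)) ^ S N * cauchy_ker z t)%C).
    { intros t. assert (Nk := cauchy_ker_neq z t Hz). unfold g, cauchy_ker.
      set (x := (z * cis (- t))%C) in *.
      assert (Gx : (sum_n (G := C_AbelianMonoid) (fun n => x ^ n)%C N * (1 - x) = 1 - x ^ S N)%C).
      { clear. induction N as [|N IH].
        - rewrite sum_O. simpl. ring.
        - rewrite sum_Sn. change (@plus C_AbelianMonoid) with Cplus.
          rewrite Cmult_plus_distr_r, IH. simpl. ring. }
      replace (sum_n (G := C_AbelianMonoid) (fun n => x ^ n)%C N) with ((1 - x ^ S N) / (1 - x))%C.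
      - field. exact Nk.
      - rewrite <- Gx. field. exact Nk. }
    match goal with |- Cmod ?x <= _ =>
      replace x with (circle_int (fun t => v t * (g t - cauchy_ker z t))%C) end.
    + replace (M * Cmod z * Cmod z ^ N) with
        (4 * PI * (K * (Cmod z ^ S N * / (1 - Cmod z)))) by (unfold M; simpl; ring).
      apply circle_int_bound.
      * apply bdd_lip_mult; [exact Hv|]. unfold Cminus.
        apply bdd_lip_plus; [exact Hb|].
        apply (bdd_lip_ext (fun t => -(1) * cauchy_ker z t)%C); [intros; ring|].
        apply (bdd_lip_mult _ _ (bdd_lip_const _) (bdd_lip_cauchy_ker z Hz)).
      * intros t. rewrite Cmod_mult, Eg, Cmod_mult, Cmod_opp, Cmod_pow, Cmod_mult, Cmod_cis, Rmult_1_r.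
        apply Rmult_le_compat; [apply Cmod_ge_0| |apply HKv|].
        -- apply Rmult_le_pos; [apply pow_le, Pz|apply Cmod_ge_0].
        -- apply Rmult_le_compat_l; [apply pow_le, Pz|now apply Cmod_cauchy_ker].
    + rewrite (circle_int_ext _ (fun t => v t * g t + -(1) * (v t * cauchy_ker z t))%C)
        by (intros t; ring).
      assert (Hvk := bdd_lip_mult _ _ Hv (bdd_lip_cauchy_ker z Hz)).
      rewrite circle_int_plus, circle_int_scal.
      * unfold g. ring.
      * exact Hvk.
      * now apply bdd_lip_mult.
      * now apply (bdd_lip_mult _ _ (bdd_lip_const _)).
  - apply is_lim_seq_const.
  - replace (Finite 0) with (Rbar_mult (M * Cmod z) 0) by (simpl; f_equal; ring).
    apply is_lim_seq_scal_l, is_lim_seq_geom. rewrite Rabs_pos_eq; assumption.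
Qed.

(** The series for the constant function 1 has only its term of index 0. *)
Lemma circle_int_cauchy_ker (z : C) : Cmod z < 1 -> circle_int (cauchy_ker z) = RtoC (2 * PI).
Proof.
  intros Hz.
  assert (H := cauchy_ker_series (fun _ => RtoC 1) z (bdd_lip_const _) Hz).
  replace (circle_int (cauchy_ker z)) with (circle_int (fun t => 1 * cauchy_ker z t)%C)
    by (apply circle_int_ext; intros; ring).
  apply (cseries_unique _ _ _ H).
  replace (RtoC (2 * PI)) with (circle_int (fun t => 1 * cis (- t) ^ 0)%C * z ^ 0 + 0)%C.
  - apply (cseries_cons (fun n => circle_int (fun t => 1 * cis (- t) ^ n) * z ^ n)%C).
    apply (cseries_ext (fun _ => 0 * 0)%C).
    + intros n. rewrite (circle_int_ext _ (fun t => cis (- t) ^ S n)%C) by (intros; ring).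
      rewrite circle_int_cis_pow by lia. ring.
    + apply cseries_sum_lim.
      apply is_lim_seq_ext with (fun _ : nat => 0); [|apply is_lim_seq_const].
      intros n. replace (sum_n (G := C_AbelianMonoid) (fun _ : nat => 0 * 0)%C n) with (RtoC 0).
      * replace (RtoC 0 - RtoC 0)%C with (RtoC 0) by ring. now rewrite Cmod_0.
      * induction n as [|n IH]; [rewrite sum_O; ring|]. rewrite sum_Sn, <- IH.
        change (@plus C_AbelianMonoid) with Cplus. ring.
  - rewrite (circle_int_ext _ (fun _ => RtoC 1)) by (intros; simpl; ring).
    rewrite circle_int_const, RtoC_mult. simpl. ring.
Qed.

(* The integral of [G(z + x(e^{it} - z)) e^{it} / (e^{it} - z)] over [t] does not
   depend on [x]: its [x]-derivative is the integral of an exact [t]-derivative. *)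
Lemma cauchy_formula (G G' : C -> C) (z : C) :
  udiff (cdisk 1) G G' -> Cmod z < 1 ->
  circle_int (fun t => G (cis t) * cauchy_ker z t)%C = (2 * PI * G z)%C.
Proof.
  intros HG Hz.
  assert (Hb : bounded_on (cdisk 1) (fun z => z)) by (apply cdisk_bounded; lra).
  assert (LG := udiff_lip _ _ _ Hb HG). assert (BG := udiff_bounded _ _ _ Hb HG).
  assert (LG' := udiff_lip_deriv _ _ _ HG). assert (BG' := udiff_bounded_deriv _ _ _ Hb HG).
  set (p := fun (x t : R) => (z + x * (cis t - z))%C).
  assert (Hp : forall x t, 0 <= x <= 1 -> cdisk 1 (p x t)).
  { intros x t Hx. apply cdisk_convex; [exact Hx|unfold cdisk; lra|].
    unfold cdisk. rewrite Cmod_cis. lra. }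
  assert (bp : forall x, bdd_lip (p x)).
  { intros x. apply (bdd_lip_ext (fun t => z - x * z + x * cis t)%C);
      [intros t; unfold p; ring|].
    apply (bdd_lip_plus _ _ (bdd_lip_const _) (bdd_lip_mult _ _ (bdd_lip_const (RtoC x)) bdd_lip_cis)). }
  assert (bG : forall x, 0 <= x <= 1 -> bdd_lip (fun t => G (p x t))).
  { intros x Hx. apply (bdd_lip_comp (cdisk 1)); auto. }
  assert (bG' : forall x, 0 <= x <= 1 -> bdd_lip (fun t => G' (p x t))).
  { intros x Hx. apply (bdd_lip_comp (cdisk 1)); auto. }
  assert (bk := bdd_lip_cauchy_ker z Hz).
  destruct HG as [B [HB HG]]. destruct BG' as [K' [HK' BG']].
  destruct cis_second_order as [A [HA Hcis]].
  destruct bdd_lip_cis as (Kc & Lc & HKc & HLc & _ & Lcis).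
  (* For x <> 0 the integrand is the t-derivative of [G (p x t)] divided by x i, and the curve is
     closed. At x = 0 the factor [G' z] is constant and e^(it) integrates to 0. *)
  assert (I0 : forall x, 0 <= x <= 1 -> circle_int (fun t => G' (p x t) * cis t)%C = RtoC 0).
  { intros x Hx. destruct (Req_dec x 0) as [->|Hx0].
    - rewrite (circle_int_ext _ (fun t => G' z * cis t)%C).
      2:{ intros t. f_equal. f_equal. unfold p. ring. }
      rewrite circle_int_scal by apply bdd_lip_cis.
      rewrite (circle_int_ftc (fun t => - Ci * cis t)%C cis A bdd_lip_cis).
      + rewrite cis_2PI, cis_0. ring.
      + intros s t.
        assert (Ci2 : (Ci * Ci)%C = (-(1))%C) by (unfold Ci, Cmult, Copp, RtoC; simpl; f_equal; ring).
        replace (- Ci * cis t - - Ci * cis s - cis s * RtoC (t - s))%C with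
          (- Ci * (cis t - cis s - Ci * cis s * RtoC (t - s)))%C.
        * rewrite Cmod_mult, Cmod_opp, Cmod_Ci, Rmult_1_l. apply Hcis.
        * replace (- Ci * (cis t - cis s - Ci * cis s * RtoC (t - s)))%C with
            (- Ci * cis t - - Ci * cis s + (Ci * Ci) * cis s * RtoC (t - s))%C by ring.
          rewrite Ci2. ring.
    - assert (E : circle_int (fun t => (x * Ci) * (G' (p x t) * cis t))%C = RtoC 0).
      { rewrite (circle_int_ftc (fun t => G (p x t)) _ (B * Lc ^ 2 + K' * A)).
        - unfold p. rewrite cis_2PI, cis_0. ring.
        - apply (bdd_lip_mult _ _ (bdd_lip_const _)). apply bdd_lip_mult; [now apply bG'|].
          apply bdd_lip_cis.
        - intros s t.
          replace (G (p x t) - G (p x s) - x * Ci * (G' (p x s) * cis s) * RtoC (t - s))%C with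
            ((G (p x t) - G (p x s) - G' (p x s) * (p x t - p x s))
             + x * G' (p x s) * (cis t - cis s - Ci * cis s * RtoC (t - s)))%C
            by (unfold p; ring).
          eapply Rle_trans; [apply Cmod_triangle|].
          rewrite (Cmod_mult (x * _)), Cmod_mult, Cmod_R, (Rabs_pos_eq x) by lra.
          assert (H1 := HG (p x s) (p x t) (Hp x s Hx) (Hp x t Hx)).
          assert (H3 := BG' (p x s) (Hp x s Hx)).
          assert (H4 : Cmod (p x t - p x s) <= Lc * Rabs (t - s)).
          { replace (p x t - p x s)%C with (x * (cis t - cis s))%C by (unfold p; ring).
            rewrite Cmod_mult, Cmod_R, (Rabs_pos_eq x) by lra.
            assert (H5 := Lcis s t). assert (H6 := Cmod_ge_0 (cis t - cis s)). nra. }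
          assert (H5 : Cmod (p x t - p x s) ^ 2 <= Lc ^ 2 * (t - s) ^ 2).
          { rewrite <- (pow2_abs (t - s)), <- Rpow_mult_distr. apply pow_incr.
            split; [apply Cmod_ge_0|exact H4]. }
          assert (H6 : x * Cmod (G' (p x s)) * Cmod (cis t - cis s - Ci * cis s * RtoC (t - s))
            <= K' * (A * (t - s) ^ 2)).
          { assert (P := Cmod_ge_0 (G' (p x s))).
            apply Rmult_le_compat; try apply Cmod_ge_0; auto; nra. }
          nra. }
      rewrite circle_int_scal in E.
      2:{ apply bdd_lip_mult; [now apply bG'|apply bdd_lip_cis]. }
      assert (Nx : (x * Ci)%C <> RtoC 0).
      { apply Cmult_neq_0; [intros H; apply RtoC_inj in H; lra|].
        apply Cmod_gt_0. rewrite Cmod_Ci. lra. }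
      replace (circle_int (fun t => G' (p x t) * cis t)%C) with
        ((x * Ci) * circle_int (fun t => G' (p x t) * cis t) / (x * Ci))%C by (field; exact Nx || (split; intros H; apply Nx; rewrite H; ring)).
      rewrite E. field; exact Nx || (split; intros H; apply Nx; rewrite H; ring). }
  (* At x = 1 this is Cauchy's integral, at x = 0 it is [G z] times the integral of the kernel;
     [clamp] makes it a function on the whole line. *)
  set (phi := fun x => circle_int (fun t => G (p (clamp 0 1 x) t) * cauchy_ker z t)%C).
  assert (Ephi : phi 1 = phi 0).
  { assert (Q := PI_RGT_0).
    assert (Hiz : 0 < / (1 - Cmod z)) by (apply Rinv_0_lt_compat; lra).
    apply (quadratic_increment_const phi (4 * PI * (B * 4 * / (1 - Cmod z)))).
    intros x' y'. apply Rle_trans with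
      (4 * PI * (B * 4 * / (1 - Cmod z)) * (clamp 0 1 y' - clamp 0 1 x') ^ 2).
    2:{ apply Rmult_le_compat_l.
        - assert (0 <= B * 4 * / (1 - Cmod z)) by nra. nra.
        - rewrite <- pow2_abs, <- (pow2_abs (y' - x')). apply pow_incr.
          split; [apply Rabs_pos|apply clamp_lip, Rle_0_1]. }
    { assert (Hx := clamp_range 0 1 x' Rle_0_1). assert (Hy := clamp_range 0 1 y' Rle_0_1).
      unfold phi. set (x := clamp 0 1 x') in *. set (y := clamp 0 1 y') in *.
      (* The first-order error of [G] between [p x t] and [p y t]. The subtracted linear term
         contains the factor e^(it) - z, which turns the kernel into e^(it), so by [I0] it
         contributes nothing. The bound |e^(it) - z| <= 2 produces the factor 4. *)
      set (err := fun t => (G (p y t) + -(1) * G (p x t) + (- RtoC (y - x)) * (G' (p x t) * (cis t - z)))%C).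
      assert (berr : bdd_lip err).
      { unfold err. apply bdd_lip_plus; [apply bdd_lip_plus|].
        - now apply bG.
        - apply (bdd_lip_mult _ _ (bdd_lip_const _)). now apply bG.
        - apply (bdd_lip_mult _ _ (bdd_lip_const _)). apply bdd_lip_mult; [now apply bG'|].
          unfold Cminus. apply bdd_lip_plus; [apply bdd_lip_cis|apply bdd_lip_const]. }
      replace (circle_int (fun t => G (p y t) * cauchy_ker z t) - circle_int (fun t => G (p x t) * cauchy_ker z t))%C
        with (circle_int (fun t => err t * cauchy_ker z t)%C).
      + replace (4 * PI * (B * 4 * / (1 - Cmod z)) * (y - x) ^ 2) with
          (4 * PI * ((B * (4 * (y - x) ^ 2)) * / (1 - Cmod z))) by ring.
        apply circle_int_bound; [apply bdd_lip_mult; assumption|].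
        intros t. rewrite Cmod_mult. apply Rmult_le_compat; try apply Cmod_ge_0.
        * unfold err.
          replace (G (p y t) + -(1) * G (p x t) + - RtoC (y - x) * (G' (p x t) * (cis t - z)))%C
            with (G (p y t) - G (p x t) - G' (p x t) * (p y t - p x t))%C
            by (unfold p; rewrite RtoC_minus; ring).
          eapply Rle_trans; [apply HG; apply Hp; assumption|].
          apply Rmult_le_compat_l; [exact HB|].
          replace (p y t - p x t)%C with (RtoC (y - x) * (cis t - z))%C
            by (unfold p; rewrite RtoC_minus; ring).
          rewrite Cmod_mult, Cmod_R, Rpow_mult_distr, pow2_abs, Rmult_comm.
          apply Rmult_le_compat_r; [apply pow2_ge_0|].
          assert (H1 := Cmod_triangle_minus (cis t) z). rewrite Cmod_cis in H1.
          assert (H2 := Cmod_ge_0 (cis t - z)). nra.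
        * now apply Cmod_cauchy_ker.
      + rewrite (circle_int_ext _ (fun t => G (p y t) * cauchy_ker z t + (-(1) * (G (p x t) * cauchy_ker z t)
           + (- RtoC (y - x)) * (G' (p x t) * cis t)))%C).
        * rewrite circle_int_plus, circle_int_plus, !circle_int_scal, I0; auto.
          -- ring.
          -- apply bdd_lip_mult; [now apply bG'|apply bdd_lip_cis].
          -- apply bdd_lip_mult; [now apply bG|exact bk].
          -- apply (bdd_lip_mult _ _ (bdd_lip_const _)). apply bdd_lip_mult; [now apply bG|exact bk].
          -- apply (bdd_lip_mult _ _ (bdd_lip_const _)). apply bdd_lip_mult; [now apply bG'|apply bdd_lip_cis].
          -- apply bdd_lip_mult; [now apply bG|exact bk].
          -- apply bdd_lip_plus.
             ++ apply (bdd_lip_mult _ _ (bdd_lip_const _)). apply bdd_lip_mult; [now apply bG|exact bk].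
             ++ apply (bdd_lip_mult _ _ (bdd_lip_const _)). apply bdd_lip_mult; [now apply bG'|apply bdd_lip_cis].
        * intros t. unfold err.
          assert (Ek : ((cis t - z) * cauchy_ker z t = cis t)%C).
          { unfold cauchy_ker. assert (Nk := cauchy_ker_neq z t Hz).
            replace (cis t - z)%C with (cis t * (1 - z * cis (- t)))%C.
            - field. exact Nk.
            - replace (cis t * (1 - z * cis (- t)))%C with (cis t - z * (cis (- t) * cis t))%C by ring.
              rewrite cis_opp. ring. }
          rewrite <- Ek at 2. ring. } }
  unfold phi in Ephi.
  rewrite !clamp_id in Ephi by lra.
  rewrite (circle_int_ext _ (fun t => G (p 1 t) * cauchy_ker z t)%C).
  - rewrite Ephi, (circle_int_ext _ (fun t => G z * cauchy_ker z t)%C).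
    + rewrite circle_int_scal, circle_int_cauchy_ker, RtoC_mult by assumption. ring.
    + intros t. do 2 f_equal. unfold p. ring.
  - intros t. do 2 f_equal. unfold p. ring.
Qed.

Lemma holo_scale (F F' : C -> C) (r : R) : holo F F' -> 0 < r < 1 ->
  udiff (cdisk 1) (fun z => F (r * z)%C) (fun z => F' (r * z) * r)%C.
Proof.
  intros HF Hr.
  apply (udiff_comp (cdisk 1) (cdisk r) F F' (fun z => r * z)%C (fun _ => RtoC r)).
  - apply cdisk_bounded; lra.
  - apply cdisk_bounded; lra.
  - intros z Hz. unfold cdisk in *. rewrite Cmod_mult, Cmod_R, Rabs_pos_eq by lra. nra.
  - apply HF. lra.
  - apply (udiff_ext _ (fun z => r * z)%C (fun _ => r * 1)%C).
    + reflexivity.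
    + intros; ring.
    + apply udiff_scal, udiff_id.
Qed.

Lemma udiff_pser (G G' : C -> C) : udiff (cdisk 1) G G' -> exists c, pser c G.
Proof.
  intros HG.
  assert (Hb : bounded_on (cdisk 1) (fun z => z)) by (apply cdisk_bounded; lra).
  assert (bG : bdd_lip (fun t => G (cis t))).
  { apply (bdd_lip_comp (cdisk 1)).
    - exact (udiff_bounded _ _ _ Hb HG).
    - exact (udiff_lip _ _ _ Hb HG).
    - intros t. unfold cdisk. rewrite Cmod_cis. lra.
    - apply bdd_lip_cis. }
  assert (NP : RtoC (2 * PI) <> RtoC 0).
  { intros H. apply RtoC_inj in H. assert (P := PI_RGT_0). lra. }
  exists (fun n => / RtoC (2 * PI) * circle_int (fun t => G (cis t) * cis (- t) ^ n))%C.
  intros z Hz. assert (H := cauchy_ker_series _ z bG Hz). cbv beta in H.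
  rewrite (cauchy_formula G G' z HG Hz) in H.
  apply (cseries_scal (/ RtoC (2 * PI))) in H.
  replace (G z) with (/ RtoC (2 * PI) * (2 * PI * G z))%C.
  - eapply cseries_ext; [|exact H]. intros n. cbv beta. ring.
  - rewrite RtoC_mult in *. rewrite Cmult_assoc, Cinv_l by exact NP. ring.
Qed.

(** Cauchy's formula expands F(r w) in |w| < 1 for each r < 1 separately. The coefficients are fixed
    at r = 1/2; a larger r reaches a given z, and uniqueness shows that its expansion is the same
    one rescaled. *)
Theorem holo_pser (F F' : C -> C) : holo F F' -> exists c, pser c F.
Proof.
  intros HF.
  destruct (udiff_pser _ _ (holo_scale F F' (1 / 2) HF ltac:(lra))) as [d Hd].
  exists (fun n => d n * 2 ^ n)%C. intros z Hz. assert (Pz := Cmod_ge_0 z).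
  set (r := (Rmax (Cmod z) (1 / 2) + 1) / 2).
  assert (M1 := Rmax_l (Cmod z) (1 / 2)). assert (M2 := Rmax_r (Cmod z) (1 / 2)).
  assert (M3 : Rmax (Cmod z) (1 / 2) < 1) by (apply Rmax_lub_lt; lra).
  assert (Hr : 0 < r < 1) by (unfold r; lra).
  assert (Hzr : Cmod z < r) by (unfold r; lra). assert (Hr2 : 1 / 2 < r) by (unfold r; lra).
  destruct (udiff_pser _ _ (holo_scale F F' r HF Hr)) as [e He].
  assert (Nr : RtoC r <> RtoC 0) by (intros H; apply RtoC_inj in H; lra).
  (* Both sides expand F(w/2): the factor 1 / (2 r) < 1 shrinks the disk of radius r to the one of
     radius 1/2. *)
  assert (E : forall n, d n = (e n * (/ (2 * r)) ^ n)%C).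
  { apply (pser_unique d _ (fun z => F (RtoC (1 / 2) * z)%C) Hd).
    intros w Hw.
    assert (H := He (/ (2 * r) * w)%C).
    replace (F (RtoC (1 / 2) * w)%C) with (F (r * (/ (2 * r) * w))%C).
    - eapply cseries_ext; [|apply H].
      + intros n. cbv beta. rewrite Cpow_mult_l. ring.
      + rewrite Cmod_mult, <- RtoC_mult, <- RtoC_inv, Cmod_R by lra.
        assert (H1 : 0 < / (2 * r) < 1).
        { split; [apply Rinv_0_lt_compat; lra|]. rewrite <- Rinv_1. apply Rinv_lt_contravar; lra. }
        rewrite Rabs_pos_eq by lra. assert (Pw := Cmod_ge_0 w). nra.
    - f_equal. rewrite RtoC_div by lra. field; repeat split; assumption. }
  assert (Hzr' : Cmod (z / r) < 1).
  { rewrite Cmod_div, Cmod_R, Rabs_pos_eq by (assumption || lra).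
    apply Rmult_lt_reg_r with r; [lra|]. replace (Cmod z / r * r) with (Cmod z) by (field; lra). lra. }
  assert (H := He (z / r)%C Hzr'). cbv beta in H.
  replace (r * (z / r))%C with z in H by (field; exact Nr).
  eapply cseries_ext; [|exact H]. intros n. cbv beta. rewrite E.
  replace (e n * (/ (2 * r)) ^ n * 2 ^ n * z ^ n)%C with (e n * ((/ (2 * r)) ^ n * 2 ^ n * z ^ n))%C by ring.
  rewrite <- !Cpow_mult_l. do 2 f_equal. field; repeat split; assumption.
Qed.

Lemma mean_value (F F' : C -> C) (r : R) : holo F F' -> 0 < r < 1 ->
  circle_int (fun t => F (r * cis t)%C) = (2 * PI * F (RtoC 0))%C.
Proof.
  intros HF Hr.
  assert (H := cauchy_formula _ _ (RtoC 0) (holo_scale F F' r HF Hr)).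
  rewrite Cmod_0 in H. specialize (H Rlt_0_1). cbv beta in H. rewrite Cmult_0_r in H.
  rewrite <- H. apply circle_int_ext. intros t. unfold cauchy_ker.
  field.
Qed.

(** * Finite sums *)

Fixpoint rsum (f : nat -> R) (N : nat) : R :=
  match N with O => 0 | S n => rsum f n + f n end.

Lemma rsum_ext (f g : nat -> R) (N : nat) :
  (forall n, (n < N)%nat -> f n = g n) -> rsum f N = rsum g N.
Proof.
  induction N as [|N IH]; intros H; simpl; [reflexivity|].
  rewrite IH, H by (intros; try apply H; lia). reflexivity.
Qed.

Lemma rsum_le (f g : nat -> R) (N : nat) :
  (forall n, (n < N)%nat -> f n <= g n) -> rsum f N <= rsum g N.
Proof.
  induction N as [|N IH]; intros H; simpl; [lra|].
  apply Rplus_le_compat; [apply IH; intros|]; apply H; lia.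
Qed.

Lemma rsum_plus (f g : nat -> R) (N : nat) :
  rsum (fun n => f n + g n) N = rsum f N + rsum g N.
Proof. induction N as [|N IH]; simpl; [ring|]. rewrite IH. ring. Qed.

Lemma rsum_scal (x : R) (f : nat -> R) (N : nat) :
  rsum (fun n => x * f n) N = x * rsum f N.
Proof. induction N as [|N IH]; simpl; [ring|]. rewrite IH. ring. Qed.

Lemma rsum_const (x : R) (N : nat) : rsum (fun _ => x) N = INR N * x.
Proof.
  induction N as [|N IH]; [simpl; ring|]. simpl rsum. rewrite IH, S_INR. ring.
Qed.

Lemma rsum_nonneg (f : nat -> R) (N : nat) :
  (forall n, (n < N)%nat -> 0 <= f n) -> 0 <= rsum f N.
Proof.
  intros H. replace 0 with (rsum (fun _ => 0) N).
  - now apply rsum_le.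
  - rewrite rsum_const. ring.
Qed.

Lemma rsum_S_l (f : nat -> R) (N : nat) : rsum f (S N) = f 0%nat + rsum (fun n => f (S n)) N.
Proof. induction N as [|N IH]; [simpl; ring|]. change (rsum f (S (S N))) with (rsum f (S N) + f (S N)).
  rewrite IH. simpl. ring. Qed.

Lemma rsum_app (f : nat -> R) (M N : nat) :
  rsum f (M + N) = rsum f M + rsum (fun n => f (M + n)%nat) N.
Proof.
  induction N as [|N IH]; [rewrite PeanoNat.Nat.add_0_r; simpl; ring|].
  rewrite PeanoNat.Nat.add_succ_r. simpl. rewrite IH. ring.
Qed.

(** * Bessel's inequality *)

Definition mean_sq (F : C -> C) (r : R) : R :=
  RInt (fun t => Cmod (F (r * cis t)%C) ^ 2) 0 (2 * PI).

Lemma cdisk_cis (r t : R) : 0 <= r -> cdisk r (r * cis t).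
Proof.
  intros Hr. unfold cdisk. rewrite Cmod_mult, Cmod_cis, Cmod_R, Rabs_pos_eq; lra.
Qed.

Lemma holo_bdd_lip (F F' : C -> C) (r : R) : holo F F' -> 0 <= r < 1 ->
  bdd_lip (fun t => F (r * cis t)%C).
Proof.
  intros HF Hr. assert (Hb := cdisk_bounded r (proj1 Hr)).
  apply (bdd_lip_comp (cdisk r)).
  - exact (udiff_bounded _ _ _ Hb (HF r Hr)).
  - exact (udiff_lip _ _ _ Hb (HF r Hr)).
  - intros t. apply cdisk_cis. lra.
  - apply (bdd_lip_mult _ _ (bdd_lip_const _) bdd_lip_cis).
Qed.

Lemma Cmod_sq (z : C) : Cmod z ^ 2 = Re (z * Cconj z).
Proof.
  rewrite Cmod2_alt. unfold Re, Im, Cmult, Cconj; simpl. ring.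
Qed.

Lemma bdd_lip_sq_ex_RInt (u : R -> C) (a b : R) : bdd_lip u -> ex_RInt (fun t => Cmod (u t) ^ 2) a b.
Proof.
  intros Hu. apply (ex_RInt_ext (fun t => Re (u t * Cconj (u t)))).
  - intros t _. symmetry. apply Cmod_sq.
  - exact (proj1 (bdd_lip_ex_RInt _ a b (bdd_lip_mult _ _ Hu (bdd_lip_conj _ Hu)))).
Qed.

(** In |c_0 + z H|^2 the cross term is twice the real part of conj(c_0) z H(z), a holomorphic
    function that vanishes at 0, so its circular mean is 0. *)
Lemma mean_sq_tail (c : nat -> C) (F H : C -> C) (r : R) :
  0 < r < 1 -> pser c F -> pser (fun n => c (S n)) H ->
  (forall z, Cmod z < 1 -> F z = (c 0%nat + z * H z)%C) ->
  mean_sq F r = 2 * PI * Cmod (c 0%nat) ^ 2 + r ^ 2 * mean_sq H r.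
Proof.
  intros Hr HF HH E.
  destruct (pser_deriv _ _ HH) as [H' [_ DH]].
  assert (Eint := mean_value _ _ r
    (holo_scal (Cconj (c 0%nat)) _ _ (holo_mult _ _ _ _ holo_id DH)) Hr).
  assert (bK := holo_bdd_lip _ _ r
    (holo_scal (Cconj (c 0%nat)) _ _ (holo_mult _ _ _ _ holo_id DH)) ltac:(lra)).
  cbv beta in Eint, bK.
  assert (ERe : RInt (fun t => Re (Cconj (c 0%nat) * (r * cis t * H (r * cis t)%C))%C) 0 (2 * PI) = 0).
  { transitivity (Re (2 * PI * (Cconj (c 0%nat) * (0 * H (RtoC 0))))%C).
    - rewrite <- Eint. reflexivity.
    - replace (2 * PI * (Cconj (c 0%nat) * (0 * H (RtoC 0))))%C with (RtoC 0) by ring.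
      reflexivity. }
  destruct (bdd_lip_ex_RInt _ 0 (2 * PI) bK) as [I1 _].
  assert (I2 := bdd_lip_sq_ex_RInt _ 0 (2 * PI) (holo_bdd_lip _ _ r DH ltac:(lra))).
  unfold mean_sq.
  rewrite (RInt_ext _ (fun t => 1 * Cmod (c 0%nat) ^ 2 +
    1 * (2 * Re (Cconj (c 0%nat) * (r * cis t * H (r * cis t)%C))%C
      + r ^ 2 * Cmod (H (r * cis t)%C) ^ 2))).
  - rewrite (RInt_lin (fun _ => Cmod (c 0%nat) ^ 2)).
    + rewrite (RInt_lin _ _ 2 (r ^ 2)) by assumption. rewrite ERe, RInt_const.
      unfold scal; simpl; unfold mult; simpl. real_eq. ring.
    + apply ex_RInt_const.
    + apply (ex_RInt_plus (V := R_NormedModule)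
        (fun t => 2 * Re (Cconj (c 0%nat) * (r * cis t * H (r * cis t)%C))%C)
        (fun t => r ^ 2 * Cmod (H (r * cis t)%C) ^ 2)).
      * apply (ex_RInt_scal (V := R_NormedModule) _ 0 (2 * PI) 2 I1).
      * apply (ex_RInt_scal (V := R_NormedModule) _ 0 (2 * PI) (r ^ 2) I2).
  - intros t _. real_eq. rewrite E.
    2:{ assert (Hd := cdisk_cis r t ltac:(lra)). unfold cdisk in Hd. lra. }
    set (h := H (r * cis t)%C).
    assert (Er : Cmod (r * cis t * h) ^ 2 = r ^ 2 * Cmod h ^ 2).
    { rewrite !Cmod_mult, Cmod_cis, Cmod_R, <- (pow2_abs r). ring. }
    rewrite <- Er. set (k := (r * cis t * h)%C).
    rewrite !Cmod2_alt. unfold Re, Im, Cplus, Cmult, Cconj; simpl. ring.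
Qed.

Lemma mean_sq_nonneg (F F' : C -> C) (r : R) : holo F F' -> 0 < r < 1 -> 0 <= mean_sq F r.
Proof.
  intros HF Hr. assert (P := PI_RGT_0). unfold mean_sq.
  apply RInt_ge_0; [lra| |].
  - apply (bdd_lip_sq_ex_RInt (fun t => F (r * cis t)%C)). apply (holo_bdd_lip F F'); [exact HF|lra].
  - intros t _. apply pow2_ge_0.
Qed.

(** Each use of [mean_sq_tail] extracts one coefficient exactly; what is left after N of them is
    nonnegative. *)
Lemma bessel (c : nat -> C) (F : C -> C) (r : R) (N : nat) :
  0 < r < 1 -> pser c F ->
  2 * PI * rsum (fun n => Cmod (c n) ^ 2 * r ^ (2 * n)) N <= mean_sq F r.
Proof.
  intros Hr. revert c F. induction N as [|N IH]; intros c F HF.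
  - destruct (pser_deriv _ _ HF) as [F' [_ DF]].
    simpl. rewrite Rmult_0_r. now apply (mean_sq_nonneg F F').
  - destruct (pser_tail c F HF) as [H [HH E]].
    rewrite (mean_sq_tail c F H r Hr HF HH E), rsum_S_l.
    assert (IH' := IH _ _ HH).
    rewrite (rsum_ext (fun n => Cmod (c (S n)) ^ 2 * r ^ (2 * S n))
      (fun n => r ^ 2 * (Cmod (c (S n)) ^ 2 * r ^ (2 * n)))).
    + rewrite rsum_scal. assert (0 <= r ^ 2) by apply pow2_ge_0.
      replace (2 * 0)%nat with 0%nat by lia. simpl (r ^ 0).
      apply (Rmult_le_compat_l (r ^ 2)) in IH'; [|assumption]. lra.
    + intros n _. replace (2 * S n)%nat with (2 + 2 * n)%nat by lia. rewrite pow_add. ring.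
Qed.

(** * Riemann sums of a radial kernel *)

Definition rlip (L : R) (f : R -> R) : Prop :=
  forall s t, Rabs (f t - f s) <= L * Rabs (t - s).

Lemma rlip_ex_RInt (L : R) (f : R -> R) (a b : R) : rlip L f -> ex_RInt f a b.
Proof.
  intros H. apply (ex_RInt_continuous (V := R_CompleteNormedModule)).
  intros x _. now apply lipschitz_continuous with L.
Qed.

Lemma rlip_scal (L x : R) (f : R -> R) : rlip L f -> rlip (Rabs x * L) (fun t => x * f t).
Proof.
  intros Hf s t. replace (x * f t - x * f s) with (x * (f t - f s)) by ring.
  rewrite Rabs_mult, Rmult_assoc. apply Rmult_le_compat_l; [apply Rabs_pos|apply Hf].
Qed.

Lemma rlip_const (x : R) : rlip 0 (fun _ => x).
Proof. intros s t. rewrite Rminus_diag, Rabs_R0. lra. Qed.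

Lemma RInt_le_const_lip (L : R) (f : R -> R) (a b K : R) :
  a <= b -> rlip L f -> (forall t, a <= t <= b -> f t <= K) -> RInt f a b <= (b - a) * K.
Proof.
  intros Hab Hf HK. replace ((b - a) * K) with (RInt (fun _ => K) a b).
  - apply RInt_le; [exact Hab|now apply rlip_ex_RInt with L|apply ex_RInt_const|].
    intros t Ht. apply HK. lra.
  - rewrite RInt_const. unfold scal; simpl; unfold mult; simpl. reflexivity.
Qed.

Lemma RInt_split (L : R) (f : R -> R) (a b c : R) : rlip L f ->
  RInt f a c = RInt f a b + RInt f b c.
Proof.
  intros Hf. symmetry.
  apply (RInt_Chasles (V := R_CompleteNormedModule)); now apply rlip_ex_RInt with L.
Qed.

Lemma RInt_zero (f : R -> R) (a b : R) :
  a <= b -> (forall t, a < t < b -> f t = 0) -> RInt f a b = 0.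
Proof.
  intros Hab H. rewrite (RInt_ext f (fun _ => 0)).
  - rewrite RInt_const. unfold scal; simpl; unfold mult; simpl. real_eq. ring.
  - intros t. rewrite Rmin_left, Rmax_right by lra. apply H.
Qed.

(** The local oscillation is bounded by a density [e] instead of a constant. With [e] supported near
    the support of [f], the error does not grow with the length of the summation interval. *)
Lemma riemann_sum_error (L M : R) (f e : R -> R) (a h : R) (N : nat) :
  0 <= h -> rlip L f -> rlip M e ->
  (forall s t, s <= t <= s + h -> Rabs (f s - f t) <= e t) ->
  Rabs (h * rsum (fun n => f (a + h * INR n)) N - RInt f a (a + h * INR N))
    <= RInt e a (a + h * INR N).
Proof.
  intros Hh Hf He H. induction N as [|N IH].
  - simpl. rewrite !Rmult_0_r, Rplus_0_r, !RInt_point.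
    change (Rabs (0 - 0) <= 0). rewrite Rminus_diag, Rabs_R0. lra.
  - simpl rsum. rewrite S_INR. set (x := a + h * INR N) in *.
    replace (a + h * (INR N + 1)) with (x + h) by (unfold x; ring).
    rewrite (RInt_split L f a x), (RInt_split M e a x), Rmult_plus_distr_l by assumption.
    assert (Hcell : Rabs (h * f x - RInt f x (x + h)) <= RInt e x (x + h)).
    { replace (h * f x - RInt f x (x + h)) with (RInt (fun t => f x - f t) x (x + h)).
      - eapply Rle_trans; [apply abs_RInt_le; [lra|]|].
        + apply (ex_RInt_minus (V := R_NormedModule) (fun _ => f x) f);
            [apply ex_RInt_const|now apply rlip_ex_RInt with L].
        + apply RInt_le; [lra| |now apply rlip_ex_RInt with M|].
          * apply (rlip_ex_RInt L). intros s t.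
            assert (H1 := Rabs_triang_inv2 (f x - f t) (f x - f s)).
            replace (f x - f t - (f x - f s)) with (- (f t - f s)) in H1 by ring.
            rewrite Rabs_Ropp in H1. assert (H2 := Hf s t). lra.
          * intros t Ht. apply H. lra.
      - rewrite (RInt_minus (V := R_CompleteNormedModule) (fun _ => f x) f);
          [|apply ex_RInt_const|now apply rlip_ex_RInt with L].
        rewrite RInt_const. unfold minus, plus, opp, scal; simpl; unfold mult; simpl. ring. }
    match goal with |- Rabs ?u <= _ => replace u with
      ((h * rsum (fun n => f (a + h * INR n)) N - RInt f a x) + (h * f x - RInt f x (x + h)))
      by ring end.
    eapply Rle_trans; [apply Rabs_triang|]. apply Rplus_le_compat; assumption.
Qed.

Lemma riemann_sum_ge (L : R) (f : R -> R) (a h : R) (N : nat) :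
  0 <= L -> 0 <= h -> rlip L f ->
  RInt f a (a + h * INR N) - L * h * (h * INR N) <= h * rsum (fun n => f (a + h * INR n)) N.
Proof.
  intros HL Hh Hf.
  assert (H := riemann_sum_error L 0 f (fun _ => L * h) a h N Hh Hf (rlip_const _)).
  rewrite RInt_const in H.
  match type of H with _ -> _ <= scal ?u ?v => change (scal u v) with (u * v) in H end.
  assert (H1 : forall s t, s <= t <= s + h -> Rabs (f s - f t) <= L * h).
  { intros s t Hst. eapply Rle_trans; [apply Hf|]. apply Rmult_le_compat_l; [exact HL|].
    rewrite Rabs_left1; lra. }
  specialize (H H1). apply Rabs_le_between in H. lra.
Qed.

(** A Lipschitz substitute for the indicator of [-rho, rho], so that it can itself be integrated and
    sampled by the lemmas on Lipschitz functions. *)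
Definition cutoff (rho t : R) : R := Rmax 0 (Rmin 1 (rho + 1 - Rabs t)).

Lemma rlip_cutoff (rho : R) : rlip 1 (cutoff rho).
Proof.
  intros s t. unfold cutoff. assert (H := Rabs_triang_inv2 t s).
  unfold Rmax, Rmin. repeat destruct Rle_dec; unfold Rabs in *; repeat destruct Rcase_abs; lra.
Qed.

Lemma cutoff_range (rho t : R) : 0 <= cutoff rho t <= 1.
Proof. unfold cutoff, Rmax, Rmin. repeat destruct Rle_dec; lra. Qed.

Lemma cutoff_in (rho t : R) : Rabs t <= rho -> cutoff rho t = 1.
Proof. intros H. unfold cutoff. rewrite Rmin_left, Rmax_right; lra. Qed.

Lemma cutoff_out (rho t : R) : rho + 1 <= Rabs t -> cutoff rho t = 0.
Proof. intros H. unfold cutoff. apply Rmax_left. eapply Rle_trans; [apply Rmin_r|]. lra. Qed.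

Lemma RInt_support_le (L : R) (f : R -> R) (rho a b : R) :
  0 <= rho -> a <= b -> rlip L f -> (forall t, 0 <= f t) -> (forall t, rho <= Rabs t -> f t = 0) ->
  RInt f a b <= RInt f (- rho) rho.
Proof.
  intros Hr Hab Hf H0 Hs.
  set (a' := Rmin a (- rho)). set (b' := Rmax b rho).
  assert (A1 : a' <= a) by apply Rmin_l. assert (A2 : a' <= - rho) by apply Rmin_r.
  assert (B1 : b <= b') by apply Rmax_l. assert (B2 : rho <= b') by apply Rmax_r.
  assert (Hge : forall x y, x <= y -> 0 <= RInt f x y).
  { intros x y Hxy. apply RInt_ge_0; [exact Hxy|now apply rlip_ex_RInt with L|auto]. }
  assert (E1 : RInt f a' b' = RInt f a' a + RInt f a b + RInt f b b').
  { rewrite (RInt_split L f a' a b'), (RInt_split L f a b b') by exact Hf. real_eq. ring. }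
  assert (E2 : RInt f a' b' = RInt f a' (- rho) + RInt f (- rho) rho + RInt f rho b').
  { rewrite (RInt_split L f a' (- rho) b'), (RInt_split L f (- rho) rho b') by exact Hf. real_eq. ring. }
  rewrite (RInt_zero f a' (- rho)), (RInt_zero f rho b') in E2; try lra.
  - assert (P1 := Hge a' a A1). assert (P2 := Hge b b' B1). lra.
  - intros t Ht. apply Hs. rewrite Rabs_pos_eq; lra.
  - intros t Ht. apply Hs. rewrite Rabs_left; lra.
Qed.

(** The oscillation is at most L h and occurs only near the support of [f], hence a bound that
    involves neither [a] nor [N]. *)
Lemma supported_sum (L : R) (f : R -> R) (rho a h : R) (N : nat) :
  0 <= L -> 0 <= rho -> 0 <= h <= 1 -> rlip L f ->
  (forall t, rho <= Rabs t -> f t = 0) ->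
  Rabs (h * rsum (fun n => f (a + h * INR n)) N - RInt f a (a + h * INR N))
    <= 2 * (rho + 2) * L * h.
Proof.
  intros HL Hr Hh Hf Hs.
  assert (Hlh : 0 <= L * h) by nra.
  (* The margin 1 suffices because h <= 1: if |t| > rho + 1, then s and t both lie where [f]
     vanishes. *)
  set (e := fun t => L * h * cutoff (rho + 1) t).
  assert (He : rlip (Rabs (L * h) * 1) e) by apply rlip_scal, rlip_cutoff.
  assert (Herange : forall t, 0 <= e t <= L * h).
  { intros t. unfold e. assert (H := cutoff_range (rho + 1) t). nra. }
  eapply Rle_trans; [apply (riemann_sum_error L _ f e a h N (proj1 Hh) Hf He)|].
  - intros s t Hst. destruct (Rle_dec (Rabs t) (rho + 1)) as [Hin|Hout].
    + unfold e. rewrite cutoff_in, Rmult_1_r by exact Hin.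
      eapply Rle_trans; [apply Hf|]. apply Rmult_le_compat_l; [exact HL|]. rewrite Rabs_left1; lra.
    + rewrite (Hs s), (Hs t), Rminus_diag, Rabs_R0; [apply Herange|lra|].
      assert (H1 := Rabs_triang_inv t (t - s)). replace (t - (t - s)) with s in H1 by ring.
      rewrite (Rabs_pos_eq (t - s)) in H1 by lra. lra.
  - apply Rle_trans with (RInt e (- (rho + 2)) (rho + 2)).
    + apply (RInt_support_le _ e (rho + 2) a (a + h * INR N) ltac:(lra)
        ltac:(assert (P := pos_INR N); nra) He); [apply Herange|].
      intros t Ht. unfold e. rewrite cutoff_out by lra. ring.
    + replace (2 * (rho + 2) * L * h) with ((rho + 2 - - (rho + 2)) * (L * h)) by ring.
      apply (RInt_le_const_lip (Rabs (L * h) * 1) e (- (rho + 2)) (rho + 2) (L * h) ltac:(lra) He). intros t _. apply Herange.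
Qed.

Lemma supported_sum_upper (L : R) (f : R -> R) (rho a h : R) (N : nat) :
  0 <= L -> 0 <= rho -> 0 <= h <= 1 -> rlip L f ->
  (forall t, 0 <= f t) -> (forall t, rho <= Rabs t -> f t = 0) ->
  h * rsum (fun n => f (a + h * INR n)) N <= RInt f (- rho) rho + 2 * (rho + 2) * L * h.
Proof.
  intros HL Hr Hh Hf H0 Hs. assert (H := supported_sum L f rho a h N HL Hr Hh Hf Hs).
  apply Rabs_le_between in H. assert (P := pos_INR N).
  assert (H1 := RInt_support_le L f rho a (a + h * INR N) Hr ltac:(nra) Hf H0 Hs). lra.
Qed.

Lemma supported_sum_lower (L : R) (f : R -> R) (rho a h : R) (N : nat) :
  0 <= L -> 0 <= rho -> 0 <= h <= 1 -> rlip L f ->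
  (forall t, 0 <= f t) -> (forall t, rho <= Rabs t -> f t = 0) ->
  a <= - rho -> rho <= a + h * INR N ->
  RInt f (- rho) rho - 2 * (rho + 2) * L * h <= h * rsum (fun n => f (a + h * INR n)) N.
Proof.
  intros HL Hr Hh Hf H0 Hs Ha HN. assert (H := supported_sum L f rho a h N HL Hr Hh Hf Hs).
  apply Rabs_le_between in H.
  rewrite (RInt_split L f a (- rho)), (RInt_split L f (- rho) rho (a + _)) in H by exact Hf.
  assert (Hge : forall x y, x <= y -> 0 <= RInt f x y).
  { intros x y Hxy. apply RInt_ge_0; [exact Hxy|now apply rlip_ex_RInt with L|auto]. }
  assert (P1 := Hge _ _ Ha). assert (P2 := Hge _ _ HN). lra.
Qed.

(** * The paraboloid kernel and its lattice sums *)

(** It serves twice: scaled by M it is the test function phi, scaled by a small sigma it is the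
    kernel that spreads a point mass over the target lattice. As a function of |u| alone it is
    unchanged by rotations. *)
Definition kern (u : C) : R := Rmax 0 (1 - Cmod u ^ 2).

Lemma kern_range (u : C) : 0 <= kern u <= 1.
Proof.
  unfold kern. assert (H := pow2_ge_0 (Cmod u)).
  unfold Rmax. destruct Rle_dec; lra.
Qed.

Lemma kern_out (u : C) : 1 <= Cmod u -> kern u = 0.
Proof. intros H. unfold kern. apply Rmax_left. nra. Qed.

Lemma kern_lip (u v : C) : Rabs (kern u - kern v) <= 2 * Cmod (u - v).
Proof.
  assert (H : forall u v, kern u - kern v <= 2 * Cmod (u - v)).
  { clear. intros u v. assert (Pu := Cmod_ge_0 u). assert (Pv := Cmod_ge_0 v).
    assert (P := Cmod_ge_0 (u - v)).
    assert (T := Cmod_triangle_rev v u). rewrite Cmod_minus_sym in T.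
    unfold kern. set (a := Cmod u) in *. set (b := Cmod v) in *. set (d := Cmod (u - v)) in *.
    unfold Rmax. destruct (Rle_dec 0 (1 - a ^ 2)) as [Ha|Ha], (Rle_dec 0 (1 - b ^ 2)) as [Hb|Hb];
      [| |lra|lra].
    - assert (a <= 1) by nra. assert (b <= 1) by nra.
      destruct (Rle_dec b a); nra.
    - assert (a <= 1) by nra. assert (1 <= b) by nra. nra. }
  assert (H1 := H u v). assert (H2 := H v u). rewrite Cmod_minus_sym in H2.
  apply Rabs_le. lra.
Qed.

Lemma kern_x (x y : R) : kern (x, y) = Rmax 0 (1 - x ^ 2 - y ^ 2).
Proof. unfold kern. rewrite Cmod2_alt. simpl. f_equal. ring. Qed.

Lemma rlip_kern_y (x : R) : rlip 2 (fun y => kern (x, y)).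
Proof.
  intros s t. eapply Rle_trans; [apply kern_lip|].
  replace ((x, t) - (x, s))%C with (Ci * RtoC (t - s))%C
    by (unfold Cminus, Cplus, Copp, Cmult, Ci, RtoC; simpl; f_equal; ring).
  rewrite Cmod_mult, Cmod_Ci, Cmod_R. lra.
Qed.

Lemma kern_lip_x (y s t : R) : Rabs (kern (t, y) - kern (s, y)) <= 2 * Rabs (t - s).
Proof.
  eapply Rle_trans; [apply kern_lip|].
  replace ((t, y) - (s, y))%C with (RtoC (t - s))
    by (unfold Cminus, Cplus, Copp, RtoC; simpl; f_equal; ring).
  rewrite Cmod_R. lra.
Qed.

Lemma kern_out_x (x y : R) : 1 <= Rabs x -> kern (x, y) = 0.
Proof.
  intros H. apply kern_out. eapply Rle_trans; [exact H|]. exact (re_le_Cmod (x, y)).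
Qed.

Lemma kern_out_y (x y : R) : 1 <= Rabs y -> kern (x, y) = 0.
Proof.
  intros H. apply kern_out. eapply Rle_trans; [exact H|]. exact (im_le_Cmod (x, y)).
Qed.

Definition kslice (x : R) : R := RInt (fun y => kern (x, y)) (- (1)) 1.

Lemma rlip_kslice : rlip 4 kslice.
Proof.
  intros s t. unfold kslice.
  assert (E : RInt (fun y => kern (t, y)) (- (1)) 1 - RInt (fun y => kern (s, y)) (- (1)) 1
    = RInt (fun y => kern (t, y) - kern (s, y)) (- (1)) 1).
  { symmetry. apply (RInt_minus (V := R_CompleteNormedModule));
      apply rlip_ex_RInt with 2; apply rlip_kern_y. }
  rewrite E.
  replace (4 * Rabs (t - s)) with ((1 - - (1)) * (2 * Rabs (t - s))) by ring.
  apply (abs_RInt_le_const (fun y => kern (t, y) - kern (s, y))); [lra| |].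
  - apply (ex_RInt_minus (V := R_NormedModule)); apply rlip_ex_RInt with 2; apply rlip_kern_y.
  - intros y _. apply kern_lip_x.
Qed.

Lemma kslice_nonneg (x : R) : 0 <= kslice x.
Proof.
  apply RInt_ge_0; [lra|apply rlip_ex_RInt with 2, rlip_kern_y|]. intros y _. apply kern_range.
Qed.

Lemma kslice_out (x : R) : 1 <= Rabs x -> kslice x = 0.
Proof. intros H. apply RInt_zero; [lra|]. intros y _. now apply kern_out_x. Qed.

Lemma kslice_value (x : R) : - (1) <= x <= 1 -> kslice x = 4 / 3 * sqrt (1 - x ^ 2) ^ 3.
Proof.
  intros Hx. set (s := sqrt (1 - x ^ 2)).
  assert (Hs0 : 0 <= s) by apply sqrt_pos.
  assert (Hs2 : s ^ 2 = 1 - x ^ 2) by (apply pow2_sqrt; nra).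
  assert (Hs1 : s <= 1) by nra.
  unfold kslice. assert (Hl := rlip_kern_y x).
  rewrite (RInt_split 2 _ (- (1)) (- s) 1), (RInt_split 2 _ (- s) s 1) by exact Hl.
  rewrite (RInt_zero _ (- (1)) (- s)), (RInt_zero _ s 1); try lra.
  - rewrite (RInt_ext _ (fun y => s ^ 2 - y ^ 2)).
    + assert (E : is_RInt (fun y => s ^ 2 - y ^ 2) (- s) s
        (minus (s ^ 2 * s - s ^ 3 / 3) (s ^ 2 * - s - (- s) ^ 3 / 3))).
      { apply (is_RInt_derive (V := R_CompleteNormedModule) (fun y => s ^ 2 * y - y ^ 3 / 3)).
        - intros y _. auto_derive; [easy|]. field.
        - intros y _. apply (ex_derive_continuous (fun y => s ^ 2 - y ^ 2)). auto_derive. easy. }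
      rewrite (is_RInt_unique _ _ _ _ E). unfold minus, plus, opp; simpl. real_eq. field.
    + intros y. rewrite Rmin_left, Rmax_right by lra. intros Hy. rewrite kern_x.
      rewrite Rmax_right; [real_eq; lra|]. nra.
  - intros y Hy. rewrite kern_x. apply Rmax_left. nra.
  - intros y Hy. rewrite kern_x. apply Rmax_left. nra.
Qed.

(** The volume under the paraboloid. The substitution x = sin t turns the slices 4/3 (1 - x^2)^(3/2)
    into 4/3 cos^4 t. *)
Lemma kern_integral : RInt kslice (- (1)) 1 = PI / 2.
Proof.
  assert (P := PI_RGT_0).
  rewrite (RInt_ext _ (fun x => 4 / 3 * sqrt (1 - x ^ 2) ^ 3)).
  2:{ intros x. rewrite Rmin_left, Rmax_right by lra. intros Hx. apply kslice_value. lra. }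
  assert (Cf : forall x, continuous (fun x => 4 / 3 * sqrt (1 - x ^ 2) ^ 3) x).
  { intros x. apply continuity_pt_filterlim.
    apply (continuity_pt_comp (fun x => sqrt (1 - x ^ 2)) (fun y => 4 / 3 * y ^ 3)).
    - apply continuity_pt_filterlim.
      apply (continuous_comp (fun x => 1 - x ^ 2) sqrt).
      + apply (ex_derive_continuous (fun x => 1 - x ^ 2)). auto_derive. easy.
      + apply continuous_sqrt.
    - reg. }
  set (f := fun x => 4 / 3 * sqrt (1 - x ^ 2) ^ 3) in *.
  replace (RInt f (- (1)) 1) with (RInt f (sin (- (PI / 2))) (sin (PI / 2)))
    by (rewrite sin_neg, sin_PI2; reflexivity).
  rewrite <- (RInt_comp (V := R_CompleteNormedModule) _ sin cos).
  - rewrite (RInt_ext _ (fun t => 4 / 3 * cos t ^ 4)).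
    + set (A := fun t => 4 / 3 * (3 / 8 * t + 3 / 8 * sin t * cos t + 1 / 4 * sin t * cos t ^ 3)).
      assert (E : is_RInt (fun t => 4 / 3 * cos t ^ 4) (- (PI / 2)) (PI / 2)
         (minus (A (PI / 2)) (A (- (PI / 2))))).
      { apply (is_RInt_derive (V := R_CompleteNormedModule) A).
        - intros t _. unfold A. auto_derive; [easy|].
          assert (H := sin2_cos2 t). unfold Rsqr in H.
          replace (sin t * (1 * (1 * - sin t))) with (- (sin t * sin t)) by ring.
          assert (E : sin t * sin t = 1 - cos t * cos t) by lra.
          transitivity (4 / 3 * (3 / 8 + 3 / 8 * (cos t * cos t - sin t * sin t)
            + 1 / 4 * (cos t ^ 4 - 3 * (sin t * sin t) * cos t ^ 2))); [|rewrite E; field].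
          field.
        - intros t _. apply (ex_derive_continuous (fun t => 4 / 3 * cos t ^ 4)). auto_derive. easy. }
      rewrite (is_RInt_unique _ _ _ _ E). unfold A, minus, plus, opp; simpl.
      rewrite sin_neg, cos_neg, sin_PI2, cos_PI2. real_eq. field.
    + intros t. rewrite Rmin_left, Rmax_right by lra. intros Ht.
      assert (H := sin2_cos2 t). unfold Rsqr in H.
      assert (Hc : 0 <= cos t) by (apply cos_ge_0; lra).
      unfold f. replace (1 - sin t ^ 2) with (cos t * cos t) by (simpl; lra).
      rewrite sqrt_square by exact Hc. unfold scal; simpl; unfold mult; simpl. real_eq. ring.
  - intros x _. apply Cf.
  - intros x _. split.
    + apply is_derive_Reals, derivable_pt_lim_sin.
    + apply continuity_pt_filterlim, continuity_cos.
Qed.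

Definition ksum (x y h1 h2 : R) (A B : nat) : R :=
  rsum (fun i => rsum (fun j => kern (x + h1 * INR i, y + h2 * INR j)) B) A.

(** With [rho := 2] the integral over [-2, 2] is at most 4 and the Riemann error at most 8 h <=
    8. *)
Lemma cutoff_sum (x h : R) (A : nat) : 0 <= h <= 1 ->
  h * rsum (fun i => cutoff 1 (x + h * INR i)) A <= 12.
Proof.
  intros Hh. eapply Rle_trans.
  - apply (supported_sum_upper 1 _ 2); [lra|lra|exact Hh|apply rlip_cutoff| |].
    + intros t. apply cutoff_range.
    + intros t Ht. apply cutoff_out. lra.
  - assert (H := RInt_le_const_lip 1 (cutoff 1) (- (2)) 2 1 ltac:(lra) (rlip_cutoff 1)
      (fun t _ => proj2 (cutoff_range 1 t))). lra.
Qed.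

(** The sum over j approximates [kslice] with error 12 h2, charged by [cutoff] only to the rows near
    the unit disk, so that it adds up to at most 144 h2. The sum of [kslice] costs 24 h1. The
    constant 200 covers both. *)
Lemma ksum_upper (x y h1 h2 : R) (A B : nat) :
  0 <= h1 <= 1 -> 0 <= h2 <= 1 ->
  h1 * h2 * ksum x y h1 h2 A B <= PI / 2 + 200 * (h1 + h2).
Proof.
  intros H1 H2.
  assert (Hin : forall i, h2 * rsum (fun j => kern (x + h1 * INR i, y + h2 * INR j)) B
     <= kslice (x + h1 * INR i) + 12 * h2 * cutoff 1 (x + h1 * INR i)).
  { intros i. set (u := x + h1 * INR i).
    destruct (Rle_dec (Rabs u) 1) as [Hu|Hu].
    - rewrite cutoff_in by exact Hu.
      assert (H := supported_sum_upper 2 (fun t => kern (u, t)) 1 y h2 B ltac:(lra) ltac:(lra) H2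
        (rlip_kern_y u) (fun t => proj1 (kern_range (u, t))) (kern_out_y u)).
      unfold kslice. lra.
    - rewrite (rsum_ext _ (fun _ => 0)).
      + rewrite rsum_const. assert (P := kslice_nonneg u). assert (P' := cutoff_range 1 u).
        assert (0 <= 12 * h2 * cutoff 1 u) by (apply Rmult_le_pos; lra). lra.
      + intros j _. apply kern_out_x. lra. }
  unfold ksum. rewrite Rmult_assoc, <- rsum_scal.
  eapply Rle_trans.
  - apply Rmult_le_compat_l; [lra|]. apply rsum_le. intros i _. apply Hin.
  - rewrite rsum_plus, rsum_scal, Rmult_plus_distr_l.
    assert (Q1 := supported_sum_upper 4 kslice 1 x h1 A ltac:(lra) ltac:(lra) H1 rlip_kslice
      kslice_nonneg kslice_out).
    rewrite kern_integral in Q1. assert (Q2 := cutoff_sum x h1 A H1).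
    assert (h1 * (12 * h2 * rsum (fun i => cutoff 1 (x + h1 * INR i)) A) <= 12 * h2 * 12).
    { replace (h1 * (12 * h2 * rsum (fun i => cutoff 1 (x + h1 * INR i)) A)) with
        (12 * h2 * (h1 * rsum (fun i => cutoff 1 (x + h1 * INR i)) A)) by ring.
      apply Rmult_le_compat_l; lra. }
    lra.
Qed.

Lemma ksum_lower (x y h1 h2 : R) (A B : nat) :
  0 <= h1 <= 1 -> 0 <= h2 <= 1 ->
  x <= - (1) -> 1 <= x + h1 * INR A -> y <= - (1) -> 1 <= y + h2 * INR B ->
  PI / 2 - 200 * (h1 + h2) <= h1 * h2 * ksum x y h1 h2 A B.
Proof.
  intros H1 H2 X1 X2 Y1 Y2.
  assert (Hin : forall i, kslice (x + h1 * INR i) + - (12 * h2) * cutoff 1 (x + h1 * INR i)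
     <= h2 * rsum (fun j => kern (x + h1 * INR i, y + h2 * INR j)) B).
  { intros i. set (u := x + h1 * INR i).
    destruct (Rle_dec (Rabs u) 1) as [Hu|Hu].
    - rewrite cutoff_in by exact Hu.
      assert (H := supported_sum_lower 2 (fun t => kern (u, t)) 1 y h2 B ltac:(lra) ltac:(lra) H2
        (rlip_kern_y u) (fun t => proj1 (kern_range (u, t))) (kern_out_y u) Y1 Y2).
      unfold kslice. lra.
    - rewrite kslice_out by lra.
      assert (P' := cutoff_range 1 u).
      assert (0 <= 12 * h2 * cutoff 1 u) by (apply Rmult_le_pos; lra).
      assert (0 <= h2 * rsum (fun j => kern (u, y + h2 * INR j)) B); [|lra].
      apply Rmult_le_pos; [lra|]. apply rsum_nonneg. intros j _. apply kern_range. }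
  unfold ksum. rewrite Rmult_assoc, <- rsum_scal.
  eapply Rle_trans.
  2:{ apply Rmult_le_compat_l; [lra|]. apply rsum_le. intros i _. apply Hin. }
  rewrite rsum_plus, rsum_scal, Rmult_plus_distr_l.
  assert (Q1 := supported_sum_lower 4 kslice 1 x h1 A ltac:(lra) ltac:(lra) H1 rlip_kslice
    kslice_nonneg kslice_out X1 X2).
  rewrite kern_integral in Q1. assert (Q2 := cutoff_sum x h1 A H1).
  assert (h1 * (- (12 * h2) * rsum (fun i => cutoff 1 (x + h1 * INR i)) A) >= - (12 * h2 * 12)).
  { replace (h1 * (- (12 * h2) * rsum (fun i => cutoff 1 (x + h1 * INR i)) A)) with
      (- (12 * h2 * (h1 * rsum (fun i => cutoff 1 (x + h1 * INR i)) A))) by ring.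
    apply Rle_ge, Ropp_le_contravar. apply Rmult_le_compat_l; lra. }
  lra.
Qed.

(** * An area inequality for injective maps *)

Definition box (a b a' b' : R) (z : C) : Prop := a <= Re z <= b /\ a' <= Im z <= b'.

(** Compactness as a principle: a property that weakens as its margin [e] shrinks, and that holds
    near each point with some positive margin, holds on the whole rectangle with a common one. *)
Lemma box_compact (a b a' b' : R) (P : R -> C -> Prop) :
  (forall e d z, d <= e -> P e z -> P d z) ->
  (forall z, box a b a' b' z ->
     exists e, 0 < e /\ forall w, box a b a' b' w -> Cmod (w - z) < e -> P e w) ->
  exists e, 0 < e /\ forall w, box a b a' b' w -> P e w.
Proof.
  intros Hmono Hloc.
  assert (Hd : forall u v, exists d : posreal, box a b a' b' (u, v) ->
    forall w, box a b a' b' w -> Cmod (w - (u, v)) < 2 * d -> P (2 * d) w).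
  { intros u v. destruct (classic (box a b a' b' (u, v))) as [Hb|Hb].
    - destruct (Hloc _ Hb) as [e [He H]].
      (* Half of the margin, because the covering controls each coordinate by delta and hence the
         modulus by 2 delta. *)
      assert (He2 : 0 < e / 2) by lra. exists (mkposreal _ He2). simpl.
      replace (2 * (e / 2)) with e by field. auto.
    - exists (mkposreal 1 Rlt_0_1). intros H. contradiction. }
  set (delta := fun u v => epsilon (inhabits (mkposreal 1 Rlt_0_1)) (fun d : posreal =>
    box a b a' b' (u, v) ->
    forall w, box a b a' b' w -> Cmod (w - (u, v)) < 2 * d -> P (2 * d) w)).
  destruct (compactness_value_2d a b a' b' delta) as [d H].
  exists d. split; [apply cond_pos|]. intros w Hw.
  apply NNPP. intros Hn. destruct Hw as [Hw1 Hw2].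
  apply (H (Re w) (Im w) Hw1 Hw2). intros (u & v & Hu & Hv & H1 & H2 & H3). apply Hn.
  assert (Hs := epsilon_spec (inhabits (mkposreal 1 Rlt_0_1)) _ (Hd u v)
    (conj Hu Hv) w (conj Hw1 Hw2)).
  fold (delta u v) in Hs. apply (Hmono (2 * delta u v)).
  - assert (Q := cond_pos (delta u v)). lra.
  - apply Hs. eapply Rle_lt_trans; [apply Cmod_le_sum|].
    unfold Re, Im, Cminus, Cplus, Copp in *; simpl in *.
    unfold Rminus in *. lra.
Qed.

Lemma box_bounded (a b a' b' : R) : bounded_on (box a b a' b') (fun z => z).
Proof.
  exists (Rabs a + Rabs b + Rabs a' + Rabs b').
  assert (H1 := Rabs_pos a). assert (H2 := Rabs_pos b).
  assert (H3 := Rabs_pos a'). assert (H4 := Rabs_pos b'). split; [lra|].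
  intros z [Hx Hy]. eapply Rle_trans; [apply Cmod_le_sum|].
  unfold Rabs in *; repeat destruct Rcase_abs; lra.
Qed.

(** |G q - G p| is positive on the compact set of pairs at distance at least d, hence bounded below
    there. [box_compact] is applied to p and, inside, to q. *)
Lemma injective_separation (a b a' b' d : R) (G : C -> C) :
  0 < d -> lip_on (box a b a' b') G ->
  (forall p q, box a b a' b' p -> box a b a' b' q -> G p = G q -> p = q) ->
  exists e, 0 < e /\ forall p q, box a b a' b' p -> box a b a' b' q ->
    d <= Cmod (q - p) -> e <= Cmod (G q - G p).
Proof.
  intros Hd [L [HL HG]] Hinj.
  destruct (box_compact a b a' b' (fun e p => forall q, box a b a' b' q ->
    d <= Cmod (q - p) -> e <= Cmod (G q - G p))) as [e [He H]].
  - intros e e' z Hee H q Hq Hqz. assert (H1 := H q Hq Hqz). lra.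
  - intros p0 Hp0.
    destruct (box_compact a b a' b' (fun e q => forall p, box a b a' b' p ->
      Cmod (p - p0) < e -> d <= Cmod (q - p) -> e <= Cmod (G q - G p))) as [e [He H]].
    + intros e e' z Hee H p Hp Hpp Hzp. assert (H1 := H p Hp ltac:(lra) Hzp). lra.
    + intros q0 Hq0. destruct (Rlt_dec (Cmod (q0 - p0)) d) as [Hlt|Hge].
      * exists ((d - Cmod (q0 - p0)) / 2). split; [lra|].
        intros q Hq Hqq p Hp Hpp Hqp. exfalso.
        assert (H1 := Cmod_triangle (q - q0) (q0 - p)).
        assert (H2 := Cmod_triangle (q0 - p0) (p0 - p)).
        replace (q - q0 + (q0 - p))%C with (q - p)%C in H1 by ring.
        replace (q0 - p0 + (p0 - p))%C with (q0 - p)%C in H2 by ring.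
        rewrite (Cmod_minus_sym p0 p) in H2. lra.
      * assert (Hm : 0 < Cmod (G q0 - G p0)).
        { apply Cmod_gt_0. intros E. assert (E1 : q0 = p0).
          { apply Hinj; auto. replace (G q0) with (G q0 - G p0 + G p0)%C by ring. rewrite E. ring. }
          subst. replace (p0 - p0)%C with (RtoC 0) in Hge by ring. rewrite Cmod_0 in Hge. lra. }
        set (m := Cmod (G q0 - G p0)) in *.
        (* Moving both points by less than this e lowers the distance of the images by at most 2 L e
           = m - e. *)
        exists (m / (2 * L + 1)). split; [apply Rdiv_lt_0_compat; lra|].
        intros q Hq Hqq p Hp Hpp Hqp.
        set (e := m / (2 * L + 1)) in *.
        assert (Ee : e * (2 * L + 1) = m) by (unfold e; field; lra).
        assert (H1 := HG q0 q Hq0 Hq). assert (H2 := HG p p0 Hp Hp0).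
        rewrite (Cmod_minus_sym p0 p) in H2.
        assert (H3 := Cmod_triangle (G q0 - G q) (G q - G p0)).
        assert (H4 := Cmod_triangle (G q - G p) (G p - G p0)).
        replace (G q0 - G q + (G q - G p0))%C with (G q0 - G p0)%C in H3 by ring.
        replace (G q - G p + (G p - G p0))%C with (G q - G p0)%C in H4 by ring.
        rewrite (Cmod_minus_sym (G q0) (G q)) in H3. rewrite (Cmod_minus_sym (G p) (G p0)) in H4.
        fold m in H3. nra.
    + exists e. split; [exact He|]. intros p Hp Hpp q Hq Hqp. now apply H.
  - exists e. split; [exact He|]. intros p q Hp Hq. now apply H.
Qed.

(** For distant pairs this is [injective_separation], divided by the diameter; for close pairs the
    linear term [G' p * (q - p)] dominates the quadratic error. Only the base point p has to satisfy
    |G' p| >= eta. *)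
Lemma noncritical_separation (a b a' b' eta : R) (G G' : C -> C) :
  0 < eta -> udiff (box a b a' b') G G' ->
  (forall p q, box a b a' b' p -> box a b a' b' q -> G p = G q -> p = q) ->
  exists c, 0 < c /\ forall p q, box a b a' b' p -> box a b a' b' q ->
    eta <= Cmod (G' p) -> c * Cmod (q - p) <= Cmod (G q - G p).
Proof.
  intros Heta HG Hinj. assert (HL := udiff_lip _ _ _ (box_bounded a b a' b') HG).
  destruct HG as [B [HB HG]].
  (* Below this distance the quadratic error is at most half of the linear term. *)
  set (d := eta / (2 * (B + 1))).
  assert (Hd : 0 < d) by (apply Rdiv_lt_0_compat; lra).
  assert (Ed : d * (2 * (B + 1)) = eta) by (unfold d; field; lra).
  destruct (injective_separation a b a' b' d G Hd HL Hinj) as [e [He Hsep]].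
  destruct (box_bounded a b a' b') as [D [HD HbD]].
  exists (Rmin (eta / 2) (e / (2 * D + 1))).
  assert (Hc2 : 0 < e / (2 * D + 1)) by (apply Rdiv_lt_0_compat; lra).
  split; [apply Rmin_glb_lt; lra|].
  intros p q Hp Hq Hge. assert (P := Cmod_ge_0 (q - p)).
  destruct (Rle_dec d (Cmod (q - p))) as [Hfar|Hnear].
  - apply Rle_trans with e; [|now apply Hsep].
    apply Rle_trans with (e / (2 * D + 1) * Cmod (q - p)).
    + apply Rmult_le_compat_r; [exact P|apply Rmin_r].
    + apply Rle_trans with (e / (2 * D + 1) * (2 * D + 1)); [|right; field; lra].
      apply Rmult_le_compat_l; [lra|].
      assert (H1 := Cmod_triangle_minus q p). assert (H2 := HbD p Hp). assert (H3 := HbD q Hq). lra.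
  - apply Rle_trans with (eta / 2 * Cmod (q - p)).
    + apply Rmult_le_compat_r; [exact P|apply Rmin_l].
    + assert (H1 := HG p q Hp Hq).
      assert (H2 := Cmod_triangle_rev (G' p * (q - p)) (G' p * (q - p) - (G q - G p))).
      replace (G' p * (q - p) - (G' p * (q - p) - (G q - G p)))%C with (G q - G p)%C in H2 by ring.
      rewrite (Cmod_minus_sym (G' p * (q - p))) in H2.
      replace (G q - G p - G' p * (q - p))%C with (G q - G p - G' p * (q - p))%C in H2 by ring.
      rewrite Cmod_mult in H2.
      assert (H3 : eta * Cmod (q - p) <= Cmod (G' p) * Cmod (q - p))
        by (apply Rmult_le_compat_r; assumption).
      assert (H4 : B * Cmod (q - p) <= eta / 2) by nra.
      assert (H5 : B * Cmod (q - p) ^ 2 <= eta / 2 * Cmod (q - p)).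
      { replace (B * Cmod (q - p) ^ 2) with (B * Cmod (q - p) * Cmod (q - p)) by ring.
        apply Rmult_le_compat_r; assumption. }
      lra.
Qed.

(** * Weighted sums over rectangular lattices *)

Definition grid_pt (s t h1 h2 : R) (i j : nat) : C := (s + h1 * INR i, t + h2 * INR j).

Definition grid_sum (s t h1 h2 : R) (A B : nat) (f : C -> R) : R :=
  h1 * h2 * rsum (fun i => rsum (fun j => f (grid_pt s t h1 h2 i j)) B) A.

Lemma grid_sum_le (s t h1 h2 : R) (A B : nat) (f g : C -> R) :
  0 <= h1 -> 0 <= h2 ->
  (forall i j, (i < A)%nat -> (j < B)%nat -> f (grid_pt s t h1 h2 i j) <= g (grid_pt s t h1 h2 i j)) ->
  grid_sum s t h1 h2 A B f <= grid_sum s t h1 h2 A B g.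
Proof.
  intros H1 H2 H. unfold grid_sum. apply Rmult_le_compat_l; [nra|].
  apply rsum_le. intros i Hi. apply rsum_le. intros j Hj. now apply H.
Qed.

Lemma grid_sum_ext (s t h1 h2 : R) (A B : nat) (f g : C -> R) :
  (forall i j, f (grid_pt s t h1 h2 i j) = g (grid_pt s t h1 h2 i j)) ->
  grid_sum s t h1 h2 A B f = grid_sum s t h1 h2 A B g.
Proof.
  intros H. unfold grid_sum. f_equal. apply rsum_ext. intros i _. apply rsum_ext. intros j _. apply H.
Qed.

Lemma grid_sum_plus (s t h1 h2 : R) (A B : nat) (f g : C -> R) :
  grid_sum s t h1 h2 A B (fun z => f z + g z) = grid_sum s t h1 h2 A B f + grid_sum s t h1 h2 A B g.
Proof.
  unfold grid_sum. rewrite <- Rmult_plus_distr_l, <- rsum_plus. f_equal.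
  apply rsum_ext. intros i _. apply rsum_plus.
Qed.

Lemma grid_sum_scal (s t h1 h2 x : R) (A B : nat) (f : C -> R) :
  grid_sum s t h1 h2 A B (fun z => x * f z) = x * grid_sum s t h1 h2 A B f.
Proof.
  unfold grid_sum.
  rewrite (rsum_ext _ (fun i => x * rsum (fun j => f (grid_pt s t h1 h2 i j)) B)), rsum_scal.
  - ring.
  - intros i _. apply rsum_scal.
Qed.

Lemma grid_sum_const (s t h1 h2 x : R) (A B : nat) :
  grid_sum s t h1 h2 A B (fun _ => x) = (h1 * INR A) * (h2 * INR B) * x.
Proof.
  unfold grid_sum. rewrite (rsum_ext _ (fun _ => INR B * x)), rsum_const; [ring|].
  intros i _. apply rsum_const.
Qed.

Lemma grid_sum_nonneg (s t h1 h2 : R) (A B : nat) (f : C -> R) :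
  0 <= h1 -> 0 <= h2 ->
  (forall i j, (i < A)%nat -> (j < B)%nat -> 0 <= f (grid_pt s t h1 h2 i j)) ->
  0 <= grid_sum s t h1 h2 A B f.
Proof.
  intros H1 H2 H. unfold grid_sum. apply Rmult_le_pos; [nra|].
  apply rsum_nonneg. intros i Hi. apply rsum_nonneg. intros j Hj. now apply H.
Qed.

Lemma grid_sum_rsum (s t h1 h2 : R) (A B N : nat) (f : nat -> C -> R) :
  grid_sum s t h1 h2 A B (fun z => rsum (fun n => f n z) N)
  = rsum (fun n => grid_sum s t h1 h2 A B (f n)) N.
Proof.
  induction N as [|N IH]; simpl.
  - rewrite grid_sum_const. ring.
  - rewrite grid_sum_plus, IH. reflexivity.
Qed.

(** The discrete Fubini theorem that brings the target lattice outside in [area_inequality]. *)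
Lemma grid_sum_swap (s t h1 h2 s' t' h1' h2' : R) (A B A' B' : nat) (f : C -> C -> R) :
  grid_sum s t h1 h2 A B (fun z => grid_sum s' t' h1' h2' A' B' (f z))
  = grid_sum s' t' h1' h2' A' B' (fun w => grid_sum s t h1 h2 A B (fun z => f z w)).
Proof.
  unfold grid_sum at 2. rewrite grid_sum_scal, grid_sum_rsum.
  unfold grid_sum at 2. f_equal. apply rsum_ext. intros i _.
  now rewrite grid_sum_rsum.
Qed.

Lemma grid_sum_kern_eq (s t h1 h2 l : R) (A B : nat) (z : C) : 0 < l ->
  grid_sum s t h1 h2 A B (fun p => kern (RtoC l * (p - z)))
  = / l ^ 2 * ((l * h1) * (l * h2) *
      ksum (l * (s - Re z)) (l * (t - Im z)) (l * h1) (l * h2) A B).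
Proof.
  intros Hl. unfold grid_sum, ksum.
  rewrite (rsum_ext _ (fun i => rsum (fun j => kern (l * (s - Re z) + l * h1 * INR i,
    l * (t - Im z) + l * h2 * INR j)) B)).
  - field. lra.
  - intros i _. apply rsum_ext. intros j _. f_equal. unfold grid_pt, Re, Im.
    unfold Cmult, Cminus, Cplus, Copp, RtoC; simpl. f_equal; ring.
Qed.

Lemma grid_sum_kern_upper (s t h1 h2 l : R) (A B : nat) (z : C) :
  0 < l -> 0 <= h1 -> 0 <= h2 -> l * h1 <= 1 -> l * h2 <= 1 ->
  grid_sum s t h1 h2 A B (fun p => kern (RtoC l * (p - z)))
  <= / l ^ 2 * (PI / 2 + 200 * (l * (h1 + h2))).
Proof.
  intros Hl H1 H2 L1 L2. rewrite grid_sum_kern_eq by exact Hl.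
  apply Rmult_le_compat_l; [left; apply Rinv_0_lt_compat, pow_lt, Hl|].
  rewrite Rmult_plus_distr_l. apply ksum_upper; split; try assumption; nra.
Qed.

Lemma grid_sum_kern_lower (s t h1 h2 l : R) (A B : nat) (z : C) :
  0 < l -> 0 <= h1 -> 0 <= h2 -> l * h1 <= 1 -> l * h2 <= 1 ->
  1 <= l * (Re z - s) -> 1 <= l * (s + h1 * INR A - Re z) ->
  1 <= l * (Im z - t) -> 1 <= l * (t + h2 * INR B - Im z) ->
  / l ^ 2 * (PI / 2 - 200 * (l * (h1 + h2)))
  <= grid_sum s t h1 h2 A B (fun p => kern (RtoC l * (p - z))).
Proof.
  intros Hl H1 H2 L1 L2 X1 X2 Y1 Y2. rewrite grid_sum_kern_eq by exact Hl.
  apply Rmult_le_compat_l; [left; apply Rinv_0_lt_compat, pow_lt, Hl|].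
  rewrite (Rmult_plus_distr_l l). apply ksum_lower; try split; try assumption; nra.
Qed.

(* All grid points that [G] sends near [w] lie near a single point [p1], where [G]
   is nearly affine with slope [a], and the kernel of an affine map can be summed. *)
Lemma local_count (s0 s1 T eta : R) (G G' : C -> C) :
  0 < eta -> udiff (box s0 s1 0 T) G G' ->
  (forall p q, box s0 s1 0 T p -> box s0 s1 0 T q -> G p = G q -> p = q) ->
  exists C0 kappa, 0 <= C0 /\ 0 < kappa /\
  forall (sigma h1 h2 : R) (A B : nat) (w : C),
    0 < sigma <= 1 -> 0 <= h1 <= kappa * sigma -> 0 <= h2 <= kappa * sigma ->
    (forall i j, (i < A)%nat -> (j < B)%nat -> box s0 s1 0 T (grid_pt s0 0 h1 h2 i j)) ->
    grid_sum s0 0 h1 h2 A B (fun p => kern (RtoC (/ sigma) * (G p - w)) *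
        Rmax 0 (Cmod (G' p) ^ 2 - eta ^ 2))
    <= sigma ^ 2 * (PI / 2 + C0 * (h1 + h2) / sigma + C0 * sigma).
Proof.
  intros Heta HG Hinj.
  destruct (noncritical_separation s0 s1 0 T eta G G' Heta HG Hinj) as [c [Hc Hsep]].
  destruct (udiff_bounded_deriv _ _ _ (box_bounded s0 s1 0 T) HG) as [K [HK HKb]].
  destruct (udiff_lip_deriv _ _ _ HG) as [L [HL HLb]].
  destruct HG as [E [HE HG]].
  (* Two points whose images lie within sigma of [w] have images within 2 sigma of each other, so
     the points are within rho sigma once one of them satisfies |G'| >= eta. *)
  set (rho := 2 / c). assert (Hrho : 0 < rho) by (apply Rdiv_lt_0_compat; lra).
  (* [e1] sigma is the error of the kernel when G is replaced by its affine part (2 is the Lipschitz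
     constant of [kern]), [e2] sigma the variation of |G'|^2 over the cluster. *)
  set (e1 := 2 * E * rho ^ 2). set (e2 := 2 * K * L * rho).
  assert (He1 : 0 <= e1) by (unfold e1; assert (0 <= rho ^ 2) by apply pow2_ge_0; nra).
  assert (He2 : 0 <= e2) by (unfold e2; assert (0 <= K * L) by nra; nra).
  set (C3 := e1 * K ^ 2 + e2 + e1 * e2).
  assert (HK2 : 0 <= K ^ 2) by apply pow2_ge_0.
  assert (HC3 : 0 <= C3) by (unfold C3; assert (0 <= e1 * K ^ 2) by nra; nra).
  assert (HP : 0 < PI / 2 <= 2) by (assert (P1 := PI_RGT_0); assert (P2 := PI_4); lra).
  (* 402 bounds PI / 2 + 200 (1 + 1), the normalized sum of a kernel whose radius is at least both
     mesh widths. *)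
  exists (200 * (K + 1) + 4 / 3 * C3 * (2 * rho) ^ 2 * 402).
  (* This makes the mesh no wider than the two kernels used below, of radii sigma / |a| and 2 rho
     sigma. *)
  exists (Rmin (/ (K + 1)) (2 * rho)).
  assert (Hr2 : 0 <= (2 * rho) ^ 2) by apply pow2_ge_0.
  assert (HC4 : 0 <= 4 / 3 * C3 * (2 * rho) ^ 2 * 402) by (assert (0 <= 4 / 3 * C3) by lra; nra).
  split; [lra|]. split.
  { apply Rmin_glb_lt; [apply Rinv_0_lt_compat; lra|lra]. }
  intros sigma h1 h2 A B w Hs Hh1 Hh2 Hgrid.
  set (C0 := 200 * (K + 1) + 4 / 3 * C3 * (2 * rho) ^ 2 * 402) in *.
  assert (HC0 : 0 <= C0) by (unfold C0; lra).
  assert (His : 0 < / sigma) by (apply Rinv_0_lt_compat; lra).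
  (* A point with psi p <> 0 has |G' p| >= eta and can serve as base point in
     [noncritical_separation]. *)
  set (psi := fun p => Rmax 0 (Cmod (G' p) ^ 2 - eta ^ 2)).
  set (f := fun p => kern (RtoC (/ sigma) * (G p - w)) * psi p).
  change (grid_sum s0 0 h1 h2 A B f <= sigma ^ 2 * (PI / 2 + C0 * (h1 + h2) / sigma + C0 * sigma)).
  assert (Hpsi0 : forall p, 0 <= psi p) by (intros p; apply Rmax_l).
  assert (Hs2 : 0 < sigma ^ 2) by (apply pow_lt; lra).
  assert (Hq0 : 0 <= C0 * (h1 + h2) / sigma).
  { apply Rmult_le_pos; [|lra]. apply Rmult_le_pos; lra. }
  destruct (classic (exists i j, (i < A)%nat /\ (j < B)%nat /\ f (grid_pt s0 0 h1 h2 i j) <> 0))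
    as [(i1 & j1 & Hi1 & Hj1 & Hne)|Hall].
  2:{ apply Rle_trans with (grid_sum s0 0 h1 h2 A B (fun _ => 0)).
      - apply grid_sum_le; try lra. intros i j Hi Hj. right. apply NNPP. intros H. apply Hall.
        now exists i, j.
      - rewrite grid_sum_const, Rmult_0_r. apply Rmult_le_pos; [lra|].
        assert (0 <= C0 * sigma) by nra. lra. }
  set (p1 := grid_pt s0 0 h1 h2 i1 j1) in *.
  assert (Hp1 : box s0 s1 0 T p1) by (now apply Hgrid).
  assert (Hnear : forall p, kern (RtoC (/ sigma) * (G p - w)) <> 0 -> Cmod (G p - w) < sigma).
  { intros p Hp. apply Rnot_le_lt. intros Hle. apply Hp. apply kern_out.
    rewrite Cmod_mult, Cmod_R, Rabs_pos_eq by lra.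
    apply (Rmult_le_reg_l sigma); [lra|]. rewrite <- Rmult_assoc, Rinv_r by lra. lra. }
  assert (N1 : Cmod (G p1 - w) < sigma).
  { apply Hnear. intros H. apply Hne. unfold f. rewrite H. ring. }
  assert (Ha : eta <= Cmod (G' p1)).
  { apply Rnot_lt_le. intros Hlt. apply Hne. unfold f, psi.
    rewrite (Rmax_left 0); [ring|]. assert (P := Cmod_ge_0 (G' p1)). nra. }
  set (a := G' p1) in *.
  assert (Na : a <> RtoC 0) by (apply Cmod_gt_0; lra).
  assert (HaK : Cmod a <= K) by (now apply HKb).
  (* The point that the affine approximation of [G] at [p1] sends to [w]. *)
  set (ps := (p1 - (G p1 - w) / a)%C).
  (* The second kernel confines the error to the cluster: it is at least 3/4 on the disk of radius
     rho sigma about [p1], whence the factor 4/3, and its lattice sum is of order sigma^2. *)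
  assert (Hpt : forall i j, (i < A)%nat -> (j < B)%nat ->
    f (grid_pt s0 0 h1 h2 i j) <=
      Cmod a ^ 2 * kern (RtoC (Cmod a * / sigma) * (grid_pt s0 0 h1 h2 i j - ps))
      + 4 / 3 * C3 * sigma * kern (RtoC (/ (2 * rho * sigma)) * (grid_pt s0 0 h1 h2 i j - p1))).
  { intros i j Hi Hj. set (p := grid_pt s0 0 h1 h2 i j).
    assert (Hp : box s0 s1 0 T p) by (now apply Hgrid).
    set (k1 := kern (RtoC (Cmod a * / sigma) * (p - ps))).
    set (k2 := kern (RtoC (/ (2 * rho * sigma)) * (p - p1))).
    assert (Hk1 := kern_range (RtoC (Cmod a * / sigma) * (p - ps))). fold k1 in Hk1.
    assert (Hk2 := kern_range (RtoC (/ (2 * rho * sigma)) * (p - p1))). fold k2 in Hk2.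
    assert (Ha2 : 0 <= Cmod a ^ 2) by apply pow2_ge_0.
    assert (Hc3 : 0 <= 4 / 3 * C3 * sigma) by nra.
    unfold f. destruct (Req_dec (kern (RtoC (/ sigma) * (G p - w))) 0) as [H0|H0].
    { rewrite H0. assert (0 <= Cmod a ^ 2 * k1) by nra.
      assert (0 <= 4 / 3 * C3 * sigma * k2) by nra. lra. }
    assert (Hd : Cmod (p - p1) <= rho * sigma).
    { assert (H1 := Hsep p1 p Hp1 Hp Ha). assert (H2 := Hnear p H0).
      assert (H3 := Cmod_triangle_minus (G p - w) (G p1 - w)).
      replace (G p - w - (G p1 - w))%C with (G p - G p1)%C in H3 by ring.
      apply (Rmult_le_reg_l c); [exact Hc|].
      replace (c * (rho * sigma)) with (2 * sigma) by (unfold rho; field; lra). lra. }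
    assert (Pd := Cmod_ge_0 (p - p1)).
    assert (Hk34 : 3 / 4 <= k2).
    { unfold k2, kern. eapply Rle_trans; [|apply Rmax_r].
      rewrite Cmod_mult, Cmod_R, Rabs_pos_eq
        by (left; apply Rinv_0_lt_compat; apply Rmult_lt_0_compat; lra).
      assert (Hq : / (2 * rho * sigma) * Cmod (p - p1) <= 1 / 2).
      { apply (Rmult_le_reg_l (2 * rho * sigma)); [apply Rmult_lt_0_compat; lra|].
        rewrite <- Rmult_assoc, Rinv_r by (apply Rgt_not_eq, Rmult_lt_0_compat; lra). lra. }
      assert (Hq0' : 0 <= / (2 * rho * sigma) * Cmod (p - p1)).
      { apply Rmult_le_pos; [left; apply Rinv_0_lt_compat; apply Rmult_lt_0_compat; lra|exact Pd]. }
      nra. }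
    assert (Hkk : kern (RtoC (/ sigma) * (G p - w)) <= k1 + e1 * sigma).
    { assert (Ek : k1 = kern (RtoC (/ sigma) * (a * (p - ps)))).
      { unfold k1. replace (RtoC (/ sigma) * (a * (p - ps)))%C with (RtoC (/ sigma) * a * (p - ps))%C by ring.
        unfold kern. rewrite !Cmod_mult, !Cmod_R, Rabs_mult, (Rabs_pos_eq (Cmod a)) by apply Cmod_ge_0.
        do 3 f_equal. ring. }
      rewrite Ek. assert (H1 := kern_lip (RtoC (/ sigma) * (G p - w)) (RtoC (/ sigma) * (a * (p - ps)))).
      replace (RtoC (/ sigma) * (G p - w) - RtoC (/ sigma) * (a * (p - ps)))%C with
        (RtoC (/ sigma) * (G p - G p1 - a * (p - p1)))%C in H1
        by (unfold ps; generalize (RtoC (/ sigma)); intros; field; exact Na).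
      rewrite Cmod_mult, Cmod_R, (Rabs_pos_eq (/ sigma)) in H1 by lra.
      assert (H2 := HG p1 p Hp1 Hp). fold a in H2.
      assert (H3 : Cmod (p - p1) ^ 2 <= (rho * sigma) ^ 2) by (apply pow_incr; lra).
      assert (H4 : / sigma * Cmod (G p - G p1 - a * (p - p1)) <= E * rho ^ 2 * sigma).
      { apply (Rmult_le_reg_l sigma); [lra|]. rewrite <- Rmult_assoc, Rinv_r, Rmult_1_l by lra.
        replace (sigma * (E * rho ^ 2 * sigma)) with (E * (rho * sigma) ^ 2) by ring.
        eapply Rle_trans; [exact H2|]. now apply Rmult_le_compat_l. }
      assert (H5 := Rle_abs (kern (RtoC (/ sigma) * (G p - w)) - kern (RtoC (/ sigma) * (a * (p - ps))))).
      unfold e1. lra. }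
    assert (Hpsi : psi p <= Cmod a ^ 2 + e2 * sigma).
    { unfold psi. assert (Q1 : Cmod (G' p) <= K) by (now apply HKb).
      assert (Q2 := HLb p1 p Hp1 Hp). fold a in Q2.
      assert (Q3 := Cmod_triangle_rev (G' p) a). assert (Q4 := Cmod_ge_0 (G' p)).
      assert (Q5 := Cmod_ge_0 a).
      assert (Q6 : Cmod (G' p) - Cmod a <= L * (rho * sigma)).
      { assert (L * Cmod (p - p1) <= L * (rho * sigma)) by (now apply Rmult_le_compat_l). lra. }
      assert (Q7 : 0 <= L * (rho * sigma)) by (apply Rmult_le_pos; [exact HL|nra]).
      assert (Q8 : (Cmod (G' p) - Cmod a) * (Cmod (G' p) + Cmod a) <= L * (rho * sigma) * (2 * K)).
      { apply Rle_trans with (L * (rho * sigma) * (Cmod (G' p) + Cmod a)).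
        - apply Rmult_le_compat_r; lra.
        - apply Rmult_le_compat_l; lra. }
      apply Rmax_lub; [unfold e2; nra|]. unfold e2.
      assert (0 <= eta ^ 2) by apply pow2_ge_0. nra. }
    assert (Hprod : kern (RtoC (/ sigma) * (G p - w)) * psi p
      <= (k1 + e1 * sigma) * (Cmod a ^ 2 + e2 * sigma)).
    { apply Rmult_le_compat; auto. apply kern_range. }
    eapply Rle_trans; [exact Hprod|].
    assert (Hfin : (k1 + e1 * sigma) * (Cmod a ^ 2 + e2 * sigma)
       <= Cmod a ^ 2 * k1 + C3 * sigma).
    { assert (Z1 : Cmod a ^ 2 <= K ^ 2) by (apply pow_incr; split; [apply Cmod_ge_0|exact HaK]).
      assert (Z2 : k1 * (e2 * sigma) <= 1 * (e2 * sigma)) by (apply Rmult_le_compat_r; nra).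
      assert (Z3 : e1 * sigma * Cmod a ^ 2 <= e1 * sigma * K ^ 2) by (apply Rmult_le_compat_l; nra).
      assert (Z4 : e1 * sigma * (e2 * sigma) <= e1 * e2 * sigma).
      { replace (e1 * sigma * (e2 * sigma)) with (e1 * e2 * sigma * sigma) by ring.
        rewrite <- (Rmult_1_r (e1 * e2 * sigma)) at 2. apply Rmult_le_compat_l; [|lra].
        apply Rmult_le_pos; [nra|lra]. }
      unfold C3. lra. }
    assert (C3 * sigma <= 4 / 3 * C3 * sigma * k2).
    { replace (4 / 3 * C3 * sigma * k2) with (C3 * sigma * (4 / 3 * k2)) by ring.
      rewrite <- (Rmult_1_r (C3 * sigma)) at 1. apply Rmult_le_compat_l; [nra|lra]. }
    lra. }
  apply Rle_trans with (grid_sum s0 0 h1 h2 A B (fun p =>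
    Cmod a ^ 2 * kern (RtoC (Cmod a * / sigma) * (p - ps))
    + 4 / 3 * C3 * sigma * kern (RtoC (/ (2 * rho * sigma)) * (p - p1)))).
  { apply grid_sum_le; [lra|lra|exact Hpt]. }
  rewrite (grid_sum_plus _ _ _ _ _ _
    (fun p => Cmod a ^ 2 * kern (RtoC (Cmod a * / sigma) * (p - ps)))), !grid_sum_scal.
  assert (M1 := Rmin_l (/ (K + 1)) (2 * rho)). assert (M2 := Rmin_r (/ (K + 1)) (2 * rho)).
  set (kappa := Rmin (/ (K + 1)) (2 * rho)) in *.
  assert (Hka : forall h, 0 <= h <= kappa * sigma -> Cmod a * / sigma * h <= 1).
  { intros h Hh. apply Rle_trans with (Cmod a * / sigma * (kappa * sigma)).
    - apply Rmult_le_compat_l; [|lra]. apply Rmult_le_pos; lra.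
    - replace (Cmod a * / sigma * (kappa * sigma)) with (Cmod a * kappa) by (field; lra).
      apply Rle_trans with ((K + 1) * / (K + 1)); [|right; field; lra].
      apply Rmult_le_compat; try lra.
      apply Rle_trans with (h / sigma); [apply Rmult_le_pos; lra|].
      apply (Rmult_le_reg_r sigma); [lra|]. replace (h / sigma * sigma) with h by (field; lra). lra. }
  assert (Hrs : 0 < 2 * rho * sigma) by (apply Rmult_lt_0_compat; lra).
  assert (Hkr : forall h, 0 <= h <= kappa * sigma -> / (2 * rho * sigma) * h <= 1).
  { intros h Hh. apply (Rmult_le_reg_l (2 * rho * sigma)); [exact Hrs|].
    rewrite <- Rmult_assoc, Rinv_r by lra.
    assert (kappa * sigma <= 2 * rho * sigma) by (apply Rmult_le_compat_r; lra). lra. }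
  assert (S1 := grid_sum_kern_upper s0 0 h1 h2 (Cmod a * / sigma) A B ps
    ltac:(apply Rmult_lt_0_compat; lra) (proj1 Hh1) (proj1 Hh2) (Hka h1 Hh1) (Hka h2 Hh2)).
  assert (S2 := grid_sum_kern_upper s0 0 h1 h2 (/ (2 * rho * sigma)) A B p1
    (Rinv_0_lt_compat _ Hrs) (proj1 Hh1) (proj1 Hh2) (Hkr h1 Hh1) (Hkr h2 Hh2)).
  assert (T1 : Cmod a ^ 2 * grid_sum s0 0 h1 h2 A B (fun p => kern (RtoC (Cmod a * / sigma) * (p - ps)))
    <= sigma ^ 2 * (PI / 2 + 200 * (K + 1) * (h1 + h2) / sigma)).
  { eapply Rle_trans; [apply Rmult_le_compat_l; [apply pow2_ge_0|exact S1]|].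
    replace (Cmod a ^ 2 * (/ (Cmod a * / sigma) ^ 2 * (PI / 2 + 200 * (Cmod a * / sigma * (h1 + h2)))))
      with (sigma ^ 2 * (PI / 2 + 200 * Cmod a * (h1 + h2) / sigma)) by (field; lra).
    apply Rmult_le_compat_l; [lra|]. apply Rplus_le_compat_l.
    apply Rmult_le_compat_r; [lra|]. apply Rmult_le_compat_r; lra. }
  assert (T2 : 4 / 3 * C3 * sigma * grid_sum s0 0 h1 h2 A B
      (fun p => kern (RtoC (/ (2 * rho * sigma)) * (p - p1)))
    <= sigma ^ 2 * (4 / 3 * C3 * (2 * rho) ^ 2 * 402 * sigma)).
  { eapply Rle_trans; [apply Rmult_le_compat_l; [nra|exact S2]|].
    replace (4 / 3 * C3 * sigma * (/ (/ (2 * rho * sigma)) ^ 2 *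
       (PI / 2 + 200 * (/ (2 * rho * sigma) * (h1 + h2))))) with
      (sigma ^ 2 * (4 / 3 * C3 * (2 * rho) ^ 2 *
       (PI / 2 + 200 * (/ (2 * rho * sigma) * (h1 + h2))) * sigma)) by (field; lra).
    apply Rmult_le_compat_l; [lra|]. apply Rmult_le_compat_r; [lra|].
    apply Rmult_le_compat_l; [assert (0 <= 4 / 3 * C3) by lra; nra|].
    assert (V1 := Hkr h1 Hh1). assert (V2 := Hkr h2 Hh2). lra. }
  eapply Rle_trans; [apply Rplus_le_compat; [exact T1|exact T2]|].
  rewrite <- Rmult_plus_distr_l. apply Rmult_le_compat_l; [lra|].
  assert (U1 : 200 * (K + 1) * (h1 + h2) / sigma <= C0 * (h1 + h2) / sigma).
  { apply Rmult_le_compat_r; [lra|]. apply Rmult_le_compat_r; [lra|]. unfold C0. lra. }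
  assert (U2 : 4 / 3 * C3 * (2 * rho) ^ 2 * 402 * sigma <= C0 * sigma).
  { apply Rmult_le_compat_r; [lra|]. unfold C0. lra. }
  lra.
Qed.

Lemma linear_small (c b : R) : 0 < b -> exists x0, 0 < x0 /\ forall x, 0 <= x <= x0 -> c * x <= b.
Proof.
  intros Hb. exists (b / (Rabs c + 1)). assert (P := Rabs_pos c). split.
  - apply Rdiv_lt_0_compat; lra.
  - intros x Hx. assert (H := Rle_abs c).
    assert (H1 : x * (Rabs c + 1) <= b).
    { apply Rle_trans with (b / (Rabs c + 1) * (Rabs c + 1)); [|right; field; lra].
      apply Rmult_le_compat_r; lra. }
    nra.
Qed.

(* Each value [phi (G p)] is spread over a fine lattice of points [w] of the target
   plane with kernels of radius [sigma]; exchanging the sums and applying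
   [local_count] to every [w] bounds the total by the lattice sum of [phi]. *)
Lemma area_inequality (s0 s1 T M eps : R) (G G' : C -> C) :
  s0 <= s1 -> 0 <= T -> 0 < M -> 0 < eps -> udiff (box s0 s1 0 T) G G' ->
  (forall p q, box s0 s1 0 T p -> box s0 s1 0 T q -> G p = G q -> p = q) ->
  exists h0, 0 < h0 /\ forall (h1 h2 : R) (A B : nat),
    0 <= h1 <= h0 -> 0 <= h2 <= h0 -> h1 * INR A <= s1 - s0 -> h2 * INR B <= T ->
    grid_sum s0 0 h1 h2 A B (fun p => kern (RtoC (/ M) * G p) * Cmod (G' p) ^ 2)
    <= M ^ 2 * (PI / 2) + eps.
Proof.
  intros Hs01 HT HM Heps HG Hinj.
  set (Ar := (s1 - s0) * T). assert (HAr : 0 <= Ar) by (unfold Ar; nra).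
  (* 2 M^2 + 1 bounds M^2 PI / 2 + zeta, so the relative error xi costs at most eps / 4. The error
     zeta in the lattice sum of phi and the loss eta^2 times the area cost eps / 4 each. *)
  set (xi := Rmin 1 (eps / (4 * (2 * M ^ 2 + 1)))).
  assert (HM2 : 0 < M ^ 2) by (apply pow_lt, HM).
  assert (Hxi : 0 < xi).
  { apply Rmin_glb_lt; [lra|]. apply Rdiv_lt_0_compat; lra. }
  assert (Hxi1 : xi <= 1) by apply Rmin_l.
  assert (Hxi2 : xi * (2 * M ^ 2 + 1) <= eps / 4).
  { apply Rle_trans with (eps / (4 * (2 * M ^ 2 + 1)) * (2 * M ^ 2 + 1)).
    - apply Rmult_le_compat_r; [lra|apply Rmin_r].
    - right. field. lra. }
  set (zeta := Rmin 1 (eps / 4)). assert (Hze : 0 < zeta) by (apply Rmin_glb_lt; lra).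
  assert (Hze1 : zeta <= 1) by apply Rmin_l. assert (Hze2 : zeta <= eps / 4) by apply Rmin_r.
  destruct (linear_small Ar (eps / 4) ltac:(lra)) as [y0 [Hy0 Hy]].
  set (eta := Rmin 1 y0). assert (Heta : 0 < eta) by (apply Rmin_glb_lt; lra).
  assert (Heta2 : eta ^ 2 * Ar <= eps / 4).
  { assert (E1 : eta <= 1) by apply Rmin_l. assert (E2 : eta <= y0) by apply Rmin_r.
    assert (H := Hy eta ltac:(lra)). assert (eta ^ 2 * Ar <= eta * Ar); [|lra].
    apply Rmult_le_compat_r; [exact HAr|]. simpl. nra. }
  destruct (local_count s0 s1 T eta G G' Heta HG Hinj) as (C0 & kappa & HC0 & Hk & Hloc).
  (* The square lattice then contains every kernel of radius sigma <= 1 about a point of modulus at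
     most M. *)
  set (R0 := M + 2).
  destruct (linear_small C0 (xi / 3) ltac:(lra)) as [x1 [Hx1 Hx1']].
  destruct (linear_small ((2 * R0) * (2 * R0) * (2 / M)) (zeta / 2) ltac:(lra)) as [x2 [Hx2 Hx2']].
  set (sigma := Rmin 1 (Rmin x1 x2)).
  assert (Hsg : 0 < sigma) by (repeat apply Rmin_glb_lt; lra).
  assert (Hsg1 : sigma <= 1) by apply Rmin_l.
  assert (Hsg2 : sigma <= x1) by (eapply Rle_trans; [apply Rmin_r|apply Rmin_l]).
  assert (Hsg3 : sigma <= x2) by (eapply Rle_trans; [apply Rmin_r|apply Rmin_r]).
  assert (Hsa := Hx1' sigma ltac:(lra)). assert (Hsb := Hx2' sigma ltac:(lra)).
  destruct (linear_small (400 * M) (zeta / 2) ltac:(lra)) as [x3 [Hx3 Hx3']].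
  destruct (linear_small (400 / sigma) (Rmin (1 / 2) (xi / 3)) ltac:(apply Rmin_glb_lt; lra))
    as [x4 [Hx4 Hx4']].
  set (d0 := Rmin (Rmin sigma M) (Rmin x3 x4)).
  assert (Hd0 : 0 < d0) by (repeat apply Rmin_glb_lt; lra).
  assert (HR0 : 0 < R0) by (unfold R0; lra).
  destruct (nfloor_ex (2 * R0 / d0)) as [n Hn].
  { apply Rdiv_le_0_compat; lra. }
  set (W := S n). assert (HW : 2 * R0 / d0 < INR W) by (unfold W; rewrite S_INR; lra).
  assert (HW0 : 0 < INR W) by (apply lt_0_INR; unfold W; lia).
  set (delta := 2 * R0 / INR W).
  assert (Hdel : 0 < delta) by (apply Rdiv_lt_0_compat; lra).
  assert (HdW : delta * INR W = 2 * R0) by (unfold delta; field; lra).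
  assert (Hdd : delta <= d0).
  { apply (Rmult_le_reg_r (INR W)); [exact HW0|]. rewrite HdW.
    apply (Rmult_lt_compat_l d0) in HW; [|exact Hd0].
    replace (d0 * (2 * R0 / d0)) with (2 * R0) in HW by (field; lra). lra. }
  assert (D1 : delta <= sigma) by (eapply Rle_trans; [exact Hdd|]; eapply Rle_trans; [apply Rmin_l|apply Rmin_l]).
  assert (D2 : delta <= M) by (eapply Rle_trans; [exact Hdd|]; eapply Rle_trans; [apply Rmin_l|apply Rmin_r]).
  assert (D3 : delta <= x3) by (eapply Rle_trans; [exact Hdd|]; eapply Rle_trans; [apply Rmin_r|apply Rmin_l]).
  assert (D4 : delta <= x4) by (eapply Rle_trans; [exact Hdd|]; eapply Rle_trans; [apply Rmin_r|apply Rmin_r]).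
  assert (Hda := Hx3' delta ltac:(lra)). assert (Hdb := Hx4' delta ltac:(lra)).
  assert (Hdc := Rle_trans _ _ _ Hdb (Rmin_l _ _)). assert (Hdd' := Rle_trans _ _ _ Hdb (Rmin_r _ _)).
  destruct (linear_small (C0 * 2 / sigma) (xi / 3) ltac:(lra)) as [x5 [Hx5 Hx5']].
  exists (Rmin (kappa * sigma) x5).
  assert (Hks : 0 < kappa * sigma) by (apply Rmult_lt_0_compat; lra).
  split; [apply Rmin_glb_lt; lra|].
  intros h1 h2 A B Hh1 Hh2 HA HB.
  assert (K1 := Rmin_l (kappa * sigma) x5). assert (K2 := Rmin_r (kappa * sigma) x5).
  assert (Hx5a := Hx5' ((h1 + h2) / 2) ltac:(lra)).
  assert (Hgrid : forall i j, (i < A)%nat -> (j < B)%nat -> box s0 s1 0 T (grid_pt s0 0 h1 h2 i j)).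
  { intros i j Hi Hj. apply lt_INR in Hi, Hj.
    assert (Pi := pos_INR i). assert (Pj := pos_INR j).
    unfold box, grid_pt, Re, Im; simpl. split; split; nra. }
  assert (HP : 3 / 2 < PI / 2 <= 2) by (assert (P1 := PI2_3_2); assert (P2 := PI_4); lra).
  assert (His : 0 < / sigma) by (apply Rinv_0_lt_compat; lra).
  assert (HiM : 0 < / M) by (apply Rinv_0_lt_compat; lra).
  set (phi := fun u : C => kern (RtoC (/ M) * u)).
  set (psi := fun p => Rmax 0 (Cmod (G' p) ^ 2 - eta ^ 2)).
  assert (Hphi : forall u, 0 <= phi u <= 1) by (intros u; apply kern_range).
  assert (Hpsi0 : forall p, 0 <= psi p) by (intros p; apply Rmax_l).
  set (gp := grid_sum s0 0 h1 h2 A B). set (gw := grid_sum (- R0) (- R0) delta delta W W).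
  set (X := gp (fun p => phi (G p) * psi p)).
  assert (Step1 : gp (fun p => phi (G p) * Cmod (G' p) ^ 2) <= X + eps / 4).
  { apply Rle_trans with (gp (fun p => phi (G p) * psi p + eta ^ 2)).
    - apply grid_sum_le; try lra. intros i j _ _. set (p := grid_pt s0 0 h1 h2 i j).
      assert (H := Hphi (G p)). assert (H1 : Cmod (G' p) ^ 2 <= psi p + eta ^ 2).
      { assert (H2 := Rmax_r 0 (Cmod (G' p) ^ 2 - eta ^ 2)). unfold psi. lra. }
      assert (H3 : 0 <= eta ^ 2) by apply pow2_ge_0.
      assert (H4 : phi (G p) * Cmod (G' p) ^ 2 <= phi (G p) * (psi p + eta ^ 2))
        by (apply Rmult_le_compat_l; lra). nra.
    - unfold gp. rewrite grid_sum_plus, grid_sum_const. apply Rplus_le_compat_l.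
      apply Rle_trans with (Ar * eta ^ 2); [|lra].
      apply Rmult_le_compat_r; [apply pow2_ge_0|]. unfold Ar.
      assert (PA := pos_INR A). assert (PB := pos_INR B).
      apply Rmult_le_compat; try assumption; apply Rmult_le_pos; lra. }
  set (m := PI / 2 - 400 * delta / sigma).
  assert (Em : 400 * delta / sigma = 400 / sigma * delta) by (field; lra).
  assert (Hm : 1 <= m) by (unfold m; lra).
  (* 2 / M is the Lipschitz constant of phi, so q w bounds phi at every point within sigma of w. *)
  set (q := fun w => phi w + 2 / M * sigma).
  assert (Hq0 : forall w, 0 <= q w).
  { intros w. unfold q. assert (H := Hphi w).
    assert (0 <= 2 / M * sigma); [|lra]. apply Rmult_le_pos; [|lra]. apply Rmult_le_pos; lra. }
  (* The lattice sum of the kernels around [G p] is at least sigma^2 m. Where such a kernel is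
     nonzero, phi (G p) <= q w. *)
  assert (Step2 : sigma ^ 2 * m * X <=
    gp (fun p => gw (fun w => q w * (kern (RtoC (/ sigma) * (G p - w)) * psi p)))).
  { unfold X, gp. rewrite <- grid_sum_scal. apply grid_sum_le; try lra. intros i j _ _.
    set (p := grid_pt s0 0 h1 h2 i j).
    assert (Hterm : forall w, 0 <= q w * (kern (RtoC (/ sigma) * (G p - w)) * psi p)).
    { intros w. apply Rmult_le_pos; [apply Hq0|]. apply Rmult_le_pos; [apply kern_range|apply Hpsi0]. }
    destruct (Rle_dec M (Cmod (G p))) as [Hbig|Hsm].
    - replace (phi (G p)) with 0.
      + rewrite Rmult_0_l, Rmult_0_r. apply grid_sum_nonneg; try lra. intros; apply Hterm.
      + symmetry. apply kern_out. rewrite Cmod_mult, Cmod_R, Rabs_pos_eq by lra.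
        apply (Rmult_le_reg_l M); [lra|]. rewrite <- Rmult_assoc, Rinv_r by lra. lra.
    - assert (Hre := Rle_trans _ _ _ (re_le_Cmod (G p)) (Rlt_le _ _ (Rnot_le_lt _ _ Hsm))).
      assert (Him := Rle_trans _ _ _ (im_le_Cmod (G p)) (Rlt_le _ _ (Rnot_le_lt _ _ Hsm))).
      apply Rabs_le_between in Hre, Him.
      assert (Hcov : forall x, 1 <= x -> 1 <= / sigma * x).
      { intros x Hx. apply (Rmult_le_reg_l sigma); [lra|]. rewrite <- Rmult_assoc, Rinv_r by lra. lra. }
      assert (Hst : / sigma * delta <= 1).
      { apply (Rmult_le_reg_l sigma); [lra|]. rewrite <- Rmult_assoc, Rinv_r by lra. lra. }
      assert (Hlow := grid_sum_kern_lower (- R0) (- R0) delta delta (/ sigma) W W (G p) His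
        ltac:(lra) ltac:(lra) Hst Hst
        ltac:(apply Hcov; unfold R0; lra) ltac:(apply Hcov; rewrite HdW; unfold R0; lra)
        ltac:(apply Hcov; unfold R0; lra) ltac:(apply Hcov; rewrite HdW; unfold R0; lra)).
      replace (/ (/ sigma) ^ 2 * (PI / 2 - 200 * (/ sigma * (delta + delta)))) with (sigma ^ 2 * m)
        in Hlow by (unfold m; field; lra).
      apply Rle_trans with (phi (G p) * psi p *
        grid_sum (- R0) (- R0) delta delta W W (fun w => kern (RtoC (/ sigma) * (w - G p)))).
      + rewrite (Rmult_comm (phi (G p) * psi p)). apply Rmult_le_compat_r; [|exact Hlow].
        apply Rmult_le_pos; [apply Hphi|apply Hpsi0].
      + unfold gw. rewrite <- grid_sum_scal. apply grid_sum_le; try lra. intros i' j' _ _.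
        set (w := grid_pt (- R0) (- R0) delta delta i' j').
        assert (Esym : kern (RtoC (/ sigma) * (w - G p)) = kern (RtoC (/ sigma) * (G p - w))).
        { unfold kern. rewrite !Cmod_mult, (Cmod_minus_sym w). reflexivity. }
        rewrite Esym.
        destruct (Req_dec (kern (RtoC (/ sigma) * (G p - w))) 0) as [E0|E0].
        * rewrite E0. lra.
        * assert (Hnear : Cmod (G p - w) < sigma).
          { apply Rnot_le_lt. intros Hle. apply E0. apply kern_out.
            rewrite Cmod_mult, Cmod_R, Rabs_pos_eq by lra.
            apply (Rmult_le_reg_l sigma); [lra|]. rewrite <- Rmult_assoc, Rinv_r by lra. lra. }
          assert (Hpq : phi (G p) <= q w).
          { unfold phi, q. assert (H := kern_lip (RtoC (/ M) * G p) (RtoC (/ M) * w)).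
            replace (RtoC (/ M) * G p - RtoC (/ M) * w)%C with (RtoC (/ M) * (G p - w))%C in H by ring.
            rewrite Cmod_mult, Cmod_R, (Rabs_pos_eq (/ M)) in H by lra.
            assert (H1 := Rle_abs (kern (RtoC (/ M) * G p) - kern (RtoC (/ M) * w))).
            assert (H2 : / M * Cmod (G p - w) <= / M * sigma) by (apply Rmult_le_compat_l; lra).
            fold (phi w) in *. unfold Rdiv. fold (phi w) in H1, H. lra. }
          rewrite Rmult_assoc, (Rmult_comm (psi p)).
          apply Rmult_le_compat_r; [|exact Hpq].
          apply Rmult_le_pos; [apply kern_range|apply Hpsi0]. }
  set (e := C0 * (h1 + h2) / sigma + C0 * sigma).
  assert (He : e <= 2 * (xi / 3)).
  { unfold e. assert (E : C0 * (h1 + h2) / sigma = C0 * 2 / sigma * ((h1 + h2) / 2)) by (field; lra).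
    lra. }
  assert (He0 : 0 <= e).
  { unfold e. assert (0 <= C0 * (h1 + h2) / sigma) by
      (apply Rmult_le_pos; [apply Rmult_le_pos|]; lra).
    assert (0 <= C0 * sigma) by nra. lra. }
  (* After the exchange, the sum over p for a fixed w is the one bounded in [local_count]. *)
  assert (Step3 : gp (fun p => gw (fun w => q w * (kern (RtoC (/ sigma) * (G p - w)) * psi p)))
    <= sigma ^ 2 * (PI / 2 + e) * gw q).
  { unfold gp, gw. rewrite grid_sum_swap, <- grid_sum_scal. apply grid_sum_le; try lra. intros i j _ _.
    set (w := grid_pt (- R0) (- R0) delta delta i j).
    rewrite grid_sum_scal, Rmult_comm. apply Rmult_le_compat_r; [apply Hq0|].
    unfold e. rewrite <- Rplus_assoc. apply Hloc; try exact Hgrid; split; lra. }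
  assert (Step4 : gw q <= M ^ 2 * (PI / 2) + zeta).
  { unfold gw, q. rewrite grid_sum_plus, grid_sum_const, HdW.
    assert (Hst : / M * delta <= 1).
    { apply (Rmult_le_reg_l M); [lra|]. rewrite <- Rmult_assoc, Rinv_r by lra. lra. }
    assert (Hup := grid_sum_kern_upper (- R0) (- R0) delta delta (/ M) W W (RtoC 0) HiM
      ltac:(lra) ltac:(lra) Hst Hst).
    rewrite (grid_sum_ext _ _ _ _ _ _ _ phi) in Hup.
    - replace (/ (/ M) ^ 2 * (PI / 2 + 200 * (/ M * (delta + delta)))) with
        (M ^ 2 * (PI / 2) + 400 * M * delta) in Hup by (field; lra).
      replace (2 * R0 * (2 * R0) * (2 / M * sigma)) with (2 * R0 * (2 * R0) * (2 / M) * sigma) by ring.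
      lra.
    - intros i' j'. unfold phi. do 2 f_equal. ring. }
  assert (HX0 : 0 <= X).
  { apply grid_sum_nonneg; try lra. intros. apply Rmult_le_pos; [apply Hphi|apply Hpsi0]. }
  assert (Hs2 : 0 < sigma ^ 2) by (apply pow_lt; lra).
  assert (Step5 : m * X <= (PI / 2 + e) * (M ^ 2 * (PI / 2) + zeta)).
  { apply (Rmult_le_reg_l (sigma ^ 2)); [exact Hs2|].
    rewrite <- !Rmult_assoc. eapply Rle_trans; [exact Step2|]. eapply Rle_trans; [exact Step3|].
    apply Rmult_le_compat_l; [|exact Step4]. apply Rmult_le_pos; lra. }
  assert (Y2 : M ^ 2 * (PI / 2) + zeta <= 2 * M ^ 2 + 1).
  { assert (M ^ 2 * (PI / 2) <= M ^ 2 * 2) by (apply Rmult_le_compat_l; lra). lra. }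
  assert (Y0 : 0 <= M ^ 2 * (PI / 2) + zeta).
  { assert (0 <= M ^ 2 * (PI / 2)) by (apply Rmult_le_pos; lra). lra. }
  set (Y := M ^ 2 * (PI / 2) + zeta) in *.
  (* Since m >= 1, (1 + xi) m >= m + xi >= PI / 2 + 2 xi / 3 >= PI / 2 + e. *)
  assert (HXY : X <= (1 + xi) * Y).
  { apply (Rmult_le_reg_l m); [lra|]. eapply Rle_trans; [exact Step5|].
    rewrite <- Rmult_assoc. apply Rmult_le_compat_r; [exact Y0|]. unfold m in *. nra. }
  assert (xi * Y <= xi * (2 * M ^ 2 + 1)) by (apply Rmult_le_compat_l; lra).
  fold phi gp. change (gp (fun p => phi (G p) * Cmod (G' p) ^ 2) <= M ^ 2 * (PI / 2) + eps).
  unfold Y in *. lra.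
Qed.

(** * The area theorem *)

Lemma grid_sum_app (s t h1 h2 : R) (A B1 B2 : nat) (f : C -> R) :
  grid_sum s t h1 h2 A (B1 + B2) f
  = grid_sum s t h1 h2 A B1 f + grid_sum s (t + h2 * INR B1) h1 h2 A B2 f.
Proof.
  unfold grid_sum. rewrite <- Rmult_plus_distr_l, <- rsum_plus. f_equal.
  apply rsum_ext. intros i _. rewrite rsum_app. f_equal.
  apply rsum_ext. intros j _. f_equal. unfold grid_pt. f_equal. rewrite plus_INR. ring.
Qed.

Lemma grid_sum_rows (s t h1 h2 : R) (A B : nat) (f : C -> R) :
  grid_sum s t h1 h2 A B f
  = h1 * rsum (fun i => h2 * rsum (fun j => f (grid_pt s t h1 h2 i j)) B) A.
Proof. unfold grid_sum. rewrite rsum_scal. ring. Qed.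

Lemma exp_pow_INR (x : R) (n : nat) : exp x ^ n = exp (INR n * x).
Proof.
  induction n as [|n IH]; [simpl; now rewrite Rmult_0_l, exp_0|].
  rewrite S_INR, Rmult_plus_distr_r, exp_plus, <- IH, Rmult_1_l. simpl. ring.
Qed.

(** All sample points lie in [a, b], so composing [f] with [clamp a b] reduces this to a function
    that is Lipschitz on the line. *)
Lemma riemann_sum_ge_on (L : R) (f : R -> R) (a b h : R) (N : nat) :
  a <= b -> 0 <= L -> 0 <= h -> h * INR N = b - a ->
  (forall s t, a <= s <= b -> a <= t <= b -> Rabs (f t - f s) <= L * Rabs (t - s)) ->
  RInt f a b - L * h * (b - a) <= h * rsum (fun n => f (a + h * INR n)) N.
Proof.
  intros Hab HL Hh HN Hf.
  set (g := fun t => f (clamp a b t)).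
  assert (Hg : rlip L g).
  { intros s t. unfold g. eapply Rle_trans; [apply Hf; now apply clamp_range|].
    apply Rmult_le_compat_l; [exact HL|]. now apply clamp_lip. }
  assert (H := riemann_sum_ge L g a h N HL Hh Hg). rewrite HN in H.
  replace (a + (b - a)) with b in H by ring.
  rewrite (rsum_ext _ (fun n => g (a + h * INR n))).
  - rewrite (RInt_ext f g); [exact H|]. intros t. rewrite Rmin_left, Rmax_right by lra.
    intros Ht. unfold g. rewrite clamp_id by lra. reflexivity.
  - intros n Hn. unfold g. rewrite clamp_id; [reflexivity|].
    apply lt_INR in Hn. assert (P := pos_INR n). nra.
Qed.

Lemma cos_1_zero (x : R) : - (2 * PI) < x < 2 * PI -> cos x = 1 -> x = 0.
Proof.
  intros Hx Hc. assert (P := PI_RGT_0).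
  assert (Hs : sin (x / 2) = 0).
  { replace x with (2 * (x / 2)) in Hc by field. rewrite cos_2a_sin in Hc. nra. }
  destruct (Rtotal_order x 0) as [Hlt|[He|Hgt]]; [|exact He|].
  - assert (H := sin_gt_0 (- (x / 2)) ltac:(lra) ltac:(lra)). rewrite sin_neg in H. lra.
  - assert (H := sin_gt_0 (x / 2) ltac:(lra) ltac:(lra)). lra.
Qed.

Lemma cexp_injective (u v : C) :
  - (2 * PI) < Im u - Im v < 2 * PI -> cexp u = cexp v -> u = v.
Proof.
  intros Him E. assert (E1 : Re u = Re v).
  { apply exp_inv. now rewrite <- !Cmod_cexp, E. }
  unfold cexp in E. rewrite E1 in E. injection E as Ec Es.
  assert (Ex := exp_pos (Re v)).
  apply Rmult_eq_reg_l in Ec; [|lra]. apply Rmult_eq_reg_l in Es; [|lra].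
  assert (E2 : Im u - Im v = 0).
  { apply cos_1_zero; [exact Him|]. rewrite cos_minus, Ec, Es.
    assert (H := sin2_cos2 (Im v)). unfold Rsqr in H. lra. }
  destruct u, v; unfold Re, Im in *; simpl in *. f_equal; lra.
Qed.

Lemma rsum_RInt (f : nat -> R -> R) (F : nat -> R -> R) (a b : R) (N : nat) :
  (forall n x, is_derive (F n) x (f n x)) -> (forall n x, continuous (f n) x) ->
  is_RInt (fun x => rsum (fun n => f n x) N) a b
    (rsum (fun n => F n b) N - rsum (fun n => F n a) N).
Proof.
  intros Hd Hc. induction N as [|N IH]; simpl.
  - replace (0 - 0) with (scal (b - a) 0) by (unfold scal; simpl; unfold mult; simpl; ring).
    apply (is_RInt_const (V := R_NormedModule)).
  - replace (rsum (fun n => F n b) N + F N b - (rsum (fun n => F n a) N + F N a))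
      with (plus (rsum (fun n => F n b) N - rsum (fun n => F n a) N) (minus (F N b) (F N a)))
      by (unfold plus, minus, plus, opp; simpl; ring).
    apply (is_RInt_plus (V := R_NormedModule)); [exact IH|].
    apply (is_RInt_derive (V := R_CompleteNormedModule)); auto.
Qed.

Lemma derivable_lip_on (f f' : R -> R) (a b : R) :
  a <= b -> (forall x, is_derive f x (f' x)) -> (forall x, continuous f' x) ->
  exists L, 0 <= L /\ forall s t, a <= s <= b -> a <= t <= b ->
    Rabs (f t - f s) <= L * Rabs (t - s).
Proof.
  intros Hab Hd Hc.
  destruct (continuity_ab_maj (fun x => Rabs (f' x)) a b Hab) as [m [Hm _]].
  { intros x _. apply continuity_pt_filterlim.
    apply (continuous_comp f' Rabs); [apply Hc|apply continuous_Rabs]. }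
  exists (Rabs (f' m)). split; [apply Rabs_pos|]. intros s t Hs Ht.
  destruct (MVT_gen f s t f') as [c [Hcc E]].
  - intros x _. apply Hd.
  - intros x _. apply continuity_pt_filterlim.
    apply (ex_derive_continuous f). exists (f' x). apply Hd.
  - rewrite E, Rabs_mult. apply Rmult_le_compat_r; [apply Rabs_pos|]. apply Hm.
    unfold Rmin, Rmax in Hcc. destruct (Rle_dec s t); lra.
Qed.

(** * The map p(z)/z in logarithmic coordinates *)

Section LaurentMap.

Variables (c : nat -> C) (p p' : C -> C).
Hypothesis Hp : pser c p.
Hypothesis Hp' : pser (fun n => INR (S n) * c (S n))%C p'.

(** With z = e^u this is p(z)/z = 1/z + c_1 + c_2 z + .... Its u-derivative is z times the
    z-derivative, namely -(p - z p')/z; the factor z absorbs the polar Jacobian. *)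
Let G (u : C) : C := (p (cexp u) * cexp (- u))%C.
Let d (z : C) : C := (p z - z * p' z)%C.
Let G' (u : C) : C := (- (d (cexp u) * cexp (- u)))%C.

Lemma laurent_udiff (a b T : R) : b < 0 -> udiff (box a b 0 T) G G'.
Proof.
  intros Hb. assert (HB := box_bounded a b 0 T).
  assert (Hr : 0 <= exp b < 1).
  { split; [left; apply exp_pos|]. rewrite <- exp_0. now apply exp_increasing. }
  assert (H1 : udiff (box a b 0 T) (fun u => p (cexp u)) (fun u => p' (cexp u) * cexp u)%C).
  { apply (udiff_comp _ (cdisk (exp b))).
    - exact HB.
    - apply cdisk_bounded; lra.
    - intros z [[_ Hz] _]. unfold cdisk. rewrite Cmod_cexp.
      destruct Hz as [Hz| ->]; [left; now apply exp_increasing|lra].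
    - now apply (pser_holo_derive c).
    - now apply udiff_cexp. }
  assert (H2 : udiff (box a b 0 T) (fun u => cexp (- u)) (fun u => cexp (- u) * - (1))%C).
  { destruct HB as [D [HD HbD]].
    apply (udiff_comp _ (cdisk D) cexp cexp (fun u => - u)%C (fun _ => - (1))%C).
    - exists D. auto.
    - now apply cdisk_bounded.
    - intros z Hz. unfold cdisk. rewrite Cmod_opp. auto.
    - apply udiff_cexp, cdisk_bounded, HD.
    - apply (udiff_ext _ (fun z => - (1) * z)%C (fun z => - (1) * 1)%C).
      + intros; ring.
      + intros; ring.
      + apply udiff_scal, udiff_id. }
  eapply udiff_ext; [| |apply (udiff_mult _ _ _ _ _ HB H1 H2)].
  - reflexivity.
  - intros u _. unfold G', d.
    assert (E : (cexp u * cexp (- u) = 1)%C).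
    { rewrite <- cexp_plus. replace (u + - u)%C with (RtoC 0) by ring. apply cexp_0. }
    replace (p' (cexp u) * cexp u * cexp (- u))%C with (p' (cexp u) * (cexp u * cexp (- u)))%C by ring.
    replace (- ((p (cexp u) - cexp u * p' (cexp u)) * cexp (- u)))%C with
      (p' (cexp u) * (cexp u * cexp (- u)) - p (cexp u) * cexp (- u))%C by ring.
    ring.
Qed.

(** With T < 2 PI the logarithm is unique in the rectangle, so injectivity of p(z)/z on the
    punctured disk carries over. *)
Lemma laurent_injective (a b T : R) :
  b < 0 -> T < 2 * PI ->
  (forall z w, 0 < Cmod z < 1 -> 0 < Cmod w < 1 -> (p z / z)%C = (p w / w)%C -> z = w) ->
  forall u v, box a b 0 T u -> box a b 0 T v -> G u = G v -> u = v.
Proof.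
  intros Hb HT Hinj u v [[Hu1 Hu2] Hu3] [[Hv1 Hv2] Hv3] E.
  assert (Hm : forall w : C, Re w <= b -> 0 < Cmod (cexp w) < 1).
  { intros w Hw. rewrite Cmod_cexp. split; [apply exp_pos|].
    rewrite <- exp_0. apply exp_increasing. lra. }
  assert (Hinv : forall w : C, cexp (- w) = (/ cexp w)%C).
  { intros w. assert (N := cexp_neq_0 w).
    assert (E1 : (cexp w * cexp (- w) = 1)%C).
    { rewrite <- cexp_plus. replace (w + - w)%C with (RtoC 0) by ring. apply cexp_0. }
    replace (cexp (- w)) with (cexp w * cexp (- w) / cexp w)%C by (field; exact N).
    rewrite E1. field. exact N. }
  apply cexp_injective; [lra|]. apply Hinj; auto.
  unfold G in E. rewrite !Hinv in E. exact E.
Qed.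

Lemma pser_d : pser (fun n => RtoC (1 - INR n) * c n)%C d.
Proof.
  intros z Hz. unfold d. assert (S1 := Hp z Hz). assert (S2 := Hp' z Hz).
  assert (S3 : cseries (fun n => RtoC (INR n) * c n * z ^ n)%C (z * p' z)%C).
  { replace (z * p' z)%C with (RtoC (INR 0) * c 0%nat * z ^ 0 + z * p' z)%C by (simpl; ring).
    apply (cseries_cons (fun n => RtoC (INR n) * c n * z ^ n)%C).
    eapply cseries_ext; [|apply (cseries_scal z _ _ S2)]. intros n. cbv beta. simpl Cpow. ring. }
  unfold Cminus. replace (- (z * p' z))%C with (- (1) * (z * p' z))%C by ring.
  eapply cseries_ext; [|apply (cseries_plus _ _ _ _ S1 (cseries_scal (- (1))%C _ _ S3))].
  intros n. cbv beta. rewrite RtoC_minus. ring.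
Qed.

Lemma d_holo : exists d', holo d d'.
Proof. destruct (pser_deriv _ _ pser_d) as [d' [_ H]]. now exists d'. Qed.

Hypothesis c0 : c 0%nat = RtoC 1.
Hypothesis c1 : c 1%nat = RtoC 0.

(** With c_1 = 0 one has p = 1 + c_2 z^2 + O(z^3) and d = 1 - c_2 z^2 + O(z^3), so the quadratic
    terms cancel in p d. An error of order |z|^2 would leave a bounded contribution as M grows;
    |z|^3 leaves one of order 1/M. *)
Lemma product_estimate (r : R) : 0 <= r < 1 ->
  exists K, 0 <= K /\ forall z, Cmod z <= r -> Cmod (p z * d z) ^ 2 <= 1 + K * Cmod z ^ 3.
Proof.
  intros Hr. assert (Hb := cdisk_bounded r (proj1 Hr)).
  assert (Hthree : forall (e : nat -> C) (F : C -> C), pser e F -> e 0%nat = RtoC 1 -> e 1%nat = RtoC 0 ->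
    exists K F3, 0 <= K /\ (forall z, Cmod z <= r -> Cmod (F3 z) <= K /\
      F z = (1 + e 2%nat * z ^ 2 + z ^ 3 * F3 z)%C)).
  { intros e F HF e0 e1.
    destruct (pser_tail _ _ HF) as [F1 [HF1 E1]].
    destruct (pser_tail _ _ HF1) as [F2 [HF2 E2]].
    destruct (pser_tail _ _ HF2) as [F3 [HF3 E3]].
    destruct (pser_deriv _ _ HF3) as [F3' [_ D3]].
    destruct (udiff_bounded _ _ _ Hb (D3 r Hr)) as [K [HK HK3]].
    exists K, F3. split; [exact HK|]. intros z Hz. split; [now apply HK3|].
    rewrite E1, E2, E3, e0, e1 by lra. simpl. ring. }
  destruct (Hthree c p Hp c0 c1) as (K & P3 & HK & HP3).
  destruct (Hthree _ d pser_d) as (K' & D3 & HK' & HD3).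
  { rewrite c0. simpl INR. rewrite Rminus_0_r. ring. }
  { rewrite c1. ring. }
  set (q := Cmod (c 2%nat)). assert (Hq : 0 <= q) by apply Cmod_ge_0.
  set (C1 := q ^ 2 + (1 + q) * (K + K') + K * K').
  assert (HC1 : 0 <= C1).
  { unfold C1. assert (0 <= q ^ 2) by apply pow2_ge_0. assert (0 <= K * K') by nra.
    assert (0 <= (1 + q) * (K + K')) by nra. lra. }
  exists (2 * C1 + C1 ^ 2). split; [nra|]. intros z Hz.
  destruct (HP3 z Hz) as [B1 E1]. destruct (HD3 z Hz) as [B2 E2].
  assert (P0 := Cmod_ge_0 z). set (x := Cmod z) in *.
  assert (Hx3 : 0 <= x ^ 3 <= 1).
  { split; [apply pow_le; lra|]. rewrite <- (pow1 3). apply pow_incr. lra. }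
  assert (Est : Cmod (p z * d z - 1) <= C1 * x ^ 3).
  { rewrite E1, E2.
    replace ((1 + c 2%nat * z ^ 2 + z ^ 3 * P3 z) *
      (1 + RtoC (1 - INR 2) * c 2%nat * z ^ 2 + z ^ 3 * D3 z) - 1)%C with
      (z ^ 3 * (- (z * (c 2%nat * c 2%nat)) + (1 + - (c 2%nat * z ^ 2)) * P3 z
        + (1 + c 2%nat * z ^ 2) * D3 z + z ^ 3 * (P3 z * D3 z)))%C
      by (simpl INR; replace (1 - (1 + 1)) with (- (1)) by ring; rewrite RtoC_opp; simpl; ring).
    rewrite Cmod_mult, Cmod_pow, Rmult_comm. fold x. apply Rmult_le_compat_r; [lra|].
    eapply Rle_trans; [apply Cmod_triangle|].
    eapply Rle_trans; [apply Rplus_le_compat_r, Cmod_triangle|].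
    eapply Rle_trans; [apply Rplus_le_compat_r, Rplus_le_compat_r, Cmod_triangle|].
    rewrite Cmod_opp, !Cmod_mult, Cmod_pow. fold x q.
    assert (Hqz : Cmod (c 2%nat * z ^ 2) <= q).
    { rewrite Cmod_mult, Cmod_pow. fold q x. assert (0 <= x ^ 2 <= 1) by (simpl; nra). nra. }
    assert (Q1 : Cmod (1 + - (c 2%nat * z ^ 2)) <= 1 + q).
    { eapply Rle_trans; [apply Cmod_triangle|]. rewrite Cmod_opp, Cmod_1. lra. }
    assert (Q2 : Cmod (1 + c 2%nat * z ^ 2) <= 1 + q).
    { eapply Rle_trans; [apply Cmod_triangle|]. rewrite Cmod_1. lra. }
    assert (Z1 : x * (q * q) <= q ^ 2) by (simpl; nra).
    assert (Z2 : Cmod (1 + - (c 2%nat * z ^ 2)) * Cmod (P3 z) <= (1 + q) * K)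
      by (apply Rmult_le_compat; auto; apply Cmod_ge_0).
    assert (Z3 : Cmod (1 + c 2%nat * z ^ 2) * Cmod (D3 z) <= (1 + q) * K')
      by (apply Rmult_le_compat; auto; apply Cmod_ge_0).
    assert (Z4 : Cmod (P3 z) * Cmod (D3 z) <= K * K')
      by (apply Rmult_le_compat; auto; apply Cmod_ge_0).
    assert (Z5 : x ^ 3 * (Cmod (P3 z) * Cmod (D3 z)) <= 1 * (K * K')).
    { apply Rmult_le_compat; try lra. apply Rmult_le_pos; apply Cmod_ge_0. }
    unfold C1. lra. }
  assert (Est2 : Cmod (p z * d z) <= 1 + C1 * x ^ 3).
  { replace (p z * d z)%C with ((p z * d z - 1) + 1)%C by ring.
    eapply Rle_trans; [apply Cmod_triangle|]. rewrite Cmod_1. lra. }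
  apply Rle_trans with ((1 + C1 * x ^ 3) ^ 2).
  - apply pow_incr. split; [apply Cmod_ge_0|exact Est2].
  - set (y := x ^ 3) in *. assert (0 <= C1 ^ 2) by apply pow2_ge_0.
    replace ((1 + C1 * y) ^ 2) with (1 + (2 * C1 * y + C1 ^ 2 * (y * y))) by ring.
    assert (C1 ^ 2 * (y * y) <= C1 ^ 2 * y) by (apply Rmult_le_compat_l; nra). lra.
Qed.

(** A lower bound for the integral of phi(G)|G'|^2 over the segment Re u = x, with M = exp(-a). The
    sum is the contribution of |G'|^2 after Bessel's inequality; the subtracted term bounds that of
    |G G'|^2 / M^2 by [product_estimate]. *)
Definition row_bound (K a : R) (N : nat) (x : R) : R :=
  rsum (fun n => 2 * PI * (INR n - 1) ^ 2 * Cmod (c n) ^ 2 * exp (2 * (INR n - 1) * x)) N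
  + - (2 * PI * exp (2 * a)) * (exp (- 4 * x) + K * exp (- x)).

Let Psi (M : R) (u : C) : R := kern (RtoC (/ M) * G u) * Cmod (G' u) ^ 2.

(** [D] bounds the mass of the discarded rows; [L], uniform in x, controls the Riemann sums in t. *)
Lemma integrand_regular (a b M : R) : b < 0 -> 0 < M ->
  exists D L, 0 <= L /\ (forall u, box a b 0 (2 * PI) u -> Psi M u <= D) /\
    forall x s t, a <= x <= b -> 0 <= s <= 2 * PI -> 0 <= t <= 2 * PI ->
      Rabs (Psi M (x, t) - Psi M (x, s)) <= L * Rabs (t - s).
Proof.
  intros Hb HM. assert (HiM : 0 < / M) by now apply Rinv_0_lt_compat.
  assert (HU := laurent_udiff a b (2 * PI) Hb).
  assert (Hbb := box_bounded a b 0 (2 * PI)).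
  destruct (udiff_lip _ _ _ Hbb HU) as [L1 [HL1 HLG]].
  destruct (udiff_lip_deriv _ _ _ HU) as [L2 [HL2 HLG']].
  destruct (udiff_bounded_deriv _ _ _ Hbb HU) as [D [HD HbG']].
  exists (D ^ 2).
  exists (2 * (/ M * L1) * D ^ 2 + 2 * D * L2).
  split; [|split].
  - assert (0 <= / M * L1) by nra. assert (0 <= 2 * (/ M * L1) * D ^ 2) by nra.
    assert (0 <= 2 * D * L2) by nra. lra.
  - intros u Hu. unfold Psi. assert (H := kern_range (RtoC (/ M) * G u)).
    assert (H1 : Cmod (G' u) ^ 2 <= D ^ 2) by (apply pow_incr; split; [apply Cmod_ge_0|now apply HbG']).
    assert (H2 := pow2_ge_0 (Cmod (G' u))). nra.
  - intros x s t Hx Hs Ht. unfold Psi. set (u := (x, s)). set (v := (x, t)).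
    assert (Hu : box a b 0 (2 * PI) u) by (unfold box, u, Re, Im; simpl; lra).
    assert (Hv : box a b 0 (2 * PI) v) by (unfold box, v, Re, Im; simpl; lra).
    replace (Rabs (t - s)) with (Cmod (v - u)).
    2:{ replace (v - u)%C with (Ci * RtoC (t - s))%C
          by (unfold u, v, Cminus, Cplus, Copp, Cmult, Ci, RtoC; simpl; f_equal; ring).
        rewrite Cmod_mult, Cmod_Ci, Cmod_R. ring. }
    set (ku := kern (RtoC (/ M) * G u)). set (kv := kern (RtoC (/ M) * G v)).
    set (gu := Cmod (G' u)). set (gv := Cmod (G' v)). set (h := Cmod (v - u)).
    assert (Hku := kern_range (RtoC (/ M) * G u)). fold ku in Hku.
    assert (Hk1 : Rabs (kv - ku) <= 2 * (/ M * L1) * h).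
    { eapply Rle_trans; [apply kern_lip|].
      replace (RtoC (/ M) * G v - RtoC (/ M) * G u)%C with (RtoC (/ M) * (G v - G u))%C by ring.
      rewrite Cmod_mult, Cmod_R, Rabs_pos_eq by lra.
      assert (H := HLG u v Hu Hv). fold h in H.
      assert (/ M * Cmod (G v - G u) <= / M * (L1 * h)) by (apply Rmult_le_compat_l; lra). lra. }
    assert (Hg0 : 0 <= gu <= D) by (split; [apply Cmod_ge_0|now apply HbG']).
    assert (Hg1 : 0 <= gv <= D) by (split; [apply Cmod_ge_0|now apply HbG']).
    assert (Hg2 : Rabs (gv - gu) <= L2 * h).
    { eapply Rle_trans; [|apply (HLG' u v Hu Hv)].
      assert (T1 := Cmod_triangle_rev (G' v) (G' u)).
      assert (T2 := Cmod_triangle_rev (G' u) (G' v)).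
      rewrite Cmod_minus_sym in T2. apply Rabs_le. unfold gu, gv. lra. }
    replace (kv * gv ^ 2 - ku * gu ^ 2) with ((kv - ku) * gv ^ 2 + ku * ((gv + gu) * (gv - gu))) by ring.
    eapply Rle_trans; [apply Rabs_triang|]. rewrite !Rabs_mult.
    rewrite (Rabs_pos_eq (gv ^ 2)) by apply pow2_ge_0.
    rewrite (Rabs_pos_eq ku), (Rabs_pos_eq (gv + gu)) by lra.
    assert (Z1 : Rabs (kv - ku) * gv ^ 2 <= 2 * (/ M * L1) * h * D ^ 2).
    { apply Rmult_le_compat; [apply Rabs_pos|apply pow2_ge_0|exact Hk1|]. apply pow_incr. exact Hg1. }
    assert (Z2 : (gv + gu) * Rabs (gv - gu) <= 2 * D * (L2 * h)).
    { apply Rmult_le_compat; [lra|apply Rabs_pos|lra|exact Hg2]. }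
    assert (Z3 : ku * ((gv + gu) * Rabs (gv - gu)) <= 1 * ((gv + gu) * Rabs (gv - gu))).
    { apply Rmult_le_compat_r; [|lra]. apply Rmult_le_pos; [lra|apply Rabs_pos]. }
    lra.
Qed.

(** The bound kern v >= 1 - |v|^2 holds everywhere, also where its right side is negative. It leaves
    |G'|^2 - |G G'|^2 / M^2, estimated by Bessel's inequality and by [HK]. *)
Lemma row_integral (K a x : R) (N : nat) : x < 0 ->
  (forall z, Cmod z <= exp x -> Cmod (p z * d z) ^ 2 <= 1 + K * Cmod z ^ 3) ->
  row_bound K a N x <=
  RInt (fun t => Psi (exp (- a)) (x, t)) 0 (2 * PI).
Proof.
  intros Hx HK. assert (HPI := PI_RGT_0).
  set (r := exp x).
  assert (Hr : 0 < r < 1).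
  { split; [apply exp_pos|]. unfold r. rewrite <- exp_0. now apply exp_increasing. }
  destruct d_holo as [d' Hd].
  assert (Ez : forall t, cexp (x, t) = (r * cis t)%C).
  { intros t. unfold cis, cexp, r, Cmult, RtoC; simpl. rewrite exp_0. f_equal; ring. }
  assert (Ei : forall t, Cmod (cexp (- (x, t))) = exp (- x)) by (intros t; apply Cmod_cexp).
  assert (Ig : ex_RInt (fun t => Psi (exp (- a)) (x, t)) 0 (2 * PI)).
  { destruct (integrand_regular x x (exp (- a)) Hx (exp_pos _)) as (_ & L & HL & _ & HP).
    apply (ex_RInt_ext (fun t => Psi (exp (- a)) (x, clamp 0 (2 * PI) t))).
    { intros t. rewrite Rmin_left, Rmax_right by lra. intros Ht. now rewrite clamp_id by lra. }
    apply (rlip_ex_RInt L). intros s t.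
    eapply Rle_trans; [apply HP; try apply clamp_range; lra|].
    apply Rmult_le_compat_l; [exact HL|]. apply clamp_lip. lra. }
  assert (bd := holo_bdd_lip d d' r Hd ltac:(lra)).
  assert (Id := bdd_lip_sq_ex_RInt _ 0 (2 * PI) bd). cbv beta in Id.
  set (V := exp (2 * a) * (exp (- 4 * x) + K * exp (- x))).
  apply Rle_trans with (RInt (fun t => exp (- 2 * x) * Cmod (d (r * cis t)%C) ^ 2 + (- 1) * V) 0 (2 * PI)).
  - rewrite (RInt_lin (fun t => Cmod (d (r * cis t)%C) ^ 2) (fun _ => V)).
    + rewrite RInt_const. fold (mean_sq d r).
      match goal with |- context [scal ?x V] => change (scal x V) with (x * V) end.
      assert (Hbes := bessel _ d r N Hr pser_d).
      apply (Rmult_le_compat_l (exp (- 2 * x))) in Hbes; [|left; apply exp_pos].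
      unfold row_bound, V.
      replace (rsum (fun n => 2 * PI * (INR n - 1) ^ 2 * Cmod (c n) ^ 2 * exp (2 * (INR n - 1) * x)) N)
        with (exp (- 2 * x) * (2 * PI * rsum (fun n => Cmod (RtoC (1 - INR n) * c n) ^ 2 * r ^ (2 * n)) N)).
      * lra.
      * rewrite <- Rmult_assoc, <- rsum_scal. apply rsum_ext. intros n _.
        rewrite Cmod_mult, Cmod_R, Rpow_mult_distr, pow2_abs.
        unfold r. rewrite exp_pow_INR.
        replace (exp (2 * (INR n - 1) * x)) with (exp (- 2 * x) * exp (INR (2 * n) * x)).
        -- ring.
        -- rewrite <- exp_plus. f_equal. rewrite mult_INR. simpl INR. ring.
    + exact Id.
    + apply ex_RInt_const.
  - apply RInt_le; [lra| |exact Ig|].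
    + apply (ex_RInt_plus (V := R_NormedModule) (fun t => exp (- 2 * x) * Cmod (d (r * cis t)%C) ^ 2)
        (fun _ => (-1) * V)).
      * apply (ex_RInt_scal (V := R_NormedModule) _ 0 (2 * PI) (exp (- 2 * x)) Id).
      * apply ex_RInt_const.
    + intros t _. set (z := (r * cis t)%C).
      assert (Hz : Cmod z = r) by (unfold z; rewrite Cmod_mult, Cmod_cis, Cmod_R, Rabs_pos_eq; lra).
      assert (EG : Cmod (G (x, t)) = Cmod (p z) * exp (- x)).
      { unfold G. rewrite Cmod_mult, Ei, Ez. reflexivity. }
      assert (EG' : Cmod (G' (x, t)) = Cmod (d z) * exp (- x)).
      { unfold G'. rewrite Cmod_opp, Cmod_mult, Ei, Ez. reflexivity. }
      assert (Hk := HK z ltac:(rewrite Hz; unfold r; lra)).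
      rewrite Hz in Hk. rewrite Cmod_mult in Hk.
      assert (Hkern : 1 - exp (2 * a) * (Cmod (p z) * exp (- x)) ^ 2 <= kern (RtoC (/ exp (- a)) * G (x, t))).
      { unfold kern. eapply Rle_trans; [|apply Rmax_r]. right.
        rewrite Cmod_mult, EG, Cmod_R, <- exp_Ropp, Ropp_involutive.
        rewrite Rabs_pos_eq by (left; apply exp_pos).
        replace (2 * a) with (a + a) by ring. rewrite exp_plus. ring. }
      unfold Psi. rewrite EG'.
      assert (E2 : exp (- x) ^ 2 = exp (- 2 * x)).
      { simpl. rewrite Rmult_1_r, <- exp_plus. f_equal. ring. }
      apply Rle_trans with ((1 - exp (2 * a) * (Cmod (p z) * exp (- x)) ^ 2) * (Cmod (d z) * exp (- x)) ^ 2).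
      2:{ apply Rmult_le_compat_r; [apply pow2_ge_0|exact Hkern]. }
      replace ((1 - exp (2 * a) * (Cmod (p z) * exp (- x)) ^ 2) * (Cmod (d z) * exp (- x)) ^ 2) with
        (exp (- x) ^ 2 * Cmod (d z) ^ 2 - exp (2 * a) * (exp (- x) ^ 4 * (Cmod (p z) * Cmod (d z)) ^ 2)) by ring.
      rewrite E2. unfold V.
      assert (Hfin : exp (- x) ^ 4 * (Cmod (p z) * Cmod (d z)) ^ 2 <= exp (- 4 * x) + K * exp (- x)).
      { apply Rle_trans with (exp (- x) ^ 4 * (1 + K * r ^ 3)).
        - apply Rmult_le_compat_l; [apply pow_le; left; apply exp_pos|exact Hk].
        - right. unfold r. rewrite Rmult_plus_distr_l, !exp_pow_INR.
          simpl (INR 4). simpl (INR 3). rewrite Rmult_1_r. f_equal; [f_equal; ring|].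
          replace (exp ((1 + 1 + 1 + 1) * - x) * (K * exp ((1 + 1 + 1) * x))) with
            (K * (exp ((1 + 1 + 1 + 1) * - x) * exp ((1 + 1 + 1) * x))) by ring.
          rewrite <- exp_plus. do 2 f_equal. ring. }
      apply (Rmult_le_compat_l (exp (2 * a))) in Hfin; [|left; apply exp_pos]. lra.
Qed.

Hypothesis inj : forall z w, 0 < Cmod z < 1 -> 0 < Cmod w < 1 ->
  (p z / z)%C = (p w / w)%C -> z = w.

Lemma row_bound_lip (K a a' b : R) (N : nat) : a' <= b ->
  exists L, 0 <= L /\ forall s t, a' <= s <= b -> a' <= t <= b ->
    Rabs (row_bound K a N t - row_bound K a N s) <= L * Rabs (t - s).
Proof.
  intros Hab.
  set (lip := fun f : R -> R => exists L, 0 <= L /\ forall s t, a' <= s <= b -> a' <= t <= b ->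
    Rabs (f t - f s) <= L * Rabs (t - s)).
  assert (Hplus : forall f g, lip f -> lip g -> lip (fun x => f x + g x)).
  { intros f g (L & HL & Hf) (M & HM & Hg). exists (L + M). split; [lra|]. intros s t Hs Ht.
    replace (f t + g t - (f s + g s)) with ((f t - f s) + (g t - g s)) by ring.
    eapply Rle_trans; [apply Rabs_triang|].
    assert (H1 := Hf s t Hs Ht). assert (H2 := Hg s t Hs Ht). lra. }
  assert (Hexp : forall A B, lip (fun x => A * exp (B * x))).
  { intros A B. apply (derivable_lip_on _ (fun x => A * (B * exp (B * x)))); [exact Hab| |].
    - intros x. auto_derive; [easy|]. ring.
    - intros x. apply (ex_derive_continuous (fun x => A * (B * exp (B * x)))). auto_derive. easy. }
  assert (Hsum : lip (fun x => rsum (fun n => 2 * PI * (INR n - 1) ^ 2 * Cmod (c n) ^ 2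
    * exp (2 * (INR n - 1) * x)) N)).
  { induction N as [|n IH]; simpl rsum; [exists 0; split; [lra|]; intros; rewrite Rminus_diag, Rabs_R0; lra|].
    apply Hplus; [exact IH|apply Hexp]. }
  destruct (Hplus _ _ Hsum (Hplus _ _ (Hexp (- (2 * PI * exp (2 * a))) (- 4))
    (Hexp (- (2 * PI * exp (2 * a)) * K) (- 1)))) as (L & HL & H).
  exists L. split; [exact HL|]. intros s t Hs Ht. unfold row_bound.
  assert (H' := H s t Hs Ht). cbv beta in H'.
  replace (-1 * t) with (- t) in H' by ring. replace (-1 * s) with (- s) in H' by ring.
  eapply Rle_trans; [|exact H']. right. f_equal. ring.
Qed.

Lemma exists_subdivision (x y : R) : 0 <= x -> 0 < y -> exists n : nat, x / INR (S n) <= y.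
Proof.
  intros Hx Hy. destruct (nfloor_ex (x / y)) as [n Hn].
  { apply Rdiv_le_0_compat; lra. }
  exists n. assert (P : 0 < INR (S n)) by (apply lt_0_INR; lia).
  apply (Rmult_le_reg_r (INR (S n))); [exact P|].
  replace (x / INR (S n) * INR (S n)) with x by (field; lra).
  destruct Hn as [_ Hn]. rewrite S_INR. apply (Rmult_lt_compat_l y) in Hn; [|exact Hy].
  replace (y * (x / y)) with x in Hn by (field; lra). lra.
Qed.

(* The rows near [t = 2 PI] are discarded so that [G] is injective on a closed
   rectangle; they carry little mass. *)
Lemma row_bound_integral (K a b : R) (N : nat) : a < b < 0 ->
  (forall z, Cmod z <= exp b -> Cmod (p z * d z) ^ 2 <= 1 + K * Cmod z ^ 3) ->
  RInt (row_bound K a N) a b <= exp (- a) ^ 2 * (PI / 2).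
Proof.
  intros Hab HK. assert (HPI := PI_RGT_0). apply le_epsilon. intros eps Heps.
  set (M := exp (- a)). assert (HM : 0 < M) by apply exp_pos.
  assert (HiM : 0 < / M) by now apply Rinv_0_lt_compat.
  destruct (integrand_regular a b M ltac:(lra) HM) as (D & L & HL & HPb & HPl).
  destruct (row_bound_lip K a a b N ltac:(lra)) as [Lr [HLr Hrow]].
  (* The strip above T has height 2 PI / (k + 1) and mass at most (b - a) D times this height. *)
  destruct (linear_small ((b - a) * D) (eps / 4) ltac:(lra)) as [y1 [Hy1 Hy1']].
  destruct (exists_subdivision (2 * PI) y1 ltac:(lra) Hy1) as [k Hk].
  assert (Pk : 0 < INR (S k)) by (apply lt_0_INR; lia).
  assert (Hka := Hy1' (2 * PI / INR (S k)) ltac:(split; [apply Rdiv_le_0_compat; lra|exact Hk])).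
  set (T := 2 * PI * INR k / INR (S k)).
  assert (HT : 0 <= T < 2 * PI).
  { unfold T. split.
    - apply Rdiv_le_0_compat; [|exact Pk]. apply Rmult_le_pos; [lra|apply pos_INR].
    - apply (Rmult_lt_reg_r (INR (S k))); [exact Pk|].
      replace (2 * PI * INR k / INR (S k) * INR (S k)) with (2 * PI * INR k) by (field; lra).
      rewrite S_INR. lra. }
  destruct (area_inequality a b T M (eps / 4) G G' ltac:(lra) ltac:(lra) HM ltac:(lra)
    (laurent_udiff a b T ltac:(lra)) (laurent_injective a b T ltac:(lra) ltac:(lra) inj))
    as [h0 [Hh0 Harea]].
  destruct (linear_small (Lr * (b - a)) (eps / 4) ltac:(lra)) as [y2 [Hy2 Hy2']].
  destruct (linear_small ((b - a) * (L * (2 * PI))) (eps / 4) ltac:(lra)) as [y3 [Hy3 Hy3']].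
  set (y := Rmin h0 (Rmin y2 y3)).
  assert (Hy : 0 < y) by (repeat apply Rmin_glb_lt; lra).
  assert (Yh : y <= h0) by apply Rmin_l.
  assert (Y2 : y <= y2) by (eapply Rle_trans; [apply Rmin_r|apply Rmin_l]).
  assert (Y3 : y <= y3) by (eapply Rle_trans; [apply Rmin_r|apply Rmin_r]).
  destruct (exists_subdivision (b - a + 2 * PI) y ltac:(lra) Hy) as [n' Hn'].
  set (n := S n') in *.
  assert (Pn : 0 < INR n) by (apply lt_0_INR; unfold n; lia).
  (* The vertical mesh makes T a grid line: k n rows lie below it and n rows in the strip above. *)
  set (h1 := (b - a) / INR n). set (h2 := 2 * PI / (INR (S k) * INR n)).
  assert (Pkn : 0 < INR (S k) * INR n) by (apply Rmult_lt_0_compat; assumption).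
  assert (Hh1 : 0 <= h1 <= y).
  { unfold h1. split; [apply Rdiv_le_0_compat; lra|]. eapply Rle_trans; [|exact Hn'].
    apply Rmult_le_compat_r; [left; now apply Rinv_0_lt_compat|lra]. }
  assert (Hh2 : 0 <= h2 <= y).
  { unfold h2. split; [apply Rdiv_le_0_compat; lra|]. eapply Rle_trans; [|exact Hn'].
    apply Rmult_le_compat; [lra| |lra|].
    - left. now apply Rinv_0_lt_compat.
    - apply Rinv_le_contravar; [exact Pn|].
      assert (1 <= INR (S k)) by (rewrite S_INR; assert (H := pos_INR k); lra). nra. }
  assert (En1 : h1 * INR n = b - a) by (unfold h1; field; lra).
  assert (En2 : h2 * INR (k * n) = T).
  { unfold h2, T. rewrite mult_INR. field. lra. }
  assert (En3 : h2 * INR n = 2 * PI / INR (S k)) by (unfold h2; field; lra).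
  assert (En4 : h2 * INR (k * n + n) = 2 * PI).
  { unfold h2. rewrite plus_INR, mult_INR, S_INR. field.
    rewrite S_INR in Pk. lra. }
  assert (Hpt : forall i j, (i < n)%nat -> (j < k * n + n)%nat -> box a b 0 (2 * PI) (grid_pt a 0 h1 h2 i j)).
  { intros i j Hi Hj. apply lt_INR in Hi, Hj.
    assert (Pi := pos_INR i). assert (Pj := pos_INR j).
    unfold box, grid_pt, Re, Im; simpl. split; split; nra. }
  assert (Hup : grid_sum a 0 h1 h2 n (k * n + n) (Psi M) <= M ^ 2 * (PI / 2) + eps / 4 + eps / 4).
  { rewrite grid_sum_app. apply Rplus_le_compat.
    - apply Harea; try lra.
    - apply Rle_trans with (grid_sum a (0 + h2 * INR (k * n)) h1 h2 n n (fun _ => D)).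
      + apply grid_sum_le; try lra. intros i j Hi Hj. apply HPb.
        replace (grid_pt a (0 + h2 * INR (k * n)) h1 h2 i j) with (grid_pt a 0 h1 h2 i (k * n + j)).
        * apply Hpt; [exact Hi|lia].
        * unfold grid_pt. f_equal. rewrite plus_INR. ring.
      + rewrite grid_sum_const, En1, En3. lra. }
  assert (Hlow : RInt (row_bound K a N) a b - eps / 4 - eps / 4 <= grid_sum a 0 h1 h2 n (k * n + n) (Psi M)).
  { rewrite grid_sum_rows.
    apply Rle_trans with (h1 * rsum (fun i => row_bound K a N (a + h1 * INR i) + - (L * h2 * (2 * PI))) n).
    - rewrite rsum_plus, rsum_const, Rmult_plus_distr_l, <- Rmult_assoc, En1.
      assert (H := riemann_sum_ge_on Lr (row_bound K a N) a b h1 n ltac:(lra) HLr ltac:(lra) En1 Hrow).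
      assert (H1 := Hy2' h1 ltac:(lra)). assert (H2 := Hy3' h2 ltac:(lra)). lra.
    - apply Rmult_le_compat_l; [lra|]. apply rsum_le. intros i Hi.
      assert (Hxi : a <= a + h1 * INR i < b).
      { apply lt_INR in Hi. assert (Pi := pos_INR i).
        assert (0 < h1) by (unfold h1; apply Rdiv_lt_0_compat; lra). split; nra. }
      set (x := a + h1 * INR i) in *.
      assert (Hr := row_integral K a x N ltac:(lra)
        (fun z Hz => HK z (Rle_trans _ _ _ Hz (Rlt_le _ _ (exp_increasing x b (proj2 Hxi)))))).
      assert (Hs := riemann_sum_ge_on L (fun t => Psi M (x, t)) 0 (2 * PI) h2 (k * n + n)
        ltac:(lra) HL ltac:(lra) ltac:(lra) (fun s t => HPl x s t ltac:(lra))).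
      fold M in Hr. cbv beta in Hs. unfold grid_pt. fold x. lra. }
  lra.
Qed.

(** Integrating [row_bound] over [a, b], the n = 0 term gives PI M^2 - PI exp(-2 b) and the quartic
    term takes away PI M^2 / 2, up to a favorable remainder. The left over PI M^2 / 2 cancels the
    right side of the area inequality; all other dependence on a is O(exp a), and a tends to minus
    infinity. *)
Lemma area_on_circle (b : R) (N : nat) : b < 0 ->
  rsum (fun n => INR n * Cmod (c (S n)) ^ 2 * exp (2 * INR n * b)) N <= exp (- 2 * b).
Proof.
  intros Hb. assert (HPI := PI_RGT_0).
  destruct (product_estimate (exp b)) as [K [HK HKe]].
  { split; [left; apply exp_pos|]. rewrite <- exp_0. now apply exp_increasing. }
  set (q := fun n => INR n * Cmod (c (S n)) ^ 2).
  assert (Hq : forall n, 0 <= q n).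
  { intros n. apply Rmult_le_pos; [apply pos_INR|apply pow2_ge_0]. }
  set (Q := rsum q N).
  assert (Main : forall a, a < b -> rsum (fun n => q n * exp (2 * INR n * b)) N
     <= exp (- 2 * b) + exp a * (Q + 2 * K)).
  { intros a Ha.
    assert (HI := row_bound_integral K a b (S N) ltac:(lra) HKe).
    (* Antiderivatives of the terms of [row_bound]; the one with n = 1 is 0, and n = 0 gives the
       negative term - PI exp(-2 x). *)
    set (F := fun n x => PI * (INR n - 1) * Cmod (c n) ^ 2 * exp (2 * (INR n - 1) * x)).
    assert (I1 := rsum_RInt (fun n x => 2 * PI * (INR n - 1) ^ 2 * Cmod (c n) ^ 2 *
       exp (2 * (INR n - 1) * x)) F a b (S N)).
    assert (I1' := I1
      ltac:(intros n x; unfold F; auto_derive; [easy|ring])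
      ltac:(intros n x; apply (ex_derive_continuous (fun x => 2 * PI * (INR n - 1) ^ 2 * Cmod (c n) ^ 2 *
       exp (2 * (INR n - 1) * x))); auto_derive; easy)).
    clear I1.
    set (H := fun x => - (2 * PI * exp (2 * a)) * (- exp (- 4 * x) / 4 - K * exp (- x))).
    assert (I2 : is_RInt (fun x => - (2 * PI * exp (2 * a)) * (exp (- 4 * x) + K * exp (- x))) a b
       (minus (H b) (H a))).
    { apply (is_RInt_derive (V := R_CompleteNormedModule) H).
      - intros x _. unfold H. auto_derive; [easy|]. field.
      - intros x _. apply (ex_derive_continuous (fun x => - (2 * PI * exp (2 * a)) * (exp (- 4 * x) + K * exp (- x)))).
        auto_derive. easy. }
    assert (I3 := is_RInt_plus (V := R_NormedModule) _ _ _ _ _ _ I1' I2).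
    assert (EI : RInt (row_bound K a (S N)) a b
       = rsum (fun n => F n b) (S N) - rsum (fun n => F n a) (S N) + (H b - H a)).
    { exact (is_RInt_unique (V := R_CompleteNormedModule) _ _ _ _ I3). }
    rewrite EI in HI.
    assert (EF : forall x, rsum (fun n => F n x) (S N)
      = PI * (rsum (fun n => q n * exp (2 * INR n * x)) N - exp (- 2 * x))).
    { intros x. rewrite rsum_S_l. unfold F at 1. rewrite c0, Cmod_1. simpl (INR 0).
      rewrite (rsum_ext _ (fun n => PI * (q n * exp (2 * INR n * x)))).
      - rewrite rsum_scal. replace (2 * (0 - 1) * x) with (- 2 * x) by ring. ring.
      - intros n _. unfold F, q. rewrite S_INR. replace (INR n + 1 - 1) with (INR n) by ring. ring. }
    rewrite !EF in HI. unfold H in HI.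
    assert (Ha0 : rsum (fun n => q n * exp (2 * INR n * a)) N <= exp a * Q).
    { unfold Q. rewrite <- rsum_scal. apply rsum_le. intros n _.
      destruct n as [|n].
      - unfold q. simpl (INR 0). lra.
      - rewrite Rmult_comm. apply Rmult_le_compat_r; [apply Hq|].
        assert (P := pos_INR n). rewrite S_INR.
        assert (Hle : 2 * (INR n + 1) * a <= a) by nra.
        destruct Hle as [Hlt|E]; [left; now apply exp_increasing|rewrite E; lra]. }
    assert (E1 : exp (2 * a) * exp (- 4 * a) = exp (- 2 * a)) by (rewrite <- exp_plus; f_equal; ring).
    assert (E2 : exp (2 * a) * exp (- a) = exp a) by (rewrite <- exp_plus; f_equal; ring).
    assert (E3 : exp (- a) ^ 2 = exp (- 2 * a)) by (simpl; rewrite Rmult_1_r, <- exp_plus; f_equal; ring).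
    rewrite E3 in HI.
    assert (P1 : 0 <= exp (2 * a) * exp (- 4 * b)) by (apply Rmult_le_pos; left; apply exp_pos).
    assert (P2 : 0 <= exp (2 * a) * (K * exp (- b))).
    { apply Rmult_le_pos; [left; apply exp_pos|]. apply Rmult_le_pos; [exact HK|left; apply exp_pos]. }
    set (Sb := rsum (fun n => q n * exp (2 * INR n * b)) N) in *.
    set (Sa := rsum (fun n => q n * exp (2 * INR n * a)) N) in *.
    apply (Rmult_le_reg_l PI); [exact HPI|].
    assert (HI2 : PI * (Sb - exp (-2 * b)) - PI * (Sa - exp (-2 * a)) +
       2 * PI * (exp (2 * a) * exp (- 4 * b) / 4 + exp (2 * a) * (K * exp (- b))
         - exp (2 * a) * exp (- 4 * a) / 4 - K * (exp (2 * a) * exp (- a)))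
       <= exp (- 2 * a) * (PI / 2)).
    { eapply Rle_trans; [|exact HI]. right. field. }
    rewrite E1, E2 in HI2.
    assert (P3 : 0 <= 2 * PI * (exp (2 * a) * exp (- 4 * b) / 4 + exp (2 * a) * (K * exp (- b)))).
    { apply Rmult_le_pos; lra. }
    assert (P4 : PI * Sa <= PI * (exp a * Q)) by (apply Rmult_le_compat_l; lra).
    lra. }
  apply le_epsilon. intros eps Heps.
  destruct (linear_small (Q + 2 * K) eps Heps) as [x0 [Hx0 Hx]].
  (* Then a < b and exp a <= x0, so the error exp a (Q + 2 K) is at most eps. *)
  set (a := Rmin (b - 1) (ln x0)).
  assert (Ha1 : a <= b - 1) by apply Rmin_l. assert (Ha2 : a <= ln x0) by apply Rmin_r.
  assert (Ha3 : exp a <= x0).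
  { rewrite <- (exp_ln x0 Hx0). destruct Ha2 as [Hlt|E]; [left; now apply exp_increasing|rewrite E; lra]. }
  assert (H := Main a ltac:(lra)).
  assert (Ha4 := Hx (exp a) ltac:(split; [left; apply exp_pos|exact Ha3])).
  unfold q in H. lra.
Qed.

(** This is the limit b -> 0 in [area_on_circle]; for b < 0 the weights exp(2 n b) with n < N are at
    least exp(2 N b), which can be divided out. *)
Theorem area_theorem (N : nat) : rsum (fun n => INR n * Cmod (c (S n)) ^ 2) N <= 1.
Proof.
  set (S0 := rsum (fun n => INR n * Cmod (c (S n)) ^ 2) N).
  assert (HS0 : 0 <= S0).
  { apply rsum_nonneg. intros n _. apply Rmult_le_pos; [apply pos_INR|apply pow2_ge_0]. }
  assert (H : forall b, b < 0 -> S0 <= exp (- (2 * INR N + 2) * b)).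
  { intros b Hb. assert (H := area_on_circle b N Hb).
    assert (H1 : S0 * exp (2 * INR N * b) <= exp (- 2 * b)).
    { eapply Rle_trans; [|exact H]. unfold S0. rewrite Rmult_comm, <- rsum_scal.
      apply rsum_le. intros n Hn. rewrite Rmult_comm. apply Rmult_le_compat_l.
      - apply Rmult_le_pos; [apply pos_INR|apply pow2_ge_0].
      - apply lt_INR in Hn. left. apply exp_increasing. nra. }
    apply (Rmult_le_reg_r (exp (2 * INR N * b))); [apply exp_pos|].
    rewrite <- exp_plus. replace (- (2 * INR N + 2) * b + 2 * INR N * b) with (- 2 * b) by ring.
    exact H1. }
  apply Rnot_lt_le. intros Hlt.
  assert (Hln : 0 < ln S0) by (rewrite <- ln_1; apply ln_increasing; lra).
  assert (PN := pos_INR N).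
  (* For this b the bound on [S0] is its own square root, which contradicts S0 > 1. *)
  set (b := - (ln S0 / (2 * (2 * INR N + 2)))).
  assert (Hb : b < 0).
  { unfold b. apply Ropp_lt_gt_0_contravar. apply Rdiv_lt_0_compat; lra. }
  assert (H1 := H b Hb).
  replace (- (2 * INR N + 2) * b) with (ln S0 / 2) in H1 by (unfold b; field; lra).
  assert (H2 : exp (ln S0 / 2) < exp (ln S0)) by (apply exp_increasing; lra).
  rewrite exp_ln in H2 by lra. lra.
Qed.

End LaurentMap.

(** * Coefficients of univalent functions *)

(** The Cauchy product, by recursion on the first sequence: it matches the step of [pser_tail] and
    unfolds by [simpl] to an explicit polynomial at each numeral. *)
Fixpoint conv (c d : nat -> C) (n : nat) : C :=
  match n with
  | O => (c 0%nat * d 0%nat)%C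
  | S m => (c 0%nat * d (S m) + conv (fun i => c (S i)) d m)%C
  end.

(** Write F = c_0 + z F_1. The product F_1 G is holomorphic and has an expansion by [holo_pser];
    uniqueness then identifies the coefficients of F G, and the induction passes to F_1 and G. *)
Lemma pser_mult_coeff (n : nat) (c d e : nat -> C) (F G : C -> C) :
  pser c F -> pser d G -> pser e (fun z => F z * G z)%C -> e n = conv c d n.
Proof.
  revert c e F. induction n as [|n IH]; intros c e F HF HG He.
  - simpl. rewrite <- (pser_0 _ _ HF), <- (pser_0 _ _ HG), <- (pser_0 _ _ He). reflexivity.
  - destruct (pser_tail c F HF) as [F1 [HF1 EF]].
    destruct (pser_deriv _ _ HF1) as [F1' [_ DF1]]. destruct (pser_deriv _ _ HG) as [G' [_ DG]].
    destruct (holo_pser _ _ (holo_mult _ _ _ _ DF1 DG)) as [e1 He1].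
    simpl. rewrite <- (IH (fun i => c (S i)) e1 F1 HF1 HG He1).
    set (e' := fun m => match m with O => (c 0%nat * d 0%nat)%C | S j => (c 0%nat * d (S j) + e1 j)%C end).
    change (e (S n) = e' (S n)). apply (pser_unique e e' _ He).
    intros z Hz. rewrite EF by exact Hz.
    set (e2 := fun m => match m with O => RtoC 0 | S j => e1 j end).
    assert (H2 : cseries (fun m => e2 m * z ^ m)%C (z * (F1 z * G z))%C).
    { replace (z * (F1 z * G z))%C with (e2 0%nat * z ^ 0 + z * (F1 z * G z))%C by (simpl; ring).
      apply (cseries_cons (fun m => e2 m * z ^ m)%C).
      eapply cseries_ext; [|apply (cseries_scal z _ _ (He1 z Hz))]. intros m. simpl. ring. }
    replace ((c 0%nat + z * F1 z) * G z)%C with (c 0%nat * G z + z * (F1 z * G z))%C by ring.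
    eapply cseries_ext; [|apply (cseries_plus _ _ _ _ (cseries_scal (c 0%nat) _ _ (HG z Hz)) H2)].
    intros [|m]; simpl; ring.
Qed.

Lemma cseries_zero : cseries (fun _ => RtoC 0) (RtoC 0).
Proof.
  apply cseries_sum_lim. apply is_lim_seq_ext with (fun _ : nat => 0); [|apply is_lim_seq_const].
  intros n. replace (sum_n (G := C_AbelianMonoid) (fun _ : nat => RtoC 0) n) with (RtoC 0).
  - replace (RtoC 0 - RtoC 0)%C with (RtoC 0) by ring. now rewrite Cmod_0.
  - induction n as [|n IH]; [now rewrite sum_O|]. rewrite sum_Sn, <- IH.
    change (@plus C_AbelianMonoid) with Cplus. ring.
Qed.

Lemma pser_const (x : C) : pser (fun n => match n with O => x | S _ => RtoC 0 end) (fun _ => x).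
Proof.
  intros z _. assert (E : (x * z ^ 0 + 0)%C = x) by (simpl; ring).
  cut (cseries (fun n => match n with O => x | S _ => RtoC 0 end * z ^ n)%C (x * z ^ 0 + 0)%C);
    [now rewrite E|].
  apply (cseries_cons (fun n => match n with O => x | S _ => RtoC 0 end * z ^ n)%C).
  eapply cseries_ext; [|apply cseries_zero]. intros n. simpl. ring.
Qed.

(** * Squared arguments, reciprocals and square roots *)

Definition even_coeff (c : nat -> C) (n : nat) : C :=
  if Nat.even n then c (Nat.div2 n) else RtoC 0.

(** The partial sums of orders 2 N and 2 N + 1 both equal the N-th partial sum at z^2. *)
Lemma pser_square_arg (c : nat -> C) (F : C -> C) :
  pser c F -> pser (even_coeff c) (fun z => F (z * z)%C).
Proof.
  intros HF z Hz.
  assert (Hzz : Cmod (z * z) < 1).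
  { rewrite Cmod_mult. assert (P := Cmod_ge_0 z). nra. }
  assert (H := proj1 (cseries_sum_lim _ _) (HF _ Hzz)). apply cseries_sum_lim.
  set (u := fun N => Cmod (sum_n (G := C_AbelianMonoid) (fun n => c n * (z * z) ^ n)%C N - F (z * z)%C)) in H.
  apply (is_lim_seq_ext (fun N => u (Nat.div2 N))).
  - assert (E : forall N, sum_n (G := C_AbelianMonoid) (fun n => even_coeff c n * z ^ n)%C (2 * N)
        = sum_n (G := C_AbelianMonoid) (fun n => c n * (z * z) ^ n)%C N /\
      sum_n (G := C_AbelianMonoid) (fun n => even_coeff c n * z ^ n)%C (S (2 * N))
        = sum_n (G := C_AbelianMonoid) (fun n => c n * (z * z) ^ n)%C N).
    { assert (Odd : forall N, even_coeff c (S (2 * N)) = RtoC 0).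
      { intros N. unfold even_coeff. rewrite PeanoNat.Nat.even_succ, PeanoNat.Nat.odd_even. reflexivity. }
      assert (Even : forall N, (even_coeff c (2 * N) * z ^ (2 * N))%C = (c N * (z * z) ^ N)%C).
      { intros N. unfold even_coeff. rewrite PeanoNat.Nat.even_even, PeanoNat.Nat.div2_double.
        f_equal. rewrite Cpow_mult_r. f_equal. simpl. ring. }
      assert (Step : forall N, sum_n (G := C_AbelianMonoid) (fun n => even_coeff c n * z ^ n)%C (2 * N)
        = sum_n (G := C_AbelianMonoid) (fun n => c n * (z * z) ^ n)%C N ->
        sum_n (G := C_AbelianMonoid) (fun n => even_coeff c n * z ^ n)%C (S (2 * N))
        = sum_n (G := C_AbelianMonoid) (fun n => c n * (z * z) ^ n)%C N).
      { intros N HN. rewrite sum_Sn, HN, Odd.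
        match goal with |- @eq _ (plus ?u _) ?v => change (u + 0 * z ^ S (2 * N) = v)%C end. ring. }
      induction N as [|N [IH1 IH2]].
      - assert (E0 : sum_n (G := C_AbelianMonoid) (fun n => even_coeff c n * z ^ n)%C (2 * 0)
          = sum_n (G := C_AbelianMonoid) (fun n => c n * (z * z) ^ n)%C 0).
        { change (2 * 0)%nat with 0%nat. rewrite !sum_O. reflexivity. }
        split; [exact E0|now apply Step].
      - assert (E1 : sum_n (G := C_AbelianMonoid) (fun n => even_coeff c n * z ^ n)%C (2 * S N)
          = sum_n (G := C_AbelianMonoid) (fun n => c n * (z * z) ^ n)%C (S N)).
        { replace (2 * S N)%nat with (S (S (2 * N))) by lia.
          rewrite sum_Sn, IH2, sum_Sn. f_equal.
          replace (S (S (2 * N))) with (2 * S N)%nat by lia. apply Even. }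
        split; [exact E1|now apply Step]. }
    intros N. unfold u. do 2 f_equal.
    destruct (PeanoNat.Nat.Even_or_Odd N) as [[m ->]|[m ->]].
    + rewrite PeanoNat.Nat.div2_double. symmetry. apply E.
    + rewrite PeanoNat.Nat.add_1_r, PeanoNat.Nat.div2_succ_double. symmetry. apply E.
  - apply is_lim_seq_subseq; [|exact H].
    intros P [N HN]. exists (2 * N)%nat. intros n Hn. apply HN.
    rewrite <- (PeanoNat.Nat.div2_double N). now apply PeanoNat.Nat.div2_le_mono.
Qed.

(** Compactness on the square around the disk. Near a point of modulus greater than r the claim is
    vacuous; near a point z of the disk the Lipschitz constant keeps |F| above |F z| / (L + 1). *)
Lemma holo_lower_bound (F F' : C -> C) (r : R) : holo F F' -> 0 <= r < 1 ->
  (forall z, Cmod z < 1 -> F z <> RtoC 0) ->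
  exists e, 0 < e /\ forall z, Cmod z <= r -> e <= Cmod (F z).
Proof.
  intros HF Hr HN.
  destruct (udiff_lip _ _ _ (cdisk_bounded r (proj1 Hr)) (HF r Hr)) as [L [HL HLF]].
  destruct (box_compact (- (1)) 1 (- (1)) 1 (fun e z => Cmod z <= r -> e <= Cmod (F z)))
    as [e [He H]].
  - intros e d z Hde H Hz. assert (H1 := H Hz). lra.
  - intros z _. destruct (Rle_dec (Cmod z) r) as [Hz|Hz].
    + assert (Hm : 0 < Cmod (F z)) by (apply Cmod_gt_0, HN; lra).
      exists (Cmod (F z) / (L + 1)). split; [apply Rdiv_lt_0_compat; lra|].
      intros w _ Hwz Hw. set (e := Cmod (F z) / (L + 1)) in *.
      assert (Ee : e * (L + 1) = Cmod (F z)) by (unfold e; field; lra).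
      assert (H1 := HLF z w Hz Hw). assert (H2 := Cmod_triangle_rev (F z) (F w)).
      rewrite Cmod_minus_sym in H2. nra.
    + exists (Cmod z - r). split; [lra|]. intros w _ Hwz Hw. exfalso.
      assert (H1 := Cmod_triangle_rev z w). rewrite Cmod_minus_sym in H1. lra.
  - exists e. split; [exact He|]. intros z Hz. apply H; [|exact Hz].
    assert (H1 := re_le_Cmod z). assert (H2 := im_le_Cmod z).
    apply Rabs_le_between in H1, H2. unfold box. lra.
Qed.

Lemma holo_inv (F F' : C -> C) : holo F F' -> (forall z, Cmod z < 1 -> F z <> RtoC 0) ->
  holo (fun z => / F z)%C (fun z => - F' z / (F z * F z))%C.
Proof.
  intros HF HN r Hr. destruct (holo_lower_bound F F' r HF Hr HN) as [e [He H]].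
  apply (udiff_inv _ F F' e); auto. apply cdisk_bounded; lra.
Qed.

(* The square root is [exp (- U / 2)] with [U] a primitive of [Q' / Q]. *)
Lemma inverse_sqrt (c : nat -> C) (Q : C -> C) :
  pser c Q -> Q (RtoC 0) = RtoC 1 -> (forall z, Cmod z < 1 -> Q z <> RtoC 0) ->
  exists k k', holo k k' /\ k (RtoC 0) = RtoC 1 /\
    forall z, Cmod z < 1 -> (k z * k z * Q z)%C = RtoC 1.
Proof.
  intros HQ Q0 HN. destruct (pser_deriv _ _ HQ) as [Q' [HQ' DQ]].
  destruct (pser_deriv _ _ HQ') as [Q'' [_ DQ']].
  destruct (holo_pser _ _ (holo_mult _ _ _ _ DQ' (holo_inv _ _ DQ HN))) as [u Hu].
  destruct (pser_primitive _ _ Hu) as [U [DU U0]].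
  assert (Dk := holo_cexp _ _ (holo_scal (RtoC (- (1 / 2))) _ _ DU)).
  set (k := fun z => cexp (RtoC (- (1 / 2)) * U z)) in *.
  set (k' := fun z => (cexp (RtoC (- (1 / 2)) * U z) * (RtoC (- (1 / 2)) * (Q' z * / Q z)))%C).
  assert (k0 : k (RtoC 0) = RtoC 1) by (unfold k; rewrite U0, Cmult_0_r; apply cexp_0).
  exists k, k'. split; [exact Dk|]. split; [exact k0|].
  intros z Hz.
  (* The derivative of k^2 Q vanishes because k' / k = - Q' / (2 Q), so its value at 0 persists. *)
  assert (D := holo_mult _ _ _ _ (holo_mult _ _ _ _ Dk Dk) DQ).
  assert (E := holo_deriv_zero_const _ _ D). cbv beta in E.
  rewrite E.
  - rewrite k0, Q0. ring.
  - intros w Hw. fold (k w). assert (Nw := HN w Hw).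
    replace (RtoC (- (1 / 2))) with (- (1 / 2))%C.
    + field. exact Nw.
    + rewrite RtoC_opp, RtoC_div by lra. reflexivity.
  - exact Hz.
Qed.

(** * Coefficient relations from the two area inequalities *)

(** The k_j are the coefficients of the inverse square root of f(z)/z. Its square is z/f(z), and
    comparing coefficients up to order 4 expresses a_2, a_4, a_5 by k_1, k_3, k_4. *)
Lemma univalent_coefficients (f : C -> C) (a : nat -> C) :
  class_S f -> has_expansion f a -> a 3%nat = RtoC 0 ->
  exists k1 k3 k4 : C,
    a 2%nat = (- (2) * k1)%C /\
    a 4%nat = (- (2) * k3 + 5 * k1 ^ 3)%C /\
    a 5%nat = (- (2) * k4 + 6 * k1 * k3 - 25 / 4 * k1 ^ 4)%C /\
    Cmod k1 ^ 2 + 27 / 4 * Cmod k1 ^ 4 + 5 * Cmod k3 ^ 2 + 7 * Cmod k4 ^ 2 <= 1 /\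
    Cmod (a 2%nat) <= 1 /\ Cmod (H3_1 a) <= 1 / 2.
Proof.
  intros (_ & Hinj & f0 & _) Hexp a3.
  set (qc := fun n : nat => match n with O => RtoC 1 | S m => a (S (S m)) end).
  (* The value 1 at 0 fills the removable singularity of f(z)/z. *)
  set (Q := fun z : C => if Ceq_dec z (RtoC 0) then RtoC 1 else (f z / z)%C).
  assert (HQ : pser qc Q).
  { intros z Hz. unfold Q. destruct (Ceq_dec z (RtoC 0)) as [->|Nz].
    - replace (RtoC 1) with (qc 0%nat * 0 ^ 0 + 0)%C by (simpl; ring).
      apply (cseries_cons (fun n => qc n * 0 ^ n)%C).
      eapply cseries_ext; [|apply cseries_zero]. intros n. simpl. ring.
    - replace (f z / z)%C with (qc 0%nat * z ^ 0 + / z * (f z - z))%C by (simpl; field; exact Nz).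
      apply (cseries_cons (fun n => qc n * z ^ n)%C).
      eapply cseries_ext; [|apply (cseries_scal (/ z)%C _ _ (Hexp z Hz))].
      intros n. cbv beta. unfold qc. replace (n + 2)%nat with (S (S n)) by lia.
      simpl. field. exact Nz. }
  assert (Q0 : Q (RtoC 0) = RtoC 1) by (rewrite (pser_0 _ _ HQ); reflexivity).
  assert (Qf : forall z, z <> RtoC 0 -> Q z = (f z / z)%C).
  { intros z Nz. unfold Q. destruct (Ceq_dec z (RtoC 0)); [contradiction|reflexivity]. }
  assert (Hd0 : in_disk (RtoC 0)) by (unfold in_disk; rewrite Cmod_0; lra).
  assert (fN : forall z, Cmod z < 1 -> z <> RtoC 0 -> f z <> RtoC 0).
  { intros z Hz Nz H. apply Nz. apply Hinj; [exact Hz|exact Hd0|]. now rewrite f0. }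
  assert (QN : forall z, Cmod z < 1 -> Q z <> RtoC 0).
  { intros z Hz. destruct (Ceq_dec z (RtoC 0)) as [->|Nz].
    - rewrite Q0. intros H. apply RtoC_inj in H. lra.
    - rewrite Qf by exact Nz. intros H. apply (fN z Hz Nz).
      replace (f z) with (f z / z * z)%C by (field; exact Nz). rewrite H. ring. }
  destruct (inverse_sqrt qc Q HQ Q0 QN) as (k & k' & Dk & k0 & Hk).
  destruct (holo_pser _ _ Dk) as [ka Hka].
  (* [s] lists the coefficients 1, -a_2, b_1, b_2, b_3, ... of z/f(z). *)
  destruct (holo_pser _ _ (holo_mult _ _ _ _ Dk Dk)) as [s Hs].
  assert (H1 : pser (fun n => match n with O => RtoC 1 | S _ => RtoC 0 end) (fun z => k z * k z * Q z)%C).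
  { intros z Hz. rewrite Hk by exact Hz. now apply (pser_const (RtoC 1)). }
  assert (Hsq := fun n => pser_mult_coeff n _ _ _ _ _ Hs HQ H1).
  assert (Hss := fun n => pser_mult_coeff n _ _ _ _ _ Hka Hka Hs).
  assert (ka0 : ka 0%nat = RtoC 1) by (rewrite <- (pser_0 _ _ Hka); exact k0).
  assert (s0 : s 0%nat = RtoC 1) by (rewrite (Hss 0%nat); simpl; rewrite ka0; ring).
  assert (E1 := Hsq 1%nat). assert (E2 := Hsq 2%nat). assert (E3 := Hsq 3%nat). assert (E4 := Hsq 4%nat).
  assert (F1 := Hss 1%nat). assert (F2 := Hss 2%nat). assert (F3 := Hss 3%nat). assert (F4 := Hss 4%nat).
  simpl in E1, E2, E3, E4, F1, F2, F3, F4. rewrite a3 in *. rewrite s0 in *. rewrite ka0 in *.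
  assert (S1 : s 1%nat = (- a 2%nat)%C).
  { replace (s 1%nat) with ((1 * a 2%nat + s 1%nat * 1) - a 2%nat)%C by ring. rewrite <- E1. ring. }
  rewrite S1 in *.
  assert (S2 : s 2%nat = (a 2%nat * a 2%nat)%C).
  { replace (s 2%nat) with ((1 * 0 + (- a 2%nat * a 2%nat + s 2%nat * 1)) + a 2%nat * a 2%nat)%C by ring.
    rewrite <- E2. ring. }
  rewrite S2 in *.
  assert (S3 : s 3%nat = (- (a 4%nat + a 2%nat * a 2%nat * a 2%nat))%C).
  { replace (s 3%nat) with ((1 * a 4%nat + (- a 2%nat * 0 + (a 2%nat * a 2%nat * a 2%nat + s 3%nat * 1)))
      - (a 4%nat + a 2%nat * a 2%nat * a 2%nat))%C by ring. rewrite <- E3. ring. }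
  rewrite S3 in *.
  assert (S4 : s 4%nat = (2 * a 2%nat * a 4%nat + a 2%nat * a 2%nat * a 2%nat * a 2%nat - a 5%nat)%C).
  { replace (s 4%nat) with ((1 * a 5%nat + (- a 2%nat * a 4%nat + (a 2%nat * a 2%nat * 0 +
      (- (a 4%nat + a 2%nat * a 2%nat * a 2%nat) * a 2%nat + s 4%nat * 1))))
      + (2 * a 2%nat * a 4%nat + a 2%nat * a 2%nat * a 2%nat * a 2%nat - a 5%nat))%C by ring.
    rewrite <- E4. ring. }
  rewrite S4 in *.
  assert (N2 : RtoC 2 <> RtoC 0) by (intros H; apply RtoC_inj in H; lra).
  assert (A2 : a 2%nat = (- (2) * ka 1%nat)%C).
  { replace (a 2%nat) with (- - a 2%nat)%C by ring. rewrite F1. ring. }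
  rewrite A2 in *.
  assert (K2 : ka 2%nat = (3 / 2 * ka 1%nat ^ 2)%C).
  { replace (ka 2%nat) with ((1 * ka 2%nat + (ka 1%nat * ka 1%nat + ka 2%nat * 1) - ka 1%nat * ka 1%nat) / 2)%C
      by (field; exact N2).
    rewrite <- F2. field. }
  rewrite K2 in *.
  assert (A4 : a 4%nat = (- (2) * ka 3%nat + 5 * ka 1%nat ^ 3)%C).
  { replace (a 4%nat) with (- - (a 4%nat + - (2) * ka 1%nat * (- (2) * ka 1%nat) * (- (2) * ka 1%nat))
      - - (2) * ka 1%nat * (- (2) * ka 1%nat) * (- (2) * ka 1%nat))%C by ring.
    rewrite F3. field. }
  rewrite A4 in *.
  assert (A5 : a 5%nat = (- (2) * ka 4%nat + 6 * ka 1%nat * ka 3%nat - 25 / 4 * ka 1%nat ^ 4)%C).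
  { match type of F4 with (?u - _)%C = ?v => replace (a 5%nat) with (u - v)%C by (rewrite <- F4; ring) end.
    replace (25 / 4)%C with (25 / (2 * 2))%C by (rewrite <- RtoC_mult; do 2 f_equal; lra).
    field. }
  exists (ka 1%nat), (ka 3%nat), (ka 4%nat).
  split; [reflexivity|]. split; [reflexivity|]. split; [exact A5|].
  (* Only even powers occur in k(z^2), so below 8 the weights 1, 3, 5, 7 meet k_1, k_2, k_3, k_4.
     The weight 3 with k_2 = 3/2 k_1^2 gives 27/4 |k_1|^4. *)
  assert (Area2 : rsum (fun n => INR n * Cmod (even_coeff ka (S n)) ^ 2) 8 <= 1).
  { assert (Hp := pser_square_arg _ _ Hka).
    destruct (pser_deriv _ _ Hp) as [p' [Dp _]].
    apply (area_theorem _ _ _ Hp Dp); [exact ka0|reflexivity|].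
    intros z w Hz Hw E.
    assert (Nw : w <> RtoC 0) by (apply Cmod_gt_0; lra).
    assert (Hsq1 : forall v, 0 < Cmod v < 1 -> Cmod (v * v) < 1).
    { intros v Hv. rewrite Cmod_mult. nra. }
    (* The square of k(v^2)/v is 1/f(v^2). Equal values therefore give z^2 = w^2, and z = -w is
       excluded because k(v^2)/v is odd and has no zero. *)
    assert (Kf : forall v, 0 < Cmod v < 1 -> ((k (v * v)%C / v) * (k (v * v)%C / v) * f (v * v)%C)%C = RtoC 1).
    { intros v Hv. assert (Nv : v <> RtoC 0) by (apply Cmod_gt_0; lra).
      assert (Nvv : (v * v)%C <> RtoC 0) by now apply Cmult_neq_0.
      rewrite <- (Hk (v * v)%C (Hsq1 v Hv)), Qf by exact Nvv. field. exact Nv. }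
    assert (Kz := Kf z Hz). assert (Kw := Kf w Hw). rewrite <- E in Kw.
    assert (Ef : f (z * z)%C = f (w * w)%C).
    { set (g := (k (z * z)%C / z * (k (z * z)%C / z))%C) in *.
      replace (f (z * z)%C) with (f (z * z)%C * (g * f (w * w)%C))%C by (rewrite Kw; ring).
      replace (f (z * z)%C * (g * f (w * w)%C))%C with ((g * f (z * z)%C) * f (w * w)%C)%C by ring.
      rewrite Kz. ring. }
    apply Hinj in Ef; [|apply (Hsq1 z Hz)|apply (Hsq1 w Hw)].
    assert (Hprod : ((z - w) * (z + w))%C = RtoC 0).
    { replace ((z - w) * (z + w))%C with (z * z - w * w)%C by ring. rewrite Ef. ring. }
    destruct (Ceq_dec z w) as [Heq|Hne]; [exact Heq|]. exfalso.
    assert (Hzw : (z + w)%C = RtoC 0).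
    { destruct (Ceq_dec (z + w)%C (RtoC 0)) as [H|H]; [exact H|]. exfalso.
      apply (Cmult_neq_0 (z - w) (z + w)); [|exact H|exact Hprod].
      intros H'. apply Hne. replace z with (z - w + w)%C by ring. rewrite H'. ring. }
    assert (Ez : z = (- w)%C) by (replace z with (z + w - w)%C by ring; rewrite Hzw; ring).
    assert (Kne : k (w * w)%C <> RtoC 0).
    { intros H. assert (H2 := Hk (w * w)%C (Hsq1 w Hw)). rewrite H in H2.
      rewrite !Cmult_0_l in H2. apply RtoC_inj in H2. lra. }
    rewrite Ef, Ez in E.
    assert (H2 : (2 * k (w * w)%C)%C = RtoC 0).
    { replace (2 * k (w * w)%C)%C with (w * (k (w * w)%C / w - k (w * w)%C / - w))%C
        by (field; repeat split; try exact Nw; intros H; apply Nw; replace w with (- - w)%C by ring; rewrite H; ring).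
      rewrite E. ring. }
    apply (Cmult_neq_0 2 (k (w * w)%C)); assumption. }
  assert (Area1 : rsum (fun n => INR n * Cmod (match S n with 1%nat => RtoC 0 | j => s j end) ^ 2) 4 <= 1).
  { set (c := fun j => match j with 1%nat => RtoC 0 | j => s j end).
    change (rsum (fun n => INR n * Cmod (c (S n)) ^ 2) 4 <= 1).
    (* Removing the constant term -a_2 of 1/f(z) secures the normalization [c 1 = 0] and keeps the
       map injective. *)
    set (p := fun z => (k z * k z + - s 1%nat * z)%C).
    assert (Hc : pser c p).
    { intros z Hz. set (m := fun j : nat => match j with 1%nat => (- s 1%nat)%C | _ => RtoC 0 end).
      assert (Hm : cseries (fun j => m j * z ^ j)%C (- s 1%nat * z)%C).
      { replace (- s 1%nat * z)%C with (m 0%nat * z ^ 0 + - s 1%nat * z)%C by (simpl; ring).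
        apply (cseries_cons (fun j => m j * z ^ j)%C).
        replace (- s 1%nat * z)%C with (m 1%nat * z ^ 1 + 0)%C by (simpl; ring).
        apply (cseries_cons (fun j => m (S j) * z ^ S j)%C).
        eapply cseries_ext; [|apply cseries_zero]. intros j. simpl. ring. }
      eapply cseries_ext; [|apply (cseries_plus _ _ _ _ (Hs z Hz) Hm)].
      intros [|[|j]]; simpl; ring. }
    destruct (pser_deriv _ _ Hc) as [p' [Dp _]].
    apply (area_theorem _ _ _ Hc Dp); [exact s0|reflexivity|].
    intros z w Hz Hw E.
    assert (Kf : forall v, 0 < Cmod v < 1 -> ((p v / v + s 1%nat) * f v)%C = RtoC 1).
    { intros v Hv. assert (Nv : v <> RtoC 0) by (apply Cmod_gt_0; lra).
      rewrite <- (Hk v ltac:(lra)), Qf by exact Nv. unfold p. field. exact Nv. }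
    assert (Kz := Kf z Hz). assert (Kw := Kf w Hw). rewrite <- E in Kw.
    apply Hinj; [apply Hz|apply Hw|].
    set (g := (p z / z + s 1%nat)%C) in *.
    replace (f z) with (f z * (g * f w))%C by (rewrite Kw; ring).
    replace (f z * (g * f w))%C with ((g * f z) * f w)%C by ring. rewrite Kz. ring. }
  simpl in Area1. rewrite S2, S3, S4 in Area1.
  unfold even_coeff in Area2. simpl in Area2. rewrite K2 in Area2.
  rewrite Cmod_0 in Area2.
  set (x := Cmod (ka 1%nat)) in *.
  split; [|split].
  - assert (Ek : Cmod (3 / 2 * ka 1%nat ^ 2) = 3 / 2 * x ^ 2).
    { rewrite Cmod_mult, Cmod_pow, <- RtoC_div, Cmod_R, Rabs_pos_eq by lra. reflexivity. }
    rewrite Ek in Area2. simpl in Area2 |- *. lra.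
  - assert (E2x : Cmod (- (2) * ka 1%nat) = 2 * x).
    { rewrite Cmod_mult, Cmod_opp, Cmod_R, Rabs_pos_eq by lra. reflexivity. }
    rewrite E2x.
    rewrite (Cmod_mult (- (2) * ka 1%nat) (- (2) * ka 1%nat)), E2x in Area1.
    set (y3 := Cmod (- _)%C) in Area1. set (y4 := Cmod (_ - _)%C) in Area1.
    set (u := 2 * x * (2 * x)) in Area1.
    assert (Hu : u <= 1) by nra. unfold u in Hu. nra.
  - unfold H3_1. rewrite a3, A2, A4.
    (* [t2], [t3], [t4] are the coefficients [b_1], [b_2], [b_3] of [1 / f] *)
    match type of Area1 with context [Cmod (?u - a 5%nat)%C] => set (t4 := (u - a 5%nat)%C) in Area1 end.
    set (t2 := (- (2) * ka 1%nat * (- (2) * ka 1%nat))%C) in Area1.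
    match type of Area1 with context [Cmod (- ?u)%C] => set (t3 := (- u)%C) in Area1 end.
    match goal with |- Cmod ?u <= _ => replace u with (t2 * t4 - t3 * t3)%C
      by (unfold t3, t4, t2; ring) end.
    eapply Rle_trans; [apply Cmod_triangle_minus|]. rewrite !Cmod_mult.
    (* |t2| |t4| <= (|t2|^2 + 3 |t4|^2) / 2; adding |t3|^2 gives half of the left side of the area
       inequality. *)
    nra.
Qed.

(** * The extremal constants *)

Lemma le_sqrt_of_sq (x y : R) : 0 <= x -> 0 <= y -> x ^ 2 <= y -> x <= sqrt y.
Proof.
  intros Hx Hy H. rewrite <- (sqrt_pow2 x Hx). now apply sqrt_le_1_alt.
Qed.

Lemma sqrt_le_of_sq (x y : R) : 0 <= x -> 0 <= y -> y <= x ^ 2 -> sqrt y <= x.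
Proof.
  intros Hx Hy H. rewrite <- (sqrt_pow2 x Hx). now apply sqrt_le_1_alt.
Qed.

Lemma inv_sqrt_bounds (k lo hi : R) : 0 < k -> 0 < lo -> 0 < hi ->
  lo ^ 2 * k <= 1 -> 1 <= hi ^ 2 * k -> lo <= / sqrt k <= hi.
Proof.
  intros Hk Hl Hh H1 H2. assert (Hs := sqrt_lt_R0 k Hk).
  assert (E : sqrt k ^ 2 = k) by (apply pow2_sqrt; lra).
  assert (Ei : / sqrt k * sqrt k = 1) by (field; lra).
  set (i := / sqrt k) in *. set (s := sqrt k) in *.
  split; apply (Rmult_le_reg_r s); try exact Hs; rewrite Ei.
  - rewrite <- E in H1. rewrite <- Rpow_mult_distr in H1. nra.
  - rewrite <- E in H2. rewrite <- Rpow_mult_distr in H2. assert (0 <= hi * s) by nra. nra.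
Qed.

Lemma inv_sqrt7_bounds : 0.37796447300922 <= / sqrt 7 <= 0.37796447300923.
Proof. apply inv_sqrt_bounds; lra. Qed.

Lemma inv_sqrt5_bounds : 0.44721359549995 <= / sqrt 5 <= 0.44721359549996.
Proof. apply inv_sqrt_bounds; lra. Qed.

Lemma Rad_sq (x : R) : 0 <= x <= 1 / 2 -> Rad x ^ 2 = 1 - x ^ 2 - 27 / 4 * x ^ 4.
Proof.
  intros Hx. unfold Rad. apply pow2_sqrt.
  assert (x ^ 2 <= 1 / 4) by nra. replace (x ^ 4) with (x ^ 2 * x ^ 2) by ring.
  assert (0 <= x ^ 2) by nra. nra.
Qed.

Lemma Rad_nonneg (x : R) : 0 <= Rad x.
Proof. apply sqrt_pos. Qed.

(* AM-GM, with equality when [Rad x = m] *)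
Lemma Rad_upper (x m : R) : 0 <= x <= 1 / 2 -> 0 < m ->
  Rad x <= (1 - x ^ 2 - 27 / 4 * x ^ 4 + m ^ 2) / (2 * m).
Proof.
  intros Hx Hm. rewrite <- Rad_sq by exact Hx.
  apply (Rmult_le_reg_r (2 * m)); [lra|].
  replace ((Rad x ^ 2 + m ^ 2) / (2 * m) * (2 * m)) with (Rad x ^ 2 + m ^ 2) by (field; lra).
  assert (0 <= (Rad x - m) ^ 2) by apply pow2_ge_0. nra.
Qed.

Lemma Rad_lower (x r : R) : 0 <= r -> r ^ 2 <= 1 - x ^ 2 - 27 / 4 * x ^ 4 -> r <= Rad x.
Proof.
  intros Hr H. apply le_sqrt_of_sq; [exact Hr| |exact H]. assert (0 <= r ^ 2) by apply pow2_ge_0. lra.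
Qed.

(* The maximum is attained near 0.439578850167, where [Rad] is about 0.744809503036. *)
Lemma c3_bounds : 1.674896577 <= c3 < 1.674896578.
Proof.
  destruct c3_is_max as [[x [Hx E]] Hmax]. assert (B7 := inv_sqrt7_bounds). assert (B5 := inv_sqrt5_bounds).
  split.
  - apply Rle_trans with (F3 0.439579); [|apply Hmax; lra].
    assert (Hr : 0.7448091839 <= Rad 0.439579) by (apply Rad_lower; lra).
    unfold F3, Rdiv.
    nra.
  - rewrite <- E. assert (Hu := Rad_upper x 0.744809503036 Hx ltac:(lra)).
    assert (Hn := Rad_nonneg x). unfold F3, Rdiv in *.
    set (r := Rad x) in *.
    assert (H1 : (2 * / sqrt 7 + 6 * / sqrt 5 * x) * r <= (2 * 0.37796447300923 + 6 * 0.44721359549996 * x) * r).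
    { apply Rmult_le_compat_r; [exact Hn|]. nra. }
    assert (H2 : (2 * 0.37796447300923 + 6 * 0.44721359549996 * x) * r <=
      (2 * 0.37796447300923 + 6 * 0.44721359549996 * x) *
      ((1 - x ^ 2 - 27 * / 4 * x ^ 4 + 0.744809503036 ^ 2) * / (2 * 0.744809503036))).
    { apply Rmult_le_compat_l; [nra|exact Hu]. }
    eapply Rle_lt_trans; [apply Rplus_le_compat_r, Rle_trans with (1 := H1), H2|].
    (* What remains is a polynomial inequality of degree 5 in x, almost an equality at this point.
       [lra] combines it from the nonnegative products x^k d^2 and the range of x. *)
    set (d := x - 0.439578850167).
    assert (D0 : 0 <= d ^ 2) by apply pow2_ge_0.
    assert (D1 : 0 <= x * d ^ 2) by nra.
    assert (D2 : 0 <= x ^ 2 * d ^ 2) by nra.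
    assert (D3 : 0 <= x ^ 3 * d ^ 2) by (apply Rmult_le_pos; [apply pow_le; lra|exact D0]).
    unfold d in *. lra.
Qed.

(* The maximum is attained at [1 / 2], where [Rad] is about 0.5728. *)
Lemma c4_bounds : 1.1373 <= c4 < 1.1374.
Proof.
  destruct c4_is_max as [[x [Hx E]] Hmax]. assert (B5 := inv_sqrt5_bounds).
  split.
  - apply Rle_trans with (F4 (1 / 2)); [|apply Hmax; lra].
    assert (Hr : 0.5728 <= Rad (1 / 2)) by (apply Rad_lower; lra).
    unfold F4, Rdiv in *. nra.
  - rewrite <- E. assert (Hu := Rad_upper x 0.5728 Hx ltac:(lra)).
    assert (Hn := Rad_nonneg x). unfold F4, Rdiv in *.
    set (r := Rad x) in *.
    assert (H1 : 4 * / sqrt 5 * x * r <= 4 * 0.44721359549996 * x * r).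
    { apply Rmult_le_compat_r; [exact Hn|]. nra. }
    assert (H2 : 4 * 0.44721359549996 * x * r <= 4 * 0.44721359549996 * x *
      ((1 - x ^ 2 - 27 * / 4 * x ^ 4 + 0.5728 ^ 2) * / (2 * 0.5728))).
    { apply Rmult_le_compat_l; [nra|exact Hu]. }
    eapply Rle_lt_trans; [apply Rplus_le_compat_r, Rle_trans with (1 := H1), H2|].
    (* The maximum lies at the end point, so multiples of 1/2 - x to the first power are available
       besides those of its square. *)
    assert (T : forall n, 0 <= x ^ n * (1 / 2 - x)).
    { intros n. apply Rmult_le_pos; [apply pow_le|]; lra. }
    assert (T' : forall n, 0 <= x ^ n * (1 / 2 - x) ^ 2).
    { intros n. apply Rmult_le_pos; [apply pow_le; lra|apply pow2_ge_0]. }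
    assert (T1 := T 1%nat). assert (T2 := T' 2%nat).
    assert (T3 := T' 3%nat). assert (T4 := T 2%nat). lra.
Qed.

(* The maximum is attained near 0.458573270517, where [Rad] is about 0.700866902555. *)
Lemma c5_bounds : 0.6647958756 <= c5 < 0.6647958757.
Proof.
  destruct c5_is_max as [[x [Hx E]] Hmax]. assert (B7 := inv_sqrt7_bounds). assert (B5 := inv_sqrt5_bounds).
  split.
  - apply Rle_trans with (F5 0.4585733); [|apply Hmax; lra].
    assert (Hr : 0.7008668285 <= Rad 0.4585733) by (apply Rad_lower; lra).
    unfold F5, Rdiv. rewrite Rad_sq by lra. set (r := Rad 0.4585733) in *.
    assert (H : 4 * 0.44721359549995 * 0.4585733 ^ 3 + 8 * 0.37796447300922 * 0.4585733 ^ 2 <=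
      4 * / sqrt 5 * 0.4585733 ^ 3 + 8 * / sqrt 7 * 0.4585733 ^ 2) by lra.
    set (q := 4 * / sqrt 5 * 0.4585733 ^ 3 + 8 * / sqrt 7 * 0.4585733 ^ 2) in *.
    assert (H1 : (4 * 0.44721359549995 * 0.4585733 ^ 3 + 8 * 0.37796447300922 * 0.4585733 ^ 2) * 0.7008668285 <= q * r).
    { apply Rmult_le_compat; lra. }
    lra.
  - rewrite <- E. assert (Hu := Rad_upper x 0.700866902555 Hx ltac:(lra)).
    assert (Hn := Rad_nonneg x). unfold F5, Rdiv in *. rewrite Rad_sq by exact Hx.
    set (r := Rad x) in *.
    assert (X3 : 0 <= x ^ 3) by (apply pow_le; lra).
    assert (H1 : (4 * / sqrt 5 * x ^ 3 + 8 * / sqrt 7 * x ^ 2) * r <=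
      (4 * 0.44721359549996 * x ^ 3 + 8 * 0.37796447300923 * x ^ 2) * r).
    { apply Rmult_le_compat_r; [exact Hn|]. nra. }
    assert (H2 : (4 * 0.44721359549996 * x ^ 3 + 8 * 0.37796447300923 * x ^ 2) * r <=
      (4 * 0.44721359549996 * x ^ 3 + 8 * 0.37796447300923 * x ^ 2) *
      ((1 - x ^ 2 - 27 * / 4 * x ^ 4 + 0.700866902555 ^ 2) * / (2 * 0.700866902555))).
    { apply Rmult_le_compat_l; [nra|exact Hu]. }
    eapply Rle_lt_trans; [apply Rplus_le_compat_l, Rle_trans with (1 := H1), H2|].
    (* Again nearly a double zero of the gap; the polynomial now has degree 7, hence the products up
       to x^5 d^2. *)
    set (d := x - 0.458573270517).
    assert (D : forall n, 0 <= x ^ n * d ^ 2).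
    { intros n. apply Rmult_le_pos; [apply pow_le; lra|apply pow2_ge_0]. }
    assert (D0 := D 0%nat). assert (D1 := D 1%nat). assert (D2 := D 2%nat).
    assert (D3 := D 3%nat). assert (D4 := D 4%nat). assert (D5 := D 5%nat).
    unfold d in *. lra.
Qed.

Lemma a4_bound_value : 1.1373 <= 1 / 4 * sqrt (21 / 5) + 5 / 8 < 1.1374.
Proof.
  assert (2.0493 <= sqrt (21 / 5)) by (apply le_sqrt_of_sq; lra).
  assert (sqrt (21 / 5) <= 2.0494) by (apply sqrt_le_of_sq; lra). lra.
Qed.

(** The constant is the value of 2 y + 5 x^3 at x = 1/2, where the constraint becomes 5 y^2 = 21/64,
    that is y = sqrt(21/5) / 8. *)
Lemma a4_bound (x y : R) : 0 <= x <= 1 / 2 -> 0 <= y -> 5 * y ^ 2 <= 1 - x ^ 2 - 27 / 4 * x ^ 4 ->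
  2 * y + 5 * x ^ 3 <= 1 / 4 * sqrt (21 / 5) + 5 / 8.
Proof.
  intros Hx Hy H.
  assert (S1 : 2.0493 <= sqrt (21 / 5)) by (apply le_sqrt_of_sq; lra).
  assert (S2 : sqrt (21 / 5) <= 2.0494) by (apply sqrt_le_of_sq; lra).
  assert (S3 : sqrt (21 / 5) ^ 2 = 21 / 5) by (apply pow2_sqrt; lra).
  set (s := sqrt (21 / 5)) in *.
  (* AM-GM with equality at [x = 1 / 2], [y = s / 8] *)
  assert (A : 2 * y <= 40 / 21 * s * y ^ 2 + s / 8).
  { assert (0 <= s * (y - s / 8) ^ 2) by (apply Rmult_le_pos; [lra|apply pow2_ge_0]).
    assert (E : s * (y - s / 8) ^ 2 = s * y ^ 2 - s ^ 2 * y / 4 + s ^ 2 * s / 64) by field.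
    rewrite S3 in E. lra. }
  assert (B : s * y ^ 2 <= s * ((1 - x ^ 2 - 27 / 4 * x ^ 4) / 5)) by (apply Rmult_le_compat_l; lra).
  set (w := 1 / 2 - x).
  (* After the AM-GM step the two sides agree at x = 1/2; [Cc] is the remaining inequality divided
     by w = 1/2 - x. *)
  assert (Cc : 8 / 21 * s * ((1 / 2 + x) * (1 + 27 / 4 * (1 / 4 + x ^ 2))) <= 5 * (1 / 4 + x / 2 + x ^ 2)).
  { assert (8 / 21 * s <= 0.7808) by lra.
    assert (0 <= (1 / 2 + x) * (1 + 27 / 4 * (1 / 4 + x ^ 2))) by nra.
    apply Rle_trans with (0.7808 * ((1 / 2 + x) * (1 + 27 / 4 * (1 / 4 + x ^ 2)))).
    - apply Rmult_le_compat_r; assumption.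
    - assert (0 <= x * (1 / 2 - x)) by nra. assert (0 <= x ^ 2 * (1 / 2 - x)) by nra. nra. }
  assert (Hw : 0 <= w) by (unfold w; lra).
  apply (Rmult_le_compat_l w) in Cc; [|exact Hw].
  assert (E1 : w * (8 / 21 * s * ((1 / 2 + x) * (1 + 27 / 4 * (1 / 4 + x ^ 2))))
    = 8 / 21 * (s * (1 - x ^ 2 - 27 / 4 * x ^ 4)) - s / 8) by (unfold w; field).
  assert (E2 : w * (5 * (1 / 4 + x / 2 + x ^ 2)) = 5 / 8 - 5 * x ^ 3) by (unfold w; field).
  lra.
Qed.

(** Used with k = 5 for |k_3| and k = 7 for |k_4|, the source of the factors 1/sqrt 5 and 1/sqrt 7
    in [F3] and [F4]. *)
Lemma weighted_le_Rad (k x y : R) : 0 < k -> 0 <= y ->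
  k * y ^ 2 <= 1 - x ^ 2 - 27 / 4 * x ^ 4 -> y <= Rad x * / sqrt k.
Proof.
  intros Hk Hy H. assert (Hs := sqrt_lt_R0 k Hk).
  apply (Rmult_le_reg_r (sqrt k)); [exact Hs|].
  replace (Rad x * / sqrt k * sqrt k) with (Rad x) by (field; lra).
  apply Rad_lower; [apply Rmult_le_pos; lra|].
  rewrite Rpow_mult_distr, pow2_sqrt by lra. lra.
Qed.

Theorem theorem5 :
  forall (f : C -> C) (a : nat -> C),
    class_S f ->
    has_expansion f a ->
    a 3%nat = RtoC 0 ->
    Cmod (a 2%nat) <= 1 /\
    (Cmod (a 4%nat) <= 1 / 4 * sqrt (21 / 5) + 5 / 8 /\
     1.1373 <= 1 / 4 * sqrt (21 / 5) + 5 / 8 < 1.1374) /\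
    (Cmod (a 5%nat) <= c3 /\ 1.674896577 <= c3 < 1.674896578) /\
    (Cmod (H2_2 a) <= c4 /\ 1.1373 <= c4 < 1.1374) /\
    (Cmod (H3_1 a) <= c5 /\ 0.6647958756 <= c5 < 0.6647958757).
Proof.
  intros f a Hf Ha a3.
  destruct (univalent_coefficients f a Hf Ha a3)
    as (k1 & k3 & k4 & E2 & E4 & E5 & Harea & H2 & H3).
  (* Part (v) follows from |H_3(1)| <= 1/2, which lies below the lower bound for [c5]. *)
  assert (B5 := c5_bounds).
  set (x := Cmod k1) in *. set (y := Cmod k3) in *. set (w := Cmod k4) in *.
  assert (Px : 0 <= x) by apply Cmod_ge_0. assert (Py : 0 <= y) by apply Cmod_ge_0.
  assert (Pw : 0 <= w) by apply Cmod_ge_0.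
  assert (C2 : forall t : R, 0 <= t -> Cmod (- RtoC t) = t).
  { intros t Ht. rewrite Cmod_opp, Cmod_R. now apply Rabs_pos_eq. }
  assert (C1 : forall t : R, 0 <= t -> Cmod (RtoC t) = t).
  { intros t Ht. rewrite Cmod_R. now apply Rabs_pos_eq. }
  assert (Hx : 0 <= x <= 1 / 2).
  { assert (H2' := H2). rewrite E2, Cmod_mult, C2 in H2' by lra. fold x in H2'. lra. }
  assert (Y2 : 0 <= y ^ 2) by apply pow2_ge_0. assert (W2 : 0 <= w ^ 2) by apply pow2_ge_0.
  assert (Hy : 5 * y ^ 2 <= 1 - x ^ 2 - 27 / 4 * x ^ 4) by lra.
  assert (Hw : 7 * w ^ 2 <= 1 - x ^ 2 - 27 / 4 * x ^ 4) by lra.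
  assert (Ry := weighted_le_Rad 5 x y ltac:(lra) Py Hy).
  assert (Rw := weighted_le_Rad 7 x w ltac:(lra) Pw Hw).
  split; [exact H2|]. split; [split; [|exact a4_bound_value]|].
  - eapply Rle_trans; [|exact (a4_bound x y Hx Py Hy)].
    rewrite E4. eapply Rle_trans; [apply Cmod_triangle|].
    rewrite !Cmod_mult, Cmod_pow, C2, C1 by lra. apply Rle_refl.
  - split; [split; [|exact c3_bounds]|split; [split; [|exact c4_bounds]|split; [lra|exact B5]]].
    + apply Rle_trans with (F3 x); [|apply c3_is_max, Hx].
      rewrite E5. eapply Rle_trans; [apply Cmod_triangle_minus|].
      eapply Rle_trans; [apply Rplus_le_compat_r, Cmod_triangle|].
      rewrite !Cmod_mult, Cmod_pow, <- RtoC_div, C2, !C1 by lra. fold x y w.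
      unfold F3, Rdiv.
      assert (x * y <= x * (Rad x * / sqrt 5)) by (apply Rmult_le_compat_l; assumption). lra.
    + apply Rle_trans with (F4 x); [|apply c4_is_max, Hx].
      unfold H2_2. rewrite a3, E2, E4.
      replace (- (2) * k1 * (- (2) * k3 + 5 * k1 ^ 3) - 0 ^ 2)%C with
        (4 * k1 * k3 - 10 * k1 ^ 4)%C by (simpl; ring).
      eapply Rle_trans; [apply Cmod_triangle_minus|].
      rewrite !Cmod_mult, Cmod_pow, !C1 by lra. fold x y.
      unfold F4, Rdiv.
      assert (x * y <= x * (Rad x * / sqrt 5)) by (apply Rmult_le_compat_l; assumption). lra.
Qed.
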